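(* Let $N\supseteq D$ be $\sigma$-finite von Neumann algebras, $\theta:D\to N$ an injective normal unital $*$-homomorphism, $E_D^N:N\to D$ and $E_{\theta(D)}^N:N\to\theta(D)$ faithful normal conditional expectations, and let $(M,E_N^M,u(\theta))=(N,E_D^N)\bigstar_D(\theta,E_{\theta(D)}^N)$ be the HNN extension. Let $$(\mathcal{M},\mathcal{E}):=\big(N\otimes M_2(\mathbf{C}),E_\theta:\iota_\theta\big)\bigstar_{D\oplus D}\big(D\otimes M_2(\mathbf{C}),E_1:\iota_1\big)$$ be the amalgamated free product of von Neumann algebras with canonical embeddings $\lambda_\theta:N\otimes M_2(\mathbf{C})\to\mathcal{M}$, $\lambda_1:D\otimes M_2(\mathbf{C})\to\mathcal{M}$, where $\iota_\theta((d_1,d_2))=\begin{bmatrix} d_1&0\\0&\theta(d_2)\end{bmatrix}$, $\iota_1((d_1,d_2))=\begin{bmatrix} d_1&0\\0&d_2\end{bmatrix}$, $E_\theta([n_{ij}])=\begin{bmatrix}E_D^N(n_{11})&0\\0&E_{\theta(D)}^N(n_{22})\end{bmatrix}$, $E_1([d_{ij}])=\begin{bmatrix}d_{11}&0\\0&d_{22}\end{bmatrix}$. Let $\mathcal{E}_\theta$ be the conditional expectation from $\mathcal{M}$ onto $\lambda_\theta(N\otimes M_2(\mathbf{C}))$ satisfying $\mathcal{E}\circ\mathcal{E}_\theta=\mathcal{E}$. Then there is a bijective $*$-homomorphism $\Phi:\mathcal{M}\to M\otimes M_2(\mathbf{C})$ such that $\Phi(\lambda_\theta(N\otimes M_2(\mathbf{C})))=N\otimes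 M_2(\mathbf{C})\subseteq M\otimes M_2(\mathbf{C})$ and $$\Phi\circ\mathcal{E}_\theta=(E_N^M\otimes\mathrm{Id})\circ\Phi,$$ and $\Phi$ is precisely given by $$\lambda_1\Big(\begin{bmatrix}0&1\\0&0\end{bmatrix}\Big)\lambda_\theta\Big(\begin{bmatrix}0&0\\1&0\end{bmatrix}\Big)\mapsto\begin{bmatrix}u(\theta)&0\\0&0\end{bmatrix},\quad \lambda_\theta\Big(\begin{bmatrix}n&0\\0&0\end{bmatrix}\Big)\mapsto\begin{bmatrix}n&0\\0&0\end{bmatrix}\ (n\in N),\quad \lambda_\theta\Big(\begin{bmatrix}0&1\\0&0\end{bmatrix}\Big)\mapsto\begin{bmatrix}0&1\\0&0\end{bmatrix}.$$
   Context: HNN extension of von Neumann algebras. For $N\supseteq D$, $\theta$, $E_D^N$, $E_{\theta(D)}^N$ as in the claim (all inclusions unital), the HNN extension $(N,E_D^N)\bigstar_D(\theta,E_{\theta(D)}^N)$ is the unique triple $(M,E_N^M,u(\theta))$ consisting of a von Neumann algebra $M\supseteq N$, a faithful normal conditional expectation $E_N^M:M\to N$ and a unitary $u(\theta)\in M$ (the stable unitary), such that $M$ is generated by $N$ and $u(\theta)$ and: (A) $u(\theta)\theta(d)u(\theta)^*=d$ for all $d\in D$; (M) $E_N^M(w)=0$ for every reduced word $w$. A word $w=u(\theta)^{\varepsilon_0}n_1u(\theta)^{\varepsilon_1}n_2\cdots n_\ell u(\theta)^{\varepsilon_\ell}$ ($\ell\ge0$, $n_j\in N$, $\varepsilon_j\in\{1,-1\}$)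 is reduced if for every $j$ with $\varepsilon_{j-1}\ne\varepsilon_j$: $n_j\in\mathrm{Ker}\,E_{\theta(D)}^N$ when $\varepsilon_{j-1}=1,\varepsilon_j=-1$, and $n_j\in\mathrm{Ker}\,E_D^N$ when $\varepsilon_{j-1}=-1,\varepsilon_j=1$. Amalgamated free product of von Neumann algebras. Given embeddings $\iota_i:Q\to P_i$ ($i=1,2$) and faithful normal conditional expectations $E_i:P_i\to\iota_i(Q)$, the amalgamated free product $(P,E)=(P_1,E_1:\iota_1)\bigstar_Q(P_2,E_2:\iota_2)$ is the unique von Neumann algebra $P$ with normal embeddings $\lambda_i:P_i\to P$ such that $\lambda:=\lambda_1\circ\iota_1=\lambda_2\circ\iota_2$ on $Q$, $P$ is generated by $\lambda_1(P_1)\cup\lambda_2(P_2)$, and with a faithful normal conditional expectation $E:P\to\lambda(Q)$ such that $E\circ\lambda_i=\lambda_i\circ E_i$ and $E(x_1\cdots x_m)=0$ whenever $x_j\in\lambda_{i_j}(\mathrm{Ker}E_{i_j})$ with $i_1\ne i_2\ne\cdots\ne i_m$ (freeness). In the claim $Q=D\oplus D$. Elements of $N\otimes M_2(\mathbf{C})$ are written as $2\times2$ matrices over $N$. *)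

(* Defs.v *)
From HB Require Import structures.
From mathcomp Require Import all_boot all_order all_algebra.
From mathcomp Require Import complex.
From mathcomp Require Import all_classical all_reals all_analysis.

Set Implicit Arguments.
Unset Strict Implicit.
Unset Printing Implicit Defensive.

Import Order.TTheory GRing.Theory Num.Theory.
Import numFieldNormedType.Exports.

Local Open Scope classical_set_scope.
Local Open Scope ring_scope.
Local Open Scope complex_scope.

(* Inner products are linear in the first variable. *)
Record hilbert (R : realType) := Hilbert {
  hspace :> lmodType R[i];
  inner : {dot hspace for Num.conj};
  hilbert_complete : forall x : nat -> hspace,
    (forall e : R, 0 < e -> exists k, forall m n, (k <= m)%N -> (k <= n)%N ->
       inner (x m - x n) (x m - x n) < e%:C) ->
    exists l, forall e : R, 0 < e -> exists k, forall n, (k <= n)%N ->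
       inner (x n - l) (x n - l) < e%:C }.

Definition ip (R : realType) (H : hilbert R) (x y : H) : R[i] := inner H x y.

Notation "'[ x , y ]" := (ip x y) : ring_scope.

(* Operators are bare functions; boundedness is a predicate, so that the maps
   between algebras below are total functions of which only the values on the
   algebra at hand matter. *)
Notation op H := (hspace H -> hspace H).

Section VonNeumann.
Context {R : realType}.
Implicit Types H K : hilbert R.

Definition bounded_op H (T : op H) :=
  linear T /\
  exists c : R, forall x, '[T x, T x] <= c%:C * '[x, x].

(* The adjoint of a bounded operator (unique, and existing by the Riesz
   representation theorem); a junk value on other functions. *)
Definition adj H (T : op H) : op H :=
  xget 0 [set S : op H | forall x y, '[T x, y] = '[x, S y]].

Definition pos_op H (T : op H) := forall x, 0 <= '[T x, x].

Definition commutant H (A : set (op H)) : set (op H) :=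
  [set T | bounded_op T /\ forall S, A S -> T \o S = S \o T].

Definition von_neumann H (A : set (op H)) :=
  [/\ A `<=` @bounded_op H,
      forall T, A T -> A (adj T) &
      commutant (commutant A) = A].

Definition vn_gen H (S : set (op H)) : set (op H) :=
  \bigcap_(A in [set A | von_neumann A /\ S `<=` A]) A.

Definition sigma_finite_vn H (A : set (op H)) :=
  forall P : set (op H),
    (forall p, P p -> [/\ A p, p \o p = p, adj p = p & p <> 0]) ->
    (forall p q, P p -> P q -> p <> q -> p \o q = 0) ->
    countable P.

Definition square_summable H (x : nat -> H) :=
  cvgn (series (fun k => '[x k, x k]) : nat -> R[i]^o).

Definition sw_form H (x y : nat -> H) (T : op H) : R[i]^o :=
  limn (series (fun k => '[T (x k), y k]) : nat -> R[i]^o).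

(* Convergence of a filter in the sigma-weak (ultraweak) topology. *)
Definition sw_cvg H (F : set_system (op H)) (T : op H) :=
  forall x y : nat -> H, square_summable x -> square_summable y ->
    sw_form x y @ F --> sw_form x y T.

(* Normality is sigma-weak continuity. *)
Definition normal_map H K (A : set (op H)) (f : op H -> op K) :=
  forall (F : set_system (op H)) (T : op H), ProperFilter F -> F A -> A T ->
    sw_cvg F T -> sw_cvg (f @ F) (f T).

Definition linear_on H K (A : set (op H)) (f : op H -> op K) :=
  forall (a : R[i]) S T, A S -> A T -> f (a *: S + T) = a *: f S + f T.

Definition star_hom H K (A : set (op H)) (B : set (op K))
    (f : op H -> op K) :=
  [/\ forall T, A T -> B (f T),
      linear_on A f,
      forall S T, A S -> A T -> f (S \o T) = f S \o f T &
      forall T, A T -> f (adj T) = adj (f T)].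

Definition normal_embedding H K (A : set (op H)) (B : set (op K))
    (f : op H -> op K) :=
  [/\ star_hom A B f, f idfun = idfun, set_inj A f & normal_map A f].

Definition cond_exp H (A B : set (op H)) (E : op H -> op H) :=
  [/\ forall T, A T -> B (E T),
      forall T, B T -> E T = T,
      linear_on A E,
      forall T, A T -> pos_op T -> pos_op (E T) &
      forall S T S', B S -> A T -> B S' -> E (S \o T \o S') = S \o E T \o S'].

Definition faithful_normal_cond_exp H (A B : set (op H)) (E : op H -> op H) :=
  [/\ cond_exp A B E,
      forall T, A T -> E (adj T \o T) = 0 -> T = 0 &
      normal_map A E].

(* In the letters eps_j of a word, true stands for 1 and false for -1. *)
Definition upow H (u : op H) (e : bool) : op H := if e then u else adj u.

(* (e0, [:: (n_1, e_1); ..; (n_l, e_l)]) encodes u^e0 n_1 u^e_1 .. n_l u^e_l. *)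
Fixpoint hnn_word H (u : op H) (e : bool) (w : seq (op H * bool)) : op H :=
  if w is (n, e') :: w' then upow u e \o n \o hnn_word u e' w' else upow u e.

Fixpoint hnn_reduced H (N : set (op H)) (ED Eth : op H -> op H) (e : bool)
    (w : seq (op H * bool)) : Prop :=
  if w is (n, e') :: w' then
    [/\ N n,
        e = true -> e' = false -> Eth n = 0,
        e = false -> e' = true -> ED n = 0 &
        hnn_reduced N ED Eth e' w']
  else True.

(* (M, EM, u) is the HNN extension of N by the partial isomorphism theta. The
   inclusions D <= N <= M are literal ones of operator algebras on H. *)
Definition is_hnn H (D N : set (op H)) (theta ED Eth : op H -> op H)
    (M : set (op H)) (EM : op H -> op H) (u : op H) :=
  [/\ von_neumann M /\ N `<=` M,
      faithful_normal_cond_exp M N EM,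
      [/\ M u, u \o adj u = idfun & adj u \o u = idfun],
      M = vn_gen (N `|` [set u]) &
      (forall d, D d -> u \o theta d \o adj u = d) /\
      (forall e w, hnn_reduced N ED Eth e w -> EM (hnn_word u e w) = 0)].

Definition ker_image H K (A : set (op H)) (E : op H -> op H)
    (l : op H -> op K) : set (op K) :=
  [set l T | T in [set T | A T /\ E T = 0]].

Definition op_prod H (w : seq (op H)) : op H := foldr (fun S T => S \o T) idfun w.

(* In a word, the label true (resp. false) marks an element of the kernel of E1
   (resp. E2). *)
Definition is_amalgamated_free_product (HQ H1 H2 H : hilbert R)
    (Q : set (op HQ))
    (P1 : set (op H1)) (E1 : op H1 -> op H1) (i1 : op HQ -> op H1)
    (P2 : set (op H2)) (E2 : op H2 -> op H2) (i2 : op HQ -> op H2)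
    (P : set (op H)) (E : op H -> op H)
    (l1 : op H1 -> op H) (l2 : op H2 -> op H) :=
  [/\ von_neumann P,
      [/\ normal_embedding P1 P l1, normal_embedding P2 P l2 &
          forall q, Q q -> l1 (i1 q) = l2 (i2 q)],
      P = vn_gen (l1 @` P1 `|` l2 @` P2),
      [/\ faithful_normal_cond_exp P [set l1 (i1 q) | q in Q] E,
          forall T, P1 T -> E (l1 T) = l1 (E1 T) &
          forall T, P2 T -> E (l2 T) = l2 (E2 T)] &
      forall w : seq (bool * op H), w != [::] ->
        sorted (fun a b : bool * op H => a.1 != b.1) w ->
        (forall (b : bool) (T : op H), (b, T) \in w ->
           (if b then ker_image P1 E1 l1 else ker_image P2 E2 l2) T) ->
        E (op_prod (map snd w)) = 0].

End VonNeumann.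



Section DirectSum.
Context {R : realType} (H : hilbert R).

Definition dsum_inner (x y : H * H) : R[i] := '[x.1, y.1] + '[x.2, y.2].

Fact dsum_zmodl y : zmod_morphism (dsum_inner ^~ y).
Proof.
by move=> x x'; rewrite /dsum_inner /ip /= !linearBl addrACA opprD.
Qed.

Fact dsum_zmodr x : zmod_morphism (dsum_inner x).
Proof.
by move=> y y'; rewrite /dsum_inner /ip /= !linearBr addrACA opprD.
Qed.

Fact dsum_scalel y : scalable_for *%R (dsum_inner ^~ y).
Proof. by move=> a x; rewrite /dsum_inner /ip /= !linearZl_LR mulrDr. Qed.

Fact dsum_scaler x : scalable_for (Num.conj \; *%R) (dsum_inner x).
Proof. by move=> a y; rewrite /dsum_inner /ip /= !linearZr_LR mulrDr. Qed.

Fact dsum_hermitian x y :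
  dsum_inner x y = (-1) ^+ false * Num.conj (dsum_inner y x).
Proof.
rewrite /dsum_inner /ip rmorphD mulrDr.
by congr (_ + _); rewrite -hermitian_subproof.
Qed.

Fact dsum_pos x : x != 0 -> 0 < dsum_inner x x.
Proof.
case: x => x y; rewrite /dsum_inner /ip /= => xy0.
rewrite lt_def addr_ge0 ?dnorm_ge0// andbT paddr_eq0 ?dnorm_ge0// !dnorm_eq0.
by apply: contra xy0 => /andP[/eqP-> /eqP->].
Qed.

HB.instance Definition _ := isBilinear.Build R[i] (H * H)%type (H * H)%type
  R[i] *%R (Num.conj \; *%R) dsum_inner
  dsum_zmodl dsum_zmodr dsum_scalel dsum_scaler.
HB.instance Definition _ := isHermitianSesquilinear.Build R[i] (H * H)%type
  false Num.conj dsum_inner dsum_hermitian.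
HB.instance Definition _ := isDotProduct.Build R[i] (H * H)%type
  dsum_inner dsum_pos.

Fact dsum_complete (x : nat -> H * H) :
  (forall e : R, 0 < e -> exists k, forall m n, (k <= m)%N -> (k <= n)%N ->
     dsum_inner (x m - x n) (x m - x n) < e%:C) ->
  exists l, forall e : R, 0 < e -> exists k, forall n, (k <= n)%N ->
     dsum_inner (x n - l) (x n - l) < e%:C.
Proof.
move=> cx.
have [|l1 h1] := @hilbert_complete R H (fst \o x).
  move=> e /cx[k hk]; exists k => m n km kn; apply: le_lt_trans (hk m n km kn).
  by rewrite /dsum_inner /ip lerDl dnorm_ge0.
have [|l2 h2] := @hilbert_complete R H (snd \o x).
  move=> e /cx[k hk]; exists k => m n km kn; apply: le_lt_trans (hk m n km kn).
  by rewrite /dsum_inner /ip lerDr dnorm_ge0.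
exists (l1, l2) => e e0.
have e20 : 0 < e / 2 by rewrite divr_gt0.
have [k1 hk1] := h1 _ e20; have [k2 hk2] := h2 _ e20.
exists (maxn k1 k2) => n; rewrite geq_max => /andP[kn1 kn2].
rewrite [e]splitr rmorphD; apply: ltrD; [exact: hk1|exact: hk2].
Qed.

(* The Hilbert space H (x) C^2 = H (+) H. *)
Definition dsum : hilbert R := Hilbert dsum_complete.

(* The operator matrix [[a, b], [c, d]]. *)
Definition block (a b c d : op H) : op dsum :=
  fun x => (a x.1 + b x.2, c x.1 + d x.2).

Definition ul (T : op dsum) : op H := fun x => (T (x, 0)).1.
Definition ur (T : op dsum) : op H := fun x => (T (0, x)).1.
Definition dl (T : op dsum) : op H := fun x => (T (x, 0)).2.
Definition dr (T : op dsum) : op H := fun x => (T (0, x)).2.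

(* A (x) M_2(C), the 2 x 2 operator matrices over A. *)
Definition mat2 (A : set (op H)) : set (op dsum) :=
  [set T | exists a b c d, [/\ A a, A b, A c, A d & T = block a b c d]].

(* A (+) A, acting diagonally. *)
Definition diag2 (A : set (op H)) : set (op dsum) :=
  [set T | exists a d, [/\ A a, A d & T = block a 0 0 d]].

(* f (x) Id. *)
Definition amplify (f : op H -> op H) (T : op dsum) : op dsum :=
  block (f (ul T)) (f (ur T)) (f (dl T)) (f (dr T)).

Definition diag_map (f g : op H -> op H) (T : op dsum) : op dsum :=
  block (f (ul T)) 0 0 (g (dr T)).

End DirectSum.

(* Main.v *)
Require Import Defs.
From HB Require Import structures.
From mathcomp Require Import all_boot all_order all_algebra.
From mathcomp Require Import complex.
From mathcomp Require Import all_classical all_reals all_analysis.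
From mathcomp Require Import ring lra.

Set Implicit Arguments.
Unset Strict Implicit.
Unset Printing Implicit Defensive.

Import Order.TTheory GRing.Theory Num.Theory.
Import numFieldNormedType.Exports.

Local Open Scope classical_set_scope.
Local Open Scope ring_scope.
Local Open Scope complex_scope.

(** The algebras [P] and [mat2 M] are compared through a set of pairs of
    operators. Write [W] for the diagonal unitary with entries [1] and [adj u]
    on the direct sum of two copies of [H]; pair [ltheta n] with [n] for [n] in
    [mat2 N], pair [l1 d] with [twist d], that is [d] conjugated by [W], for [d]
    in [mat2 D], and close up under sums and products ([matching]). Because
    [theta d] is [adj u \o d \o u], the two copies of [diag2 D] correspond. The
    first components generate [P], the second ones generate [mat2 M].

    The pairing preserves expectations: if [(T, S)] is a matching pair, then
    [E T] is the image under [ltheta] of [diag_expect S], the composite of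
    [amplify EM] with the conditional expectation of [mat2 N] ([E_match]). By
    the usual centering argument every pair is a sum of pairs from the diagonal
    algebra and of alternating words in centered letters
    ([matching_word_span]). On such a word [E] vanishes by freeness. On the
    other side the centered letters of the second algebra are the off-diagonal
    matrices with entries [b \o u] and [adj u \o c], so multiplying out the
    matrices shows that the entries of an alternating word containing such a
    letter are, up to coefficients from [N] on the left, sums of reduced words
    of the HNN extension ([word_blocks]), which [EM] kills. The only other
    alternating words are single centered elements of [mat2 N].

    It remains to extend the pairing to an isomorphism of the generated von
    Neumann algebras. Both expectations being normal, the vector functionals
    of [E T] and of [ltheta (diag_expect S)] are normal; they agree on matching
    pairs, and they separate the two algebras because the expectations are
    faithful. The general statement is [spatial_isomorphism]. Instead of passing
    to Gelfand-Naimark-Segal representations and completions, it works with the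
    operators [X] between the two Hilbert spaces that intertwine all pairs. Two
    matching normal functionals provide such an [X] on the spaces of
    square-summable sequences, through the bounded form that sends the vectors
    obtained from [T] and [T'] to the value at [adj T \o T']
    ([cross_intertwiner]); its matrix entries intertwine as well. As the
    functionals separate, the ranges of all the entries span a dense subspace
    ([full_intertw_separating]). An operator [T] of the first algebra is then
    transported to the operator [S] with [S \o X = X \o T] for every [X];
    such an [S] is bounded by a log-convexity estimate ([comb_act_bound]), and
    it belongs to the second algebra because composing an intertwiner with an
    element of the commutant gives an intertwiner. Normal functionals that
    agree on a *-algebra agree on its bicommutant ([nfun_density]), and this
    carries the identity between the expectations over to all of [P].

    Finally [Etheta] is determined by [E] and the bimodule property, since [E]
    is faithful, and [amplify EM] satisfies the same equations
    ([expectation_intertwined]). *)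

(** * Scalar products and the Cauchy-Schwarz inequality *)

Section Modulus.
Variable R : realType.
Implicit Types a b : R[i].

Definition nsq a : R := complex.Re a ^+ 2 + complex.Im a ^+ 2.

Lemma nsqE a : `|a| ^+ 2 = (nsq a)%:C.
Proof. by rewrite add_Re2_Im2. Qed.

Lemma nsq_ge0 a : 0 <= nsq a.
Proof. by rewrite addr_ge0 ?sqr_ge0. Qed.

Lemma nsqM a b : nsq (a * b) = nsq a * nsq b.
Proof. by case: a b => [a1 a2] [b1 b2]; rewrite /nsq /=; ring. Qed.

Lemma nsqJ a : nsq a^* = nsq a.
Proof. by case: a => [a1 a2]; rewrite /nsq /=; ring. Qed.

Lemma nsq_real (r : R) : nsq r%:C = r ^+ 2.
Proof. by rewrite /nsq /= expr0n addr0. Qed.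

(** The complex discriminant criterion. It is stated on numbers so as to give
    the Cauchy-Schwarz inequality for degenerate positive forms as well. *)
Lemma discriminant_le (p r : R) a : 0 <= p -> 0 <= r ->
  (forall t : R[i], 0 <= p + 2 * complex.Re (t * a) + nsq t * r) ->
  nsq a <= p * r.
Proof.
move=> p0 r0 h; have n0 := nsq_ge0 a.
have key (s : R) : 0 <= p - 2 * s * nsq a + s ^+ 2 * nsq a * r.
  have := h ((- s)%:C * a^*); rewrite nsqM nsqJ nsq_real sqrrN.
  by congr (0 <= _ + _ + _); case: (a) => [a1 a2]; rewrite /nsq /=; ring.
have [nz|nz] := eqVneq (nsq a) 0; first by rewrite nz mulr_ge0.
have [rz|rz] := eqVneq r 0.
  have := key ((p + 1) / (2 * nsq a)); rewrite rz !mulr0 addr0.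
  have -> : 2 * ((p + 1) / (2 * nsq a)) * nsq a = p + 1 by field.
  lra.
have := key r^-1.
have -> : p - 2 * r^-1 * nsq a + r^-1 ^+ 2 * nsq a * r = (p * r - nsq a) / r.
  by field.
by rewrite pmulr_lge0 ?subr_ge0// invr_gt0 lt0r rz.
Qed.
End Modulus.

Section ScalarProduct.
Variables (R : realType) (K : hilbert R).
Implicit Types (x y z : K) (a : R[i]).

Lemma ipDl x y z : '[x + y, z] = '[x, z] + '[y, z].
Proof. exact: linearDl. Qed.
Lemma ipDr x y z : '[z, x + y] = '[z, x] + '[z, y].
Proof. exact: linearDr. Qed.
Lemma ipNl x z : '[- x, z] = - '[x, z].
Proof. exact: linearNl. Qed.
Lemma ipNr x z : '[z, - x] = - '[z, x].
Proof. exact: linearNr. Qed.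
Lemma ipBl x y z : '[x - y, z] = '[x, z] - '[y, z].
Proof. exact: linearBl. Qed.
Lemma ipBr x y z : '[z, x - y] = '[z, x] - '[z, y].
Proof. exact: linearBr. Qed.
Lemma ip0l z : '[0, z] = 0 :> R[i].
Proof. exact: linear0l. Qed.
Lemma ip0r z : '[z, 0] = 0 :> R[i].
Proof. exact: linear0r. Qed.
Lemma ipZl a x z : '[a *: x, z] = a * '[x, z].
Proof. exact: linearZl_LR. Qed.
Lemma ipZr a x z : '[z, a *: x] = conjc a * '[z, x].
Proof. by rewrite /ip linearZr_LR. Qed.
Lemma ipC x y : '[x, y] = ('[y, x])^*.
Proof. by rewrite {1}/ip (hermC (inner K)) expr0 mul1r. Qed.

Definition sq x : R := complex.Re '[x, x].

Lemma ip_ge0 x : 0 <= '[x, x].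
Proof. exact: dnorm_ge0. Qed.

Lemma ipxx x : '[x, x] = (sq x)%:C.
Proof. by rewrite /sq RRe_real// ger0_real// ip_ge0. Qed.

Lemma sq_ge0 x : 0 <= sq x.
Proof. by rewrite -ler0c -ipxx ip_ge0. Qed.

Lemma sq_eq0 x : sq x = 0 -> x = 0.
Proof. by move=> x0; apply/eqP; rewrite -(dnorm_eq0 (inner K)) -/(ip x x) ipxx x0. Qed.

Lemma ip_eq0 x : (forall y, '[x, y] = 0) -> x = 0.
Proof. by move=> x0; apply: sq_eq0; rewrite /sq x0. Qed.

Lemma ip_inj x x' : (forall y, '[x, y] = '[x', y]) -> x = x'.
Proof.
by move=> xx'; apply/eqP; rewrite -subr_eq0; apply/eqP/ip_eq0 => y;
  rewrite ipBl xx' subrr.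
Qed.

Lemma sqD x y : sq (x + y) = sq x + sq y + 2 * complex.Re '[x, y].
Proof.
rewrite /sq ipDl !ipDr [ '[y, x] ]ipC.
case: '[x, x] '[y, y] '[x, y] => a b [c d] [e f] /=; ring.
Qed.

Lemma sqZ a x : sq (a *: x) = nsq a * sq x.
Proof.
rewrite {1}/sq ipZl ipZr ipxx; case: a => a b; rewrite /nsq /=; ring.
Qed.

Lemma sqN x : sq (- x) = sq x.
Proof. by rewrite /sq ipNl ipNr opprK. Qed.

Lemma sqB x y : sq (x - y) = sq x + sq y - 2 * complex.Re '[x, y].
Proof. by rewrite sqD sqN ipNr; case: '[x, y] => a b /=; ring. Qed.

Lemma sqDle x y : sq (x + y) <= 2 * sq x + 2 * sq y.
Proof. by have := sq_ge0 (x - y); rewrite sqB sqD; lra. Qed.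

Lemma sqBC x y : sq (x - y) = sq (y - x).
Proof. by rewrite -opprB sqN. Qed.

Lemma sq0 : sq 0 = 0.
Proof. by rewrite /sq ip0l. Qed.

Lemma cauchy_schwarz x y : nsq '[x, y] <= sq x * sq y.
Proof.
apply: discriminant_le; rewrite ?sq_ge0// => t.
have := sq_ge0 (t^* *: y + x); rewrite sqD sqZ nsqJ ipZl [ '[y, x] ]ipC.
congr (0 <= _); case: '[x, y] t (sq x) (sq y) => [a b] [c d] p r /=; ring.
Qed.

Lemma ip_real_le x y : 2 * `|complex.Re '[x, y]| <= sq x + sq y.
Proof.
have := sq_ge0 (x - y); have := sq_ge0 (x + y); rewrite sqB sqD.
by case: (ler0P (complex.Re '[x, y])); lra.
Qed.

Lemma ip_imag_le x y : 2 * `|complex.Im '[x, y]| <= sq x + sq y.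
Proof.
have := ip_real_le x ('i *: y); rewrite ipZr sqZ /=.
have -> : complex.Re (('i)^* * '[x, y]) = complex.Im '[x, y].
  by case: '[x, y] => a b /=; ring.
by rewrite /nsq /= expr0n expr1n add0r mul1r.
Qed.
End ScalarProduct.

(** * Riesz representation for bounded linear relations *)

Section Riesz.
Variables (R : realType).

Lemma le0_eps (a k : R) : 0 <= k -> (forall e : R, 0 < e -> a <= e * k) -> a <= 0.
Proof.
move=> k0 h; rewrite leNgt; apply/negP => a0.
have k1 : 0 < k + 1 by lra.
by have := h _ (divr_gt0 a0 k1); rewrite mulrAC ler_pdivlMr//; nra.
Qed.

Lemma nsq_eq0 (a : R[i]) : nsq a <= 0 -> a = 0.
Proof.
case: a => a b; rewrite /nsq /= => h.
have /eqP := h; have a2 := sqr_ge0 a; have b2 := sqr_ge0 b.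
have -> : a = 0 by apply/eqP; rewrite -sqrf_eq0; apply/eqP; lra.
by have -> : b = 0 by apply/eqP; rewrite -sqrf_eq0; apply/eqP; lra.
Qed.

Lemma nsqD_le (a b : R[i]) : nsq (a + b) <= 2 * nsq a + 2 * nsq b.
Proof.
case: a b => [a1 a2] [b1 b2]; rewrite /nsq /=.
by have := sqr_ge0 (a1 - b1); have := sqr_ge0 (a2 - b2); nra.
Qed.

Variable K : hilbert R.

(** Partially defined linear maps are represented by their graphs, so that
    single-valuedness, which follows from boundedness, need not be known when
    the graph is written down. *)
Definition linear_rel (L : lmodType R[i]) (G : K -> L -> Prop) :=
  G 0 0 /\ forall a x c y d, G x c -> G y d -> G (a *: x + y) (a *: c + d).

Lemma hilbert_limit (x : nat -> K) :
  (forall e : R, 0 < e -> exists k, forall m n, (k <= m)%N -> (k <= n)%N ->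
     sq (x m - x n) < e) ->
  exists l, forall e : R, 0 < e -> exists k, forall n, (k <= n)%N ->
     sq (x n - l) < e.
Proof.
move=> cx; have [|l hl] := @hilbert_complete R K x.
  move=> e /cx[k hk]; exists k => m n km kn.
  by rewrite -/(ip (x m - x n) (x m - x n)) ipxx ltcR hk.
exists l => e /hl[k hk]; exists k => n /hk.
by rewrite -/(ip (x n - l) (x n - l)) ipxx ltcR.
Qed.

(** The vector [v] minimizes [sq x - 2 Re c] over the graph: a minimizing
    sequence is Cauchy by the parallelogram identity, and perturbing it along
    [(t *: x, t * c)] gives the representation property. Being a limit of
    elements of the domain, [v] is orthogonal to all that the domain is
    orthogonal to. *)
Lemma riesz (G : K -> R[i]^o -> Prop) (M : R) : 0 <= M -> linear_rel G ->
  (forall x c, G x c -> nsq c <= M * sq x) ->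
  exists v, [/\ forall x c, G x c -> '[x, v] = c, sq v <= M &
    forall w, (forall x c, G x c -> '[x, w] = 0) -> '[v, w] = 0].
Proof.
move=> M0 [G0 Glin] Gle.
pose J (x : K) (c : R[i]) := sq x - 2 * complex.Re c.
pose S := [set j | exists x c, G x c /\ j = J x c].
(* [2 Re c <= M + sq x] because [(Re c)^2 <= M sq x]. *)
have Slb : lbound S (- M).
  move=> _ [x [c [/Gle h ->]]]; rewrite /J; have := sq_ge0 x => x0.
  have h1 : complex.Re c ^+ 2 <= M * sq x.
    by apply: le_trans h; rewrite /nsq lerDl sqr_ge0.
  rewrite leNgt; apply/negP => h2.
  have := sqr_ge0 (M - sq x); nra.
have Sinf : has_inf S by split; [exists (J 0 0), 0, 0|exists (- M)].
pose m := inf S.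
have mle x c : G x c -> m <= J x c.
  by move=> Gxc; apply: ge_inf; [exists (- M)|exists x, c].
have [f fP] : {f : nat -> K * R[i] & forall n,
    G (f n).1 (f n).2 /\ J (f n).1 (f n).2 < m + n.+1%:R^-1}.
  apply: (@choice _ _ (fun n (p : K * R[i]) => G p.1 p.2 /\ J p.1 p.2 < m + n.+1%:R^-1)).
  move=> n; have n0 : 0 < n.+1%:R^-1 :> R by rewrite invr_gt0 ltr0n.
  by have [_ [x [c [Gxc ->]]] lt] := inf_adherent n0 Sinf; exists (x, c).
have small (e : R) : 0 < e -> exists k, forall n, (k <= n)%N -> n.+1%:R^-1 < e.
  move=> e0; exists (Num.truncn e^-1) => n kn.
  rewrite -[e]invrK ltf_pV2 ?posrE ?invr_gt0 ?ltr0n//.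
  apply: lt_le_trans (truncnS_gt _) _; by rewrite ler_nat ltnS.
(* Parallelogram identity, with the midpoint of two points of the graph. *)
have cauchy i j : sq ((f i).1 - (f j).1) <= 2 * (i.+1%:R^-1 + j.+1%:R^-1).
  have [Gi Ji] := fP i; have [Gj Jj] := fP j.
  have h2 : 2^-1 *: ((f i).1 + (f j).1) = 2^-1 *: (f i).1 + (2^-1 *: (f j).1 + 0).
    by rewrite addr0 scalerDr.
  have /mle : G (2^-1 *: ((f i).1 + (f j).1)) (2^-1 * ((f i).2 + (f j).2)).
    rewrite h2 mulrDr -[2^-1 * (f j).2]addr0.
    apply: (Glin) => //; exact: (Glin).
  have -> : 2^-1 = (2^-1 : R)%:C by rewrite fmorphV rmorphMn.
  move: Ji Jj; rewrite /J sqZ nsq_real sqB sqD.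
  case: (f i).2 (f j).2 => [a b] [c d] /=.
  move: (complex.Re _) (sq (f i).1) (sq (f j).1) (i.+1%:R^-1) (j.+1%:R^-1) => p q r e1 e2.
  have -> : 2^-1 ^+ 2 = 4^-1 :> R by field.
  lra.
have [v hv] : exists l, forall e : R, 0 < e -> exists k, forall n, (k <= n)%N ->
     sq ((f n).1 - l) < e.
  apply: (@hilbert_limit (fun n => (f n).1)) => e e0.
  have /small[k hk] : 0 < e / 4 by lra.
  exists k => i j /hk + /hk; have := cauchy i j.
  by move: (i.+1%:R^-1) (j.+1%:R^-1) => a b; lra.
have near (e : R) : 0 < e -> exists n, sq ((f n).1 - v) < e /\ n.+1%:R^-1 < e.
  move=> e0; have [k hk] := hv _ e0; have [k' hk'] := small _ e0.
  by exists (maxn k k'); rewrite hk ?hk' ?leq_maxl ?leq_maxr.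
have vE x c : G x c -> '[x, v] = c.
  move=> Gxc; apply/eqP; rewrite -subr_eq0; apply/eqP/nsq_eq0.
  apply: (@le0_eps _ (4 * sq x)); first by rewrite mulr_ge0 ?sq_ge0.
  move=> e /near[n [vn ne]].
  have -> : '[x, v] - c = '[x, v - (f n).1] + ('[x, (f n).1] - c).
    by rewrite ipBr addrA subrK.
  have h1 := cauchy_schwarz x (v - (f n).1); rewrite sqBC in h1.
  have h2 : nsq ('[x, (f n).1] - c) <= n.+1%:R^-1 * sq x.
    apply: discriminant_le; rewrite ?invr_ge0 ?ler0n ?sq_ge0// => t.
    have [Gn Jn] := fP n.
    have := mle _ _ (Glin t _ _ _ _ Gxc Gn).
    move: Jn; rewrite /J sqD sqZ ipZl.
    have -> : complex.Re (t *: (c : R[i]^o) + (f n).2) = complex.Re (t * c) + complex.Re (f n).2.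
      by case: (f n).2 (t) (c) => [? ?] [? ?] [? ?] /=.
    have -> : complex.Re (t * ('[x, (f n).1] - c)) =
        complex.Re (t * '[x, (f n).1]) - complex.Re (t * c).
      by case: '[x, (f n).1] (t) (c) => [? ?] [? ?] [? ?] /=; ring.
    by move: (n.+1%:R^-1) => e1; lra.
  have := nsqD_le '[x, v - (f n).1] ('[x, (f n).1] - c).
  have := ler_wpM2l (sq_ge0 x) (ltW vn); have := ler_wpM2l (sq_ge0 x) (ltW ne).
  move: h1 h2; move: (n.+1%:R^-1) => e1; lra.
exists v; split=> //.
- have key (e : R) : 0 < e -> M * (sq v - M) <= M * e /\ (M = 0 -> sq v <= e).
    move=> /near[n [vn _]]; have [Gn _] := fP n.
    have := Gle _ _ Gn; have <- := vE _ _ Gn.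
    have := vn; rewrite sqB; have := sq_ge0 (f n).1.
    rewrite /nsq; have := sqr_ge0 (complex.Im '[(f n).1, v]).
    move: (complex.Im _) (complex.Re _) (sq (f n).1) (sq v) => b a p q b0 p0 h h'.
    have := sqr_ge0 (a - M) => aM.
    split; first by nra.
    move=> Mz; rewrite Mz mul0r in h'.
    have a0 : a = 0 by apply/eqP; rewrite -sqrf_eq0; apply/eqP; have := sqr_ge0 a; lra.
    by rewrite a0 in h; lra.
  have [Mz|Mz] := eqVneq M 0.
    rewrite {1}Mz; apply: (@le0_eps _ 1) => // e /key[_ /(_ Mz)]; by rewrite mulr1.
  have Mp : 0 < M by rewrite lt0r Mz.
  rewrite -subr_le0; apply: (@le0_eps _ 1) => // e /key[+ _].
  by rewrite ler_pM2l// mulr1.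
- move=> w hw; apply/nsq_eq0; apply: (@le0_eps _ (sq w)); first exact: sq_ge0.
  move=> e /near[n [vn _]].
  have -> : '[v, w] = '[v - (f n).1, w].
    by rewrite ipBl (hw _ _ (fP n).1) subr0.
  apply: le_trans (cauchy_schwarz _ _) _; rewrite sqBC.
  by rewrite ler_wpM2r ?sq_ge0// ltW.
Qed.
End Riesz.

(** * Adjoints, and extension of partially defined operators *)

Section Adjoint.
Variable R : realType.
Implicit Types K L W : hilbert R.

(** Mutually adjoint operators between possibly different spaces. Having an
    adjoint forces linearity, so that it is convenient to carry both
    operators. *)
Definition adjp K L (X : K -> L) (Y : L -> K) :=
  forall x y, '[X x, y] = '[x, Y y].

Definition bdd K L (X : K -> L) := exists2 c : R, 0 <= c & forall x, sq (X x) <= c * sq x.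

Lemma adjp_sym K L (X : K -> L) (Y : L -> K) : adjp X Y -> adjp Y X.
Proof. by move=> XY x y; rewrite ipC -XY -ipC. Qed.

Lemma adjp_linear K L (X : K -> L) (Y : L -> K) : adjp X Y -> linear X.
Proof.
move=> XY a x x'; apply: ip_inj => y.
by rewrite XY ipDl ipZl -!XY -ipZl -ipDl.
Qed.

Lemma adjp_uniq K L (X X' : K -> L) (Y : L -> K) : adjp X Y -> adjp X' Y -> X = X'.
Proof. by move=> XY XY'; apply/funext => x; apply: ip_inj => y; rewrite XY XY'. Qed.

Lemma adjp_comp K L W (X : K -> L) (Y : L -> K) (X' : L -> W) (Y' : W -> L) :
  adjp X Y -> adjp X' Y' -> adjp (X' \o X) (Y \o Y').
Proof. by move=> XY XY' x y /=; rewrite XY' XY. Qed.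

Lemma adjp_add K L (X X' : K -> L) (Y Y' : L -> K) :
  adjp X Y -> adjp X' Y' -> adjp (X + X') (Y + Y').
Proof. by move=> XY XY' x y; rewrite ipDl ipDr XY XY'. Qed.

Lemma adjp_scale K L a (X : K -> L) (Y : L -> K) :
  adjp X Y -> adjp (a *: X) (conjc a *: Y).
Proof. by move=> XY x y; rewrite ipZl ipZr XY conjcK. Qed.

Lemma adjp_id K : adjp (@idfun K) idfun.
Proof. by []. Qed.

Lemma adjp_zero K L : adjp (0 : K -> L) 0.
Proof. by move=> x y; rewrite ip0l ip0r. Qed.

Lemma lin0 K L (X : K -> L) : linear X -> X 0 = 0.
Proof. by move=> lX; have := lX (-1) 0 0; rewrite scaleN1r oppr0 add0r scaleN1r addNr. Qed.

Lemma linD K L (X : K -> L) x y : linear X -> X (x + y) = X x + X y.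
Proof. by move=> lX; rewrite -[x]scale1r lX !scale1r. Qed.

Lemma linZ K L (X : K -> L) a x : linear X -> X (a *: x) = a *: X x.
Proof. by move=> lX; rewrite -[a *: x]addr0 lX lin0// addr0. Qed.

Lemma linB K L (X : K -> L) x y : linear X -> X (x - y) = X x - X y.
Proof. by move=> lX; rewrite -scaleN1r linD// linZ// scaleN1r. Qed.

Lemma bdd_comp K L W (X : K -> L) (X' : L -> W) : bdd X -> bdd X' -> bdd (X' \o X).
Proof.
move=> [c c0 hc] [d d0 hd]; exists (d * c); first exact: mulr_ge0.
by move=> x /=; apply: le_trans (hd _) _; rewrite -mulrA ler_wpM2l.
Qed.

Lemma bdd_add K L (X X' : K -> L) : bdd X -> bdd X' -> bdd (X + X').
Proof.
move=> [c c0 hc] [d d0 hd]; exists (2 * c + 2 * d); first lra.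
move=> x; apply: le_trans (sqDle _ _) _.
by have := hc x; have := hd x; nra.
Qed.

Lemma bdd_scale K L a (X : K -> L) : bdd X -> bdd (a *: X).
Proof.
move=> [c c0 hc]; exists (nsq a * c); first by rewrite mulr_ge0 ?nsq_ge0.
by move=> x; rewrite sqZ -mulrA ler_wpM2l ?nsq_ge0.
Qed.

Lemma bdd_adj K L (X : K -> L) (Y : L -> K) : adjp X Y -> bdd X -> bdd Y.
Proof.
move=> XY [c c0 hc]; exists c => // y.
have := cauchy_schwarz (X (Y y)) y; rewrite XY ipxx nsq_real.
have := hc (Y y); have := sq_ge0 y; have := sq_ge0 (Y y).
have [->|n0] := eqVneq (sq (Y y)) 0; first by move=> *; rewrite mulr_ge0.
move=> p0 q0 h1 h2; have p1 : 0 < sq (Y y) by rewrite lt0r n0.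
rewrite -(ler_pM2l p1) -expr2; apply: le_trans h2 _.
by rewrite mulrA [sq (Y y) * c]mulrC ler_wpM2r.
Qed.

Lemma bdd_id K : bdd (@idfun K).
Proof. by exists 1 => // x; rewrite mul1r. Qed.

Lemma bdd_zero K L : bdd (0 : K -> L).
Proof. by exists 0 => // x; rewrite sq0 mul0r. Qed.

Lemma bounded_opP K (T : op K) : bounded_op T <-> linear T /\ bdd T.
Proof.
split=> [[lT [c hc]]|[lT [c c0 hc]]]; split=> //.
  exists (Num.max c 0); first by rewrite le_max lexx orbT.
  move=> x; have := hc x; rewrite !ipxx -rmorphM lecR => /le_trans; apply.
  by rewrite ler_wpM2r ?sq_ge0// le_max lexx.
by exists c => x; rewrite !ipxx -rmorphM lecR.
Qed.

(** A bounded partial linear map extends by zero to the orthogonal complement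
    of its domain. The last two clauses say that the extension and its adjoint
    live on the closures of the domain and of the range; they are what makes
    the extension unique, hence compatible with every symmetry of the graph. *)
Lemma extension K L (G : K -> L -> Prop) (c : R) : 0 <= c -> linear_rel G ->
  (forall x z, G x z -> sq z <= c * sq x) ->
  exists X : K -> L, exists Y : L -> K, [/\ adjp X Y, bdd X,
    forall x z, G x z -> X x = z,
    forall w, (forall x z, G x z -> '[x, w] = 0) -> X w = 0 &
    forall y, (forall x z, G x z -> '[z, y] = 0) -> Y y = 0].
Proof.
move=> c0 [G0 Glin] Gle.
have exY y : exists v, [/\ forall x z, G x z -> '[x, v] = '[z, y], sq v <= c * sq y &
    forall w, (forall x z, G x z -> '[x, w] = 0) -> '[v, w] = 0].
  have [||x a|v [v1 v2 v3]] :=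
      @riesz R K (fun x a => exists2 z, G x z & a = '[z, y]) (c * sq y).
  - by rewrite mulr_ge0 ?sq_ge0.
  - split; first by exists 0; rewrite ?ip0l.
    move=> a x _ x' _ [z Gxz ->] [z' Gxz' ->].
    by exists (a *: z + z'); [exact: Glin|rewrite ipDl ipZl].
  - move=> [z Gxz ->]; apply: le_trans (cauchy_schwarz _ _) _.
    by rewrite mulrAC ler_wpM2r ?sq_ge0// Gle.
  exists v; split => //; first by move=> x z Gxz; apply: v1; exists z.
  by move=> w hw; apply: v3 => x _ [z Gxz _]; exact: hw Gxz.
have [Y YP] := choice exY.
have Yuniq y v : (forall x z, G x z -> '[x, v] = '[z, y]) ->
    (forall w, (forall x z, G x z -> '[x, w] = 0) -> '[v, w] = 0) -> v = Y y.
  move=> hv hw; have [h1 _ h2] := YP y.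
  have h3 x z : G x z -> '[x, v - Y y] = 0.
    by move=> Gxz; rewrite ipBr (hv _ _ Gxz) (h1 _ _ Gxz) subrr.
  apply/eqP; rewrite -subr_eq0; apply/eqP/sq_eq0.
  by rewrite /sq ipBl hw// h2// subrr.
have Ylin : linear Y.
  move=> a y y'; have [h1 _ h2] := YP y; have [h1' _ h2'] := YP y'.
  apply/esym/Yuniq => [x z Gxz|w hw].
    by rewrite !ipDr !ipZr (h1 _ _ Gxz) (h1' _ _ Gxz).
  by rewrite ipDl ipZl h2// h2'// mulr0 addr0.
have exX x : exists v, forall y, '[Y y, x] = '[y, v].
  have [||y a|v [v1 v2 v3]] :=
      @riesz R L (fun y a => a = '[Y y, x]) (c * sq x).
  - by rewrite mulr_ge0 ?sq_ge0.
  - split; first by rewrite lin0// ip0l.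
    by move=> a y _ y' _ -> ->; rewrite Ylin ipDl ipZl.
  - move=> ->; apply: le_trans (cauchy_schwarz _ _) _.
    by rewrite mulrAC ler_wpM2r ?sq_ge0//; have [] := YP y.
  by exists v => y; rewrite (v1 y _ erefl).
have [X XP] := choice exX.
have YX : adjp Y X by move=> y x; rewrite XP.
have XY := adjp_sym YX.
exists X, Y; split => //.
- by apply: bdd_adj YX _; exists c => // y; have [] := YP y.
- move=> x z Gxz; apply: ip_inj => y; rewrite XY.
  by have [h _ _] := YP y; exact: h Gxz.
- move=> w hw; apply: ip_eq0 => y; rewrite XY ipC.
  by have [_ _ ->] := YP y => //; rewrite conjc0.
- move=> y hy; apply/esym/Yuniq => [x z Gxz|w _]; last by rewrite ip0l.
  by rewrite ip0r (hy _ _ Gxz).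
Qed.

Lemma adj_exists K L (X : K -> L) : linear X -> bdd X -> exists Y : L -> K, adjp X Y.
Proof.
move=> lX [c c0 hc].
have [|x _ ->|X' [Y [XY _ X'X _ _]]] := @extension K L (fun x z => z = X x) c c0.
- by split=> [|a x _ y _ -> ->]; [rewrite lin0|rewrite lX].
- exact: hc.
by exists Y; have <- : X' = X by apply/funext => x; exact: X'X.
Qed.

Lemma adjE K (T S : op K) : adjp T S -> adj T = S.
Proof.
move=> TS; rewrite /adj; case: xgetP => [S' -> TS'|/(_ S)//].
by apply: (@adjp_uniq K K _ _ T); exact: adjp_sym.
Qed.

Lemma adjP K (T : op K) : bounded_op T -> adjp T (adj T).
Proof.
move=> /bounded_opP[lT bT]; have [S TS] := adj_exists lT bT.
by rewrite (adjE TS).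
Qed.

Lemma adjp_bounded K (T S : op K) : adjp T S -> bdd T -> bounded_op T.
Proof. by move=> TS bT; apply/bounded_opP; split=> //; exact: adjp_linear TS. Qed.

Lemma adj_bounded K (T : op K) : bounded_op T -> bounded_op (adj T).
Proof.
move=> bT; have TT := adjP bT; have /bounded_opP[_ bT'] := bT.
exact: adjp_bounded (adjp_sym TT) (bdd_adj TT bT').
Qed.

Lemma bounded_linear K (T : op K) : bounded_op T -> linear T.
Proof. by case. Qed.

Lemma bounded_bdd K (T : op K) : bounded_op T -> bdd T.
Proof. by move=> /bounded_opP[]. Qed.

Lemma adjK K (T : op K) : bounded_op T -> adj (adj T) = T.
Proof. by move=> bT; apply: adjE; apply/adjp_sym/adjP. Qed.

Lemma adj_comp K (S T : op K) : bounded_op S -> bounded_op T ->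
  adj (S \o T) = adj T \o adj S.
Proof. by move=> bS bT; apply: adjE; apply: adjp_comp; exact: adjP. Qed.

Lemma adj_id K : adj (@idfun K) = idfun.
Proof. exact/adjE/adjp_id. Qed.

Lemma adj0 K : adj (0 : op K) = 0.
Proof. exact/adjE/adjp_zero. Qed.

Lemma bounded_comp K (S T : op K) : bounded_op S -> bounded_op T ->
  bounded_op (S \o T).
Proof.
move=> bS bT; apply: adjp_bounded (adjp_comp (adjP bT) (adjP bS)) _.
by apply: bdd_comp; exact: bounded_bdd.
Qed.

Lemma bounded_add K (S T : op K) : bounded_op S -> bounded_op T ->
  bounded_op (S + T).
Proof.
move=> bS bT; apply: adjp_bounded (adjp_add (adjP bS) (adjP bT)) _.
by apply: bdd_add; exact: bounded_bdd.
Qed.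

Lemma bounded_scale K a (T : op K) : bounded_op T -> bounded_op (a *: T).
Proof.
move=> bT; apply: adjp_bounded (adjp_scale a (adjP bT)) _.
by apply: bdd_scale; exact: bounded_bdd.
Qed.

Lemma bounded_id K : bounded_op (@idfun K).
Proof. exact: adjp_bounded (@adjp_id K) (@bdd_id K). Qed.

Lemma bounded_zero K : bounded_op (0 : op K).
Proof. exact: adjp_bounded (@adjp_zero K K) (@bdd_zero K K). Qed.

Lemma adj_add K (S T : op K) : bounded_op S -> bounded_op T ->
  adj (S + T) = adj S + adj T.
Proof. by move=> bS bT; apply/adjE/adjp_add; exact: adjP. Qed.

End Adjoint.

(** * Commutants and generated von Neumann algebras *)

Section Commutant.
Variables (R : realType) (K : hilbert R).
Implicit Types (A B : set (op K)) (S T X : op K).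

Lemma commutant_id A : commutant A idfun.
Proof. by split; [exact: bounded_id|]. Qed.

Lemma commutant_comp A T X : commutant A T -> commutant A X -> commutant A (T \o X).
Proof.
move=> [bT hT] [bX hX]; split; first exact: bounded_comp.
by move=> S AS; rewrite -compA hX// compA hT// compA.
Qed.

Lemma commutant_add A T X : (forall S : op K, A S -> linear S) ->
  commutant A T -> commutant A X -> commutant A (T + X).
Proof.
move=> lA [bT hT] [bX hX]; split; first exact: bounded_add.
move=> S AS; apply/funext => x /=; rewrite /= [RHS]linD//; last exact: lA.
by have /= <- := congr1 (@^~ x) (hT _ AS); have /= <- := congr1 (@^~ x) (hX _ AS).
Qed.

Lemma commutant_scale A a T : (forall S : op K, A S -> linear S) ->
  commutant A T -> commutant A (a *: T).
Proof.
move=> lA [bT hT]; split; first exact: bounded_scale.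
move=> S AS; apply/funext => x /=; rewrite /= [RHS]linZ//; last exact: lA.
by have /= <- := congr1 (@^~ x) (hT _ AS).
Qed.

Lemma commutant_adj A T : A `<=` @bounded_op R K -> (forall S : op K, A S -> A (adj S)) ->
  commutant A T -> commutant A (adj T).
Proof.
move=> bA aA [bT hT]; split; first exact: adj_bounded.
move=> S AS; have bS := bA _ AS.
rewrite -[S in LHS](adjK bS) -[S in RHS](adjK bS).
have bS' := bA _ (aA _ AS).
by rewrite -!adj_comp// hT//; exact: aA.
Qed.

Lemma commutant_bounded A : commutant A `<=` @bounded_op R K.
Proof. by move=> T []. Qed.

Lemma commutant_linear A T : commutant A T -> linear T.
Proof. by move=> [/bounded_linear]. Qed.

Lemma commutant_anti A B : A `<=` B -> commutant B `<=` commutant A.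
Proof. by move=> AB T [bT hT]; split=> // S /AB; exact: hT. Qed.

Lemma sub_bicommutant A : A `<=` @bounded_op R K -> A `<=` commutant (commutant A).
Proof. by move=> bA T AT; split; [exact: bA|move=> S [_ hS]; rewrite hS]. Qed.

Lemma tricommutant A : A `<=` @bounded_op R K ->
  commutant (commutant (commutant A)) = commutant A.
Proof.
move=> bA; rewrite eqEsubset; split.
  exact/commutant_anti/sub_bicommutant.
exact/sub_bicommutant/commutant_bounded.
Qed.

Section Closure.
Variable A : set (op K).
Hypothesis vnA : von_neumann A.

Lemma vn_bounded T : A T -> bounded_op T.
Proof. by case: vnA => bA _ _; exact: bA. Qed.

Lemma vn_linear T : A T -> linear T.
Proof. by move=> /vn_bounded/bounded_linear. Qed.

Lemma vn_adj T : A T -> A (adj T).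
Proof. by case: vnA => _ aA _; exact: aA. Qed.

Lemma vn_id : A idfun.
Proof. by case: vnA => _ _ <-; exact: commutant_id. Qed.

Lemma vn_comp S T : A S -> A T -> A (S \o T).
Proof. by case: vnA => _ _ <-; exact: commutant_comp. Qed.

Lemma vn_add S T : A S -> A T -> A (S + T).
Proof. by case: vnA => _ _ <-; apply: commutant_add => ?; exact: commutant_linear. Qed.

Lemma vn_scale a T : A T -> A (a *: T).
Proof. by case: vnA => _ _ <-; apply: commutant_scale => ?; exact: commutant_linear. Qed.

Lemma vn_opp T : A T -> A (- T).
Proof. by move=> AT; rewrite -scaleN1r; exact: vn_scale. Qed.

Lemma vn_sub S T : A S -> A T -> A (S - T).
Proof. by move=> AS AT; apply: vn_add => //; exact: vn_opp. Qed.

Lemma vn_zero : A 0.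
Proof. by rewrite -[0](scale0r idfun); apply/vn_scale/vn_id. Qed.
End Closure.

Lemma bicommutant_vn A : A `<=` @bounded_op R K ->
  (forall T : op K, A T -> A (adj T)) -> von_neumann (commutant (commutant A)).
Proof.
move=> bA aA; split; first exact: commutant_bounded.
- move=> T; apply: commutant_adj; first exact: commutant_bounded.
  by move=> X; exact: commutant_adj.
- by rewrite tricommutant//; exact: commutant_bounded.
Qed.

Section AdjClosure.
Variable S : set (op K).
(** The generators of a von Neumann algebra need not form a self-adjoint set,
    which the double commutant requires. *)
Definition adj_closure := S `|` [set adj T | T in S].

Lemma adj_closure_bounded : S `<=` @bounded_op R K ->
  adj_closure `<=` @bounded_op R K.
Proof. by move=> bS T [/bS//|[X SX <-]]; exact/adj_bounded/bS. Qed.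

Lemma adj_closure_adj T : S `<=` @bounded_op R K ->
  adj_closure T -> adj_closure (adj T).
Proof.
move=> bS [ST|[X SX <-]]; first by right; exists T.
by left; rewrite adjK//; exact: bS.
Qed.

Lemma vn_genE : S `<=` @bounded_op R K ->
  vn_gen S = commutant (commutant (adj_closure)).
Proof.
move=> bS; have bS' := adj_closure_bounded bS.
rewrite eqEsubset; split=> [T|T hT A [vnA SA]].
  apply; split; last by move=> X SX; apply: sub_bicommutant => //; left.
  by apply: bicommutant_vn => // X; exact: adj_closure_adj.
have [_ _ <-] := vnA; apply: commutant_anti hT; apply: commutant_anti.
by move=> X [/SA//|[Y /SA AY <-]]; exact: vn_adj.
Qed.
End AdjClosure.
End Commutant.

(** * Square-summable sequences *)

Section ComplexLimits.
Variable R : realType.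

Lemma cvg_real (u : nat -> R) (l : R) :
  u @ \oo --> l -> (fun n => (u n)%:C : R[i]^o) @ \oo --> (l%:C : R[i]^o).
Proof.
move=> /cvgrPdist_lt ul; apply/cvgrPdist_lt => e e0.
have re : e = (complex.Re e)%:C by rewrite RRe_real// gtr0_real.
have /ul : 0 < complex.Re e by rewrite -ltcR -re.
by apply: filterS => n h; rewrite -rmorphB normc_def /= expr0n addr0 sqrtr_sqr re ltcR.
Qed.

Lemma cvg_normc (u : nat -> R[i]^o) (l : R[i]^o) :
  u @ \oo --> l <-> (fun n => complex.Re `|l - u n|) @ \oo --> (0 : R).
Proof.
split=> /cvgrPdist_lt ul; apply/cvgrPdist_lt => e e0.
  have /ul : 0 < e%:C by rewrite ltcR.
  apply: filterS => n; rewrite sub0r normrN normc_def ltcR /=.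
  by rewrite ger0_norm// sqrtr_ge0.
have re : e = (complex.Re e)%:C by rewrite RRe_real// gtr0_real.
have /ul : 0 < complex.Re e by rewrite -ltcR -re.
apply: filterS => n; rewrite sub0r normrN normc_def /= re ltcR.
by rewrite ger0_norm// sqrtr_ge0.
Qed.

Lemma cvg_complex (u : nat -> R[i]^o) (a b : R) :
  (fun n => complex.Re (u n)) @ \oo --> a -> (fun n => complex.Im (u n)) @ \oo --> b ->
  u @ \oo --> (a +i* b : R[i]^o).
Proof.
move=> /cvgrPdist_lt ua /cvgrPdist_lt ub; apply/cvg_normc/cvgrPdist_lt => e e0.
have e20 : 0 < e / 2 by rewrite divr_gt0.
near=> n; have := ua _ e20.
have : `|a - complex.Re (u n)| < e / 2 by near: n; exact: ua.
have : `|b - complex.Im (u n)| < e / 2 by near: n; exact: ub.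
rewrite sub0r normrN normc_def /= (ger0_norm (sqrtr_ge0 _)).
case: (u n) => c d /=; set p := a - c; set q := b - d => hq hp _.
have h0 : 0 <= `|p| + `|q| by rewrite addr_ge0.
apply: (@le_lt_trans _ _ (`|p| + `|q|)); last by rewrite [e]splitr ltrD.
rewrite -[leRHS](ger0_norm h0); rewrite -[leRHS]sqrtr_sqr ler_wsqrtr//.
rewrite -[p ^+ 2]real_normK ?num_real//.
rewrite -[q ^+ 2]real_normK ?num_real// sqrrD -addrA lerD2l lerDr.
by rewrite mulrn_wge0// mulr_ge0.
Unshelve. all: end_near. Qed.

Lemma cvg_mulc a (u : nat -> R[i]^o) (l : R[i]^o) : u @ \oo --> l ->
  (fun n => (a * u n : R[i]^o)) @ \oo --> (a * l : R[i]^o).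
Proof.
move=> /cvg_normc ul; apply/cvg_normc.
have -> : (fun n => complex.Re `|a * l - a * u n|) =
    (fun n => complex.Re `|a| * complex.Re `|l - u n|).
  by apply/funext => n; rewrite -mulrBr normrM !normc_def /= !mul0r subr0.
by rewrite -[X in _ --> X](mulr0 (complex.Re `|a|)); apply: cvgMr.
Qed.

Lemma cvg_conj (u : nat -> R[i]^o) (l : R[i]^o) :
  u @ \oo --> l -> (fun n => conjc (u n) : R[i]^o) @ \oo --> (conjc l : R[i]^o).
Proof.
move=> /cvgrPdist_lt ul; apply/cvgrPdist_lt => e /ul.
by apply: filterS => n; rewrite -rmorphB normcJ.
Qed.

Lemma cvg_Re (u : nat -> R[i]^o) (l : R[i]^o) :
  u @ \oo --> l -> (fun n => complex.Re (u n)) @ \oo --> complex.Re l.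
Proof.
move=> /cvgrPdist_lt ul; apply/cvgrPdist_lt => e e0.
have /ul : 0 < e%:C by rewrite ltcR.
apply: filterS => n; rewrite -ltcR; apply: le_lt_trans.
have -> : complex.Re l - complex.Re (u n) = complex.Re (l - u n).
  by case: (l) (u n) => [? ?] [? ?].
exact: normc_ge_Re.
Qed.
End ComplexLimits.

Section SquareSummable.
Variables (R : realType) (K : hilbert R).
Implicit Types x y : nat -> K.

Definition l2_summable x := exists c : R, forall n, \sum_(0 <= k < n) sq (x k) <= c.

Definition sqsum x : R := limn (series (fun k => sq (x k))).

Lemma sqser_nd x : nondecreasing_seq (series (fun k => sq (x k))).
Proof. by apply: nondecreasing_series => n _ _; exact: sq_ge0. Qed.

Lemma sqser_cvg x : l2_summable x -> cvgn (series (fun k => sq (x k))).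
Proof.
move=> [c hc]; apply: nondecreasing_is_cvgn; first exact: sqser_nd.
by exists c => _ [n _ <-]; exact: hc.
Qed.

Lemma sqsum_ge x n : l2_summable x -> \sum_(0 <= k < n) sq (x k) <= sqsum x.
Proof. by move=> sx; apply: (nondecreasing_cvgn_le (@sqser_nd x)); exact: sqser_cvg. Qed.

Lemma sqsum_le x c : (forall n, \sum_(0 <= k < n) sq (x k) <= c) -> sqsum x <= c.
Proof.
move=> h; apply: limr_le; first by apply: sqser_cvg; exists c.
by near=> n; exact: h.
Unshelve. all: end_near. Qed.

Lemma summable_ser x : l2_summable x ->
  series (fun k => '[x k, x k]) @ \oo --> ((sqsum x)%:C : R[i]^o).
Proof.
move=> /sqser_cvg/cvg_real; apply: cvg_trans; apply: near_eq_cvg; near=> n.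
by rewrite /series /= rmorph_sum; apply: eq_bigr => k _; rewrite ipxx.
Unshelve. all: end_near. Qed.

(** Bounded partial sums are easier to handle than the convergence of a
    complex series. *)
Lemma square_summableP x : square_summable x <-> l2_summable x.
Proof.
split=> [|/summable_ser h]; last by apply/cvg_ex; exists (sqsum x)%:C.
move=> /cvg_ex[l] /cvg_Re h.
have : cvgn (series (fun k => sq (x k))).
  apply/cvg_ex; exists (complex.Re l).
  apply: cvg_trans h; apply: near_eq_cvg; near=> n.
  rewrite /series /= (eq_bigr (fun k => (sq (x k))%:C)); last by move=> k _; rewrite ipxx.
  by rewrite -rmorph_sum.
move=> c; exists (sqsum x) => n; exact: (nondecreasing_cvgn_le (@sqser_nd x)).
Unshelve. all: end_near. Qed.

Lemma l2_summable0 : l2_summable 0.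
Proof. by exists 0 => n; rewrite big1// => k _; rewrite sq0. Qed.

Lemma l2_summableD x y : l2_summable x -> l2_summable y -> l2_summable (x + y).
Proof.
move=> [c hc] [d hd]; exists (2 * c + 2 * d) => n.
apply: (@le_trans _ _ (\sum_(0 <= k < n) (2 * sq (x k) + 2 * sq (y k)))).
  by apply: ler_sum => k _; exact: sqDle.
by rewrite big_split/= -!mulr_sumr lerD// ler_wpM2l.
Qed.

Lemma l2_summableZ a x : l2_summable x -> l2_summable (a *: x).
Proof.
move=> [c hc]; exists (nsq a * c) => n.
rewrite (eq_bigr (fun k => nsq a * sq (x k))) => [|k _]; last by rewrite sqZ.
by rewrite -mulr_sumr ler_wpM2l// nsq_ge0.
Qed.

Definition ipsum x y : R[i]^o := limn (series (fun k => '[x k, y k]) : nat -> R[i]^o).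

(** The real and imaginary parts of the terms are dominated by half of
    [sq (x k) + sq (y k)]. *)
Lemma ipsum_cvg x y : l2_summable x -> l2_summable y ->
  (series (fun k => '[x k, y k]) : nat -> R[i]^o) @ \oo --> ipsum x y.
Proof.
move=> /sqser_cvg sx /sqser_cvg sy.
have sxy : cvgn (series (fun k => sq (x k) + sq (y k))).
  rewrite -[X in series X]/((fun k => sq (x k)) + (fun k => sq (y k))) seriesD.
  exact: is_cvgD.
have key (f : nat -> R) : (forall k, 2 * `|f k| <= sq (x k) + sq (y k)) -> cvgn (series f).
  move=> hf; apply: normed_cvg; apply: series_le_cvg sxy => k.
    exact: normr_ge0.
    by apply: addr_ge0; exact: sq_ge0.
  by apply: le_trans (hf k); rewrite mulr_natl mulr2n lerDl; exact: normr_ge0.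
have /cvg_ex[a ha] := key _ (fun k => ip_real_le (x k) (y k)).
have /cvg_ex[b hb] := key _ (fun k => ip_imag_le (x k) (y k)).
suff : (series (fun k => '[x k, y k]) : nat -> R[i]^o) @ \oo --> (a +i* b : R[i]^o).
  by move=> h; apply/cvg_ex; exists (a +i* b).
apply: cvg_complex.
  suff -> : (fun n => complex.Re (series (fun k => '[x k, y k]) n)) =
    series (fun k => complex.Re '[x k, y k]) by [].
  by apply/funext => n; rewrite /series /= (raddf_sum (@complex.Re R : Rcomplex R -> R)).
suff -> : (fun n => complex.Im (series (fun k => '[x k, y k]) n)) =
  series (fun k => complex.Im '[x k, y k]) by [].
by apply/funext => n; rewrite /series /= (raddf_sum (@complex.Im R : Rcomplex R -> R)).
Qed.

Lemma ipsum_lim x y l : l2_summable x -> l2_summable y ->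
  (series (fun k => '[x k, y k]) : nat -> R[i]^o) @ \oo --> (l : R[i]^o) ->
  ipsum x y = l.
Proof. by move=> sx sy h; apply/cvg_lim. Qed.

Lemma ipsum_linl a x x' y : l2_summable x -> l2_summable x' -> l2_summable y ->
  ipsum (a *: x + x') y = a * ipsum x y + ipsum x' y.
Proof.
move=> sx sx' sy; apply: ipsum_lim => //.
  by apply: l2_summableD => //; exact: l2_summableZ.
suff -> : series (fun k => '[(a *: x + x') k, y k]) =
    (fun n => a * series (fun k => '[x k, y k]) n + series (fun k => '[x' k, y k]) n).
  by apply: cvgD; [apply: cvg_mulc|]; exact: ipsum_cvg.
apply/funext => n; rewrite /series /= mulr_sumr -big_split/=.
by apply: eq_bigr => k _; rewrite ipDl ipZl.
Qed.

Lemma ipsumC x y : l2_summable x -> l2_summable y -> ipsum x y = conjc (ipsum y x).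
Proof.
move=> sx sy; apply: ipsum_lim => //.
suff <- : (fun n => conjc (series (fun k => '[y k, x k]) n)) =
  series (fun k => '[x k, y k]) by exact: cvg_conj (ipsum_cvg sy sx).
apply/funext => n; rewrite /series /= rmorph_sum.
by apply: eq_bigr => k _; rewrite [RHS]ipC.
Qed.

Lemma ipsumxx x : l2_summable x -> ipsum x x = (sqsum x)%:C.
Proof. by move=> sx; apply: ipsum_lim => //; exact: summable_ser. Qed.

Lemma sq_le_sqsum x k : l2_summable x -> sq (x k) <= sqsum x.
Proof.
move=> sx; apply: le_trans (sqsum_ge k.+1 sx).
by rewrite big_nat_recr//= lerDr sumr_ge0// => i _; exact: sq_ge0.
Qed.
End SquareSummable.

(** * The Hilbert space of square-summable sequences *)

Section EllTwo.
Variables (R : realType) (K : hilbert R).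

Definition l2_pred : {pred (nat -> K)} := fun x => `[< l2_summable x >].

Record l2_type := L2 { l2val :> nat -> K; _ : l2val \in l2_pred }.

Fact l2_submod : submod_closed l2_pred.
Proof.
split; first exact/asboolP/l2_summable0.
by move=> a x y /asboolP sx /asboolP sy; apply/asboolP/l2_summableD => //; exact: l2_summableZ.
Qed.

HB.instance Definition _ := GRing.isSubmodClosed.Build R[i] (nat -> K) l2_pred l2_submod.
HB.instance Definition _ := [isSub of l2_type for l2val].
HB.instance Definition _ := [Choice of l2_type by <:].
HB.instance Definition _ := [SubChoice_isSubLmodule of l2_type by <:].

Implicit Types x y z : l2_type.

Lemma l2P x : l2_summable x.
Proof. by case: x => x /= /asboolP. Qed.

Definition mkl2 (x : nat -> K) (sx : l2_summable x) : l2_type := L2 (introT (asboolP _) sx).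

Definition l2_inner x y : R[i] := ipsum x y.

Lemma l2_inner_linl a x x' y :
  l2_inner (a *: x + x') y = a * l2_inner x y + l2_inner x' y.
Proof. by apply: ipsum_linl; exact: l2P. Qed.

Lemma l2_innerC x y : l2_inner x y = conjc (l2_inner y x).
Proof. by apply: ipsumC; exact: l2P. Qed.

Fact l2_zmodl y : zmod_morphism (l2_inner ^~ y).
Proof.
by move=> x x'; rewrite -scaleN1r addrC l2_inner_linl mulN1r addrC.
Qed.

Fact l2_zmodr x : zmod_morphism (l2_inner x).
Proof.
move=> y y'; rewrite l2_innerC l2_zmodl rmorphB.
by rewrite [in RHS](l2_innerC x y) [in RHS](l2_innerC x y').
Qed.

Lemma l2_inner0l y : l2_inner 0 y = 0.
Proof. by rewrite -(subrr (0 : l2_type)) l2_zmodl subrr. Qed.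

Fact l2_scalel y : scalable_for *%R (l2_inner ^~ y).
Proof. by move=> a x; rewrite -[a *: x]addr0 l2_inner_linl l2_inner0l addr0. Qed.

Fact l2_scaler x : scalable_for (Num.conj \; *%R) (l2_inner x).
Proof.
by move=> a y; rewrite l2_innerC l2_scalel rmorphM /= [in RHS]l2_innerC.
Qed.

Fact l2_hermitian x y : l2_inner x y = (-1) ^+ false * Num.conj (l2_inner y x).
Proof. by rewrite expr0 mul1r l2_innerC. Qed.

Fact l2_pos x : x != 0 -> 0 < l2_inner x x.
Proof.
move=> x0; rewrite /l2_inner ipsumxx ?ltcR; last exact: l2P.
have sx0 k := sq_le_sqsum k (l2P x).
rewrite lt0r (le_trans (sq_ge0 _) (sx0 0%N)) andbT.
apply: contra x0 => /eqP s0; apply/eqP/val_inj/funext => k /=.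
by apply: sq_eq0; apply/eqP; rewrite eq_le sq_ge0 andbT -s0.
Qed.

HB.instance Definition _ := isBilinear.Build R[i] l2_type l2_type
  R[i] *%R (Num.conj \; *%R) l2_inner l2_zmodl l2_zmodr l2_scalel l2_scaler.
HB.instance Definition _ := isHermitianSesquilinear.Build R[i] l2_type
  false Num.conj l2_inner l2_hermitian.
HB.instance Definition _ := isDotProduct.Build R[i] l2_type l2_inner l2_pos.

Fact l2_complete (x : nat -> l2_type) :
  (forall e : R, 0 < e -> exists k, forall m n, (k <= m)%N -> (k <= n)%N ->
     l2_inner (x m - x n) (x m - x n) < e%:C) ->
  exists l, forall e : R, 0 < e -> exists k, forall n, (k <= n)%N ->
     l2_inner (x n - l) (x n - l) < e%:C.
Proof.
move=> cx.
have {}cx (e : R) : 0 < e -> exists k, forall m n, (k <= m)%N -> (k <= n)%N ->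
    sqsum (x m - x n : l2_type) < e.
  move=> /cx[k hk]; exists k => m n km kn.
  by have := hk m n km kn; rewrite /l2_inner ipsumxx ?ltcR//; exact: l2P.
have /choice[l hl] (j : nat) : exists l, forall e : R, 0 < e ->
    exists k, forall n, (k <= n)%N -> sq (x n j - l) < e.
  apply: (@hilbert_limit R K (fun n => x n j)) => e /cx[k hk].
  exists k => m n km kn; apply: le_lt_trans (hk m n km kn).
  exact: (sq_le_sqsum j (l2P (x m - x n))).
have tail (N : nat) (e : R) : 0 < e -> exists k, forall n, (k <= n)%N ->
    \sum_(0 <= j < N) sq (x n j - l j) <= e.
  elim: N e => [|N IH] e e0; first by exists 0%N => n _; rewrite big_nil ltW.
  have e20 : 0 < e / 2 by rewrite divr_gt0.
  have [k1 hk1] := IH _ e20; have [k2 hk2] := hl N _ e20.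
  exists (maxn k1 k2) => n; rewrite geq_max => /andP[kn1 kn2].
  by rewrite big_nat_recr//= [e]splitr lerD ?hk1// ltW ?hk2.
(* The limit of each coordinate is reached at a rank that depends on [N],
   so the distance to it is split through one more term of the sequence. *)
have close (e : R) : 0 < e -> exists k, forall n, (k <= n)%N -> forall N,
    \sum_(0 <= j < N) sq (x n j - l j) <= e.
  move=> e0; have e40 : 0 < e / 4 by rewrite divr_gt0.
  have [k hk] := cx _ e40; exists k => n kn N.
  have [k' hk'] := tail N _ e40.
  pose m := maxn k k'.
  have h1 := hk' m (leq_maxr _ _).
  have h2 := hk n m kn (leq_maxl _ _).
  have h3 := sqsum_ge N (l2P (x n - x m)).
  apply: (@le_trans _ _ (\sum_(0 <= j < N)
      (2 * sq ((x n - x m : l2_type) j) + 2 * sq (x m j - l j)))).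
    apply: ler_sum => j _.
    have -> : x n j - l j = (x n - x m : l2_type) j + (x m j - l j).
      by rewrite /= addrA subrK.
    exact: sqDle.
  rewrite big_split/= -!mulr_sumr; move: h1 h2 h3; lra.
have sl : l2_summable l.
  have [k hk] := close 1 ltr01.
  have -> : l = (x k : nat -> K) + (-1) *: ((x k : nat -> K) - l).
    by rewrite scaleN1r opprB addrCA subrr addr0.
  apply: l2_summableD; first exact: l2P.
  by apply: l2_summableZ; exists 1 => N; exact: (hk k (leqnn k) N).
exists (mkl2 sl) => e e0.
have e20 : 0 < e / 2 by rewrite divr_gt0.
have [k hk] := close _ e20; exists k => n kn.
rewrite /l2_inner ipsumxx ?ltcR; last exact: l2P.
apply: (@le_lt_trans _ _ (e / 2)); last by lra.
by apply: sqsum_le => N; exact: hk n kn N.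
Qed.

Definition l2 : hilbert R := Hilbert l2_complete.
End EllTwo.

(** * Amplified operators *)

Section Coordinates.
Variables (R : realType) (K : hilbert R).
Implicit Types x y z : l2 K.

Lemma l2_ext x y : (forall k, x k = y k) -> x = y.
Proof. by move=> xy; apply/val_inj/funext. Qed.

Lemma l2_ipE x y : '[x, y] = ipsum x y.
Proof. by []. Qed.

Lemma l2_sqE x : sq x = sqsum x.
Proof. by rewrite /sq l2_ipE ipsumxx//; exact: l2P. Qed.

Fact l2_unit_summable j (v : K) : l2_summable (fun k : nat => if k == j then v else 0).
Proof.
exists (sq v) => n; case: (leqP n j) => [nj|jn].
  rewrite big_nat_cond big1 ?sq_ge0// => k /andP[/andP[_ kn] _].
  by rewrite ltn_eqF ?sq0// (leq_trans kn nj).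
rewrite (bigD1_seq j) ?mem_index_iota ?iota_uniq//= eqxx big1 ?addr0// => k kj.
by rewrite (negPf kj) sq0.
Qed.

Definition l2_unit j (v : K) : l2 K := mkl2 (l2_unit_summable j v).

Lemma l2_unitP j v y : '[l2_unit j v, y] = '[v, y j].
Proof.
rewrite l2_ipE; apply: ipsum_lim; [exact: l2P|exact: l2P|].
apply: cvg_near_cst; exists j.+1 => // n /= jn; rewrite /series /=.
rewrite (bigD1_seq j) ?mem_index_iota ?iota_uniq//= eqxx big1 ?addr0// => k kj.
by rewrite (negPf kj) ip0l.
Qed.

Lemma l2_unit_dense y : (forall j v, '[l2_unit j v, y] = 0) -> y = 0.
Proof.
move=> h; apply: l2_ext => k; apply: ip_eq0 => v.
by rewrite ipC -l2_unitP h conjc0.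
Qed.

Lemma l2_lipE a x y k : (a *: x + y : l2 K) k = a *: x k + y k.
Proof. by []. Qed.
End Coordinates.

Section Amplification.
Variable R : realType.
Implicit Types K L W : hilbert R.

Lemma bdd_summable K L (T : K -> L) (x : l2 K) : bdd T -> l2_summable (fun k => T (x k)).
Proof.
move=> [c c0 hc]; have [d hd] := l2P x; exists (c * d) => n.
apply: (@le_trans _ _ (\sum_(0 <= k < n) (c * sq (x k)))).
  by apply: ler_sum => k _; exact: hc.
by rewrite -mulr_sumr ler_wpM2l.
Qed.

(** For bounded [T], the tensor product of [T] with the identity operator of the
    space of square-summable scalar sequences. *)
Definition amp K L (T : K -> L) (x : l2 K) : l2 L :=
  if pselect (l2_summable (fun k => T (x k))) is left h then mkl2 h else 0.

Lemma ampE K L (T : K -> L) x k : bdd T -> amp T x k = T (x k).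
Proof.
by move=> bT; rewrite /amp; case: pselect => //; have := bdd_summable x bT.
Qed.

Lemma amp_adjp K L (T : K -> L) (S : L -> K) : adjp T S -> bdd T -> adjp (amp T) (amp S).
Proof.
move=> TS bT x y; rewrite !l2_ipE /ipsum.
suff -> : (fun k => '[amp T x k, y k]) = (fun k => '[x k, amp S y k]) by [].
by apply/funext => k; rewrite !ampE//; exact: bdd_adj bT.
Qed.

Lemma amp_comp K L W (T : K -> L) (S : L -> W) x : bdd S -> bdd T ->
  amp (S \o T) x = amp S (amp T x).
Proof.
by move=> bS bT; apply: l2_ext => k; rewrite !ampE//; exact: bdd_comp.
Qed.

Lemma amp_id K x : amp (@idfun K) x = x.
Proof. by apply: l2_ext => k; rewrite ampE//; exact: bdd_id. Qed.

Lemma amp0 K L x : amp (0 : K -> L) x = 0.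
Proof. by apply: l2_ext => k; rewrite ampE//; exact: bdd_zero. Qed.

Lemma amp_lin K L (a : R[i]) (S T : K -> L) x : bdd S -> bdd T ->
  amp (a *: S + T) x = a *: amp S x + amp T x.
Proof.
move=> bS bT; apply: l2_ext => k; rewrite l2_lipE !ampE//.
by apply: bdd_add => //; exact: bdd_scale.
Qed.

Lemma amp_unit K L (T : K -> L) j v : bdd T -> T 0 = 0 ->
  amp T (l2_unit j v) = l2_unit j (T v).
Proof. by move=> bT T0; apply: l2_ext => k; rewrite ampE//=; case: eqP. Qed.

(** The hypothesis is that the entries of the operator matrix [X] intertwine.
    Passing to adjoints reduces the claim to vectors supported in one
    coordinate, so that no convergence is involved. *)
Lemma amp_intertwine K L (X : l2 K -> l2 L) (Y : l2 L -> l2 K) (S : op L) (T : op K) :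
  adjp X Y -> bounded_op S -> bounded_op T ->
  (forall i j v, S (X (l2_unit j v) i) = X (l2_unit j (T v)) i) ->
  forall x, amp S (X x) = X (amp T x).
Proof.
move=> XY bS bT h x.
have SS := amp_adjp (adjP bS) (bounded_bdd bS).
have TT := amp_adjp (adjP bT) (bounded_bdd bT).
suff key w : Y (amp (adj S) w) = amp (adj T) (Y w).
  by apply: ip_inj => w; rewrite SS XY key -TT -XY.
apply/eqP; rewrite -subr_eq0; apply/eqP/l2_unit_dense => j v.
rewrite ipBr -XY -SS -TT -XY amp_unit; last 2 first.
- exact: bounded_bdd.
- by rewrite lin0//; exact: bounded_linear.
suff -> : amp S (X (l2_unit j v)) = X (l2_unit j (T v)) by rewrite subrr.
by apply: l2_ext => i; rewrite ampE ?h//; exact: bounded_bdd.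
Qed.

Lemma sw_formE K (x y : nat -> K) (T : op K) (sx : l2_summable x) (sy : l2_summable y) :
  bdd T -> sw_form x y T = '[amp T (mkl2 sx), mkl2 sy].
Proof.
move=> bT; rewrite l2_ipE /sw_form /ipsum.
suff -> : (fun k => '[T (x k), y k]) =
  (fun k => '[amp T (mkl2 sx) k, mkl2 sy k]) by [].
by apply/funext => k; rewrite ampE.
Qed.

(** Two square-summable sequences are put into one, so that sums of normal
    functionals are again given by a single pair of sequences. *)
Definition interleave_fun K (x y : nat -> K) (k : nat) : K :=
  if odd k then y k./2 else x k./2.

Lemma sum_double (V : zmodType) (f : nat -> V) n :
  \sum_(0 <= k < n.*2) f k = \sum_(0 <= k < n) f k.*2 + \sum_(0 <= k < n) f k.*2.+1.
Proof.
elim: n => [|n IH]; first by rewrite !big_nil addr0.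
by rewrite doubleS !big_nat_recr//= IH -!addrA; congr (_ + _); rewrite addrCA.
Qed.

Fact interleave_summable K (x y : l2 K) : l2_summable (interleave_fun x y).
Proof.
have [c hc] := l2P x; have [d hd] := l2P y; exists (c + d) => n.
apply: (@le_trans _ _ (\sum_(0 <= k < n.*2) sq (interleave_fun x y k))).
  rewrite -addnn [leRHS](big_cat_nat (n := n))//= ?leq_addr// lerDl sumr_ge0// => k _.
  exact: sq_ge0.
rewrite sum_double lerD//.
  rewrite (eq_bigr (fun k => sq (x k)))// => k _.
  by rewrite /interleave_fun odd_double doubleK.
rewrite (eq_bigr (fun k => sq (y k)))// => k _.
by rewrite /interleave_fun /= odd_double /= uphalf_double.
Qed.

Definition interleave K (x y : l2 K) : l2 K := mkl2 (interleave_summable x y).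

Lemma ip_interleave K (x y x' y' : l2 K) :
  '[interleave x y, interleave x' y'] = '[x, x'] + '[y, y'].
Proof.
have h := ipsum_cvg (l2P (interleave x y)) (l2P (interleave x' y')).
have dbl : (fun n : nat => n.*2) @ \oo --> \oo.
  move=> A [N _ hN]; exists N => // n /= Nn; apply: hN => /=.
  by rewrite (leq_trans Nn)// -addnn leq_addr.
have h2 := cvg_comp _ _ dbl h.
have h1 := cvgD (ipsum_cvg (l2P x) (l2P x')) (ipsum_cvg (l2P y) (l2P y')).
suff e : (series (fun k => '[interleave x y k, interleave x' y' k]) : nat -> R[i]^o)
    \o (fun n => n.*2) =
    (series (fun k => '[x k, x' k]) : nat -> R[i]^o) + series (fun k => '[y k, y' k]).
  by rewrite e in h2; rewrite !l2_ipE -(cvg_lim _ h2)// (cvg_lim _ (h1 _)).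
apply/funext => n; rewrite /series /= sum_double; congr (_ + _); apply: eq_bigr => k _.
  by rewrite /interleave_fun odd_double doubleK.
by rewrite /interleave_fun /= odd_double /= uphalf_double.
Qed.

Lemma sq_interleave K (x y : l2 K) : sq (interleave x y) = sq x + sq y.
Proof. by rewrite /sq ip_interleave; case: '[x, x] '[y, y] => ? ? [? ?]. Qed.

Lemma amp_interleave K L (T : K -> L) (x y : l2 K) : bdd T ->
  amp T (interleave x y) = interleave (amp T x) (amp T y).
Proof.
move=> bT; apply: l2_ext => k; rewrite ampE// /= /interleave_fun.
by case: ifP => _; rewrite ampE.
Qed.
End Amplification.

(** * Normal functionals *)

Section Intertwine.
Variable R : realType.
Implicit Types K L : hilbert R.

(** Pairs of operators that preserve the graph, together with their adjoints,
    are intertwined by its extension: [T' (Y y)] and [Y (S' y)] satisfy the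
    same equations on the domain and both lie in its closure. *)
Lemma extension_intertwine K L (G : K -> L -> Prop) (X : K -> L) (Y : L -> K)
    (T T' : op K) (S S' : op L) :
  adjp X Y -> (forall k l, G k l -> X k = l) ->
  (forall w, (forall k l, G k l -> '[k, w] = 0) -> X w = 0) ->
  adjp T T' -> adjp S S' ->
  (forall k l, G k l -> G (T k) (S l)) -> (forall k l, G k l -> G (T' k) (S' l)) ->
  forall w, X (T w) = S (X w).
Proof.
move=> XY XG X0 TT SS GT GT' w; apply: ip_inj => y.
rewrite XY TT SS XY; congr '[_, _].
apply/eqP; rewrite -subr_eq0; apply/eqP; set d := _ - _.
have dG k l : G k l -> '[k, d] = 0.
  move=> Gkl; rewrite ipBr -TT -XY (XG _ _ (GT _ _ Gkl)) -XY (XG _ _ Gkl) SS.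
  by rewrite subrr.
have Y0 z v : (forall k l, G k l -> '[k, v] = 0) -> '[Y z, v] = 0.
  by move=> /X0 Xv; rewrite (adjp_sym XY) Xv ip0r.
apply: sq_eq0; rewrite /sq {1}/d ipBl (Y0 _ _ dG) (adjp_sym TT) Y0 ?subrr// => k l Gkl.
by rewrite -(adjp_sym TT) (dG _ _ (GT' _ _ Gkl)).
Qed.

Lemma sq_unit K j (v : K) : sq (l2_unit j v) = sq v.
Proof. by rewrite /sq l2_unitP /= eqxx. Qed.

Lemma sq_coord K (x : l2 K) j : sq (x j) <= sq x.
Proof. by rewrite l2_sqE; apply: (sq_le_sqsum j); exact: l2P. Qed.

Definition entry K L (X : l2 K -> l2 L) i j (v : K) : L := X (l2_unit j v) i.

Lemma entry_adjp K L (X : l2 K -> l2 L) (Y : l2 L -> l2 K) i j :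
  adjp X Y -> adjp (entry X i j) (entry Y j i).
Proof.
by move=> XY v w; rewrite /entry ipC -l2_unitP -ipC XY l2_unitP.
Qed.

Lemma entry_bdd K L (X : l2 K -> l2 L) i j : bdd X -> bdd (entry X i j).
Proof.
move=> [c c0 hc]; exists c => // v; apply: le_trans (sq_coord _ _) _.
by apply: le_trans (hc _) _; rewrite sq_unit.
Qed.
End Intertwine.

Section NormalFunctionals.
Variables (R : realType) (K : hilbert R).
Implicit Types (A B : set (op K)) (S T : op K) (f g : op K -> R[i]).

Record star_algebra A : Prop := StarAlgebra {
  sa_bounded : forall T, A T -> bounded_op T;
  sa_id : A idfun;
  sa_lin : forall a S T, A S -> A T -> A (a *: S + T);
  sa_comp : forall S T, A S -> A T -> A (S \o T);
  sa_adj : forall T, A T -> A (adj T) }.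

Lemma vn_star_algebra A : von_neumann A -> star_algebra A.
Proof.
move=> vA; split; first exact: vn_bounded.
- exact: vn_id.
- by move=> a S T AS AT; apply: vn_add => //; exact: vn_scale.
- exact: vn_comp.
- exact: vn_adj.
Qed.

(** The ultraweakly continuous functionals: '[amp T x, y] is the sum of the
    '[T (x k), y k]. *)
Definition nfun A f := exists x y : l2 K, forall T, A T -> f T = '[amp T x, y].

Lemma nfun_lin A a f g : A `<=` @bounded_op R K -> nfun A f -> nfun A g ->
  nfun A (fun T => a * f T + g T).
Proof.
move=> bA [x [y fE]] [x' [y' gE]].
exists (interleave x x'), (interleave (conjc a *: y) y') => T AT.
rewrite amp_interleave; last exact/bounded_bdd/bA.
by rewrite ip_interleave ipZr conjcK fE// gE.
Qed.

Lemma nfun_ext A f g : (forall T, A T -> f T = g T) -> nfun A f -> nfun A g.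
Proof. by move=> fg [x [y fE]]; exists x, y => T AT; rewrite -fg// fE. Qed.

Lemma nfun0 A : nfun A (fun=> 0).
Proof. by exists 0, 0 => T _; rewrite ip0r. Qed.

Lemma nfun_vec A (x y : K) : A `<=` @bounded_op R K -> nfun A (fun T => '[T x, y]).
Proof.
move=> bA; exists (l2_unit 0 x), (l2_unit 0 y) => T /bA bT.
rewrite amp_unit ?l2_unitP//=; first exact: bounded_bdd.
by rewrite lin0//; exact: bounded_linear.
Qed.

(** Von Neumann's density theorem for one ultraweakly continuous functional:
    the projection [X] onto the closure of [amp A x] commutes with [amp A], so
    its entries lie in the commutant of [A] and [X] commutes with [amp T] for
    [T] in the bicommutant. *)
Lemma bicommutant_density A (x y : l2 K) : star_algebra A ->
  (forall T, A T -> '[amp T x, y] = 0) ->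
  forall T, commutant (commutant A) T -> '[amp T x, y] = 0.
Proof.
move=> sA Axy T [bT hT].
have ampb S : A S -> bdd S by move=> /(sa_bounded sA)/bounded_bdd.
pose G (k l : l2 K) := exists2 S, A S & k = amp S x /\ l = k.
have [||X [Y [XY bX XG X0 Y0]]] := @extension R _ _ G 1 ler01.
- split.
    exists (0 : op K); last by rewrite amp0.
    by rewrite -(addNr idfun) -scaleN1r; apply: sa_lin => //; exact: sa_id.
  move=> a k l k' l' [S AS [-> ->]] [S' AS' [-> ->]].
  exists (a *: S + S'); first exact: sa_lin.
  by rewrite amp_lin//; exact: ampb.
- by move=> k l [S AS [-> ->]]; rewrite mul1r.
have comm S : A S -> forall w, X (amp S w) = amp S (X w).
  move=> AS; have bS := sa_bounded sA AS.
  apply: (extension_intertwine XY XG X0 (amp_adjp (adjP bS) (ampb _ AS))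
            (amp_adjp (adjP bS) (ampb _ AS))).
    move=> k l [S' AS' [-> ->]]; exists (S \o S'); first exact: sa_comp.
    by rewrite amp_comp//; exact: ampb.
  move=> k l [S' AS' [-> ->]]; exists (adj S \o S').
    by apply: sa_comp => //; exact: sa_adj.
  by rewrite amp_comp//; [exact/ampb/(sa_adj sA)|exact: ampb].
have entryA i j : commutant A (entry X i j).
  split.
    exact: (adjp_bounded (entry_adjp i j XY) (entry_bdd i j bX)).
  move=> S AS; apply/funext => v; rewrite /entry /=.
  have bS := ampb _ AS.
  rewrite -amp_unit//; last by rewrite lin0//; exact: bounded_linear (sa_bounded sA AS).
  by rewrite comm// ampE.
have Xx : X x = x.
  by apply: XG; exists idfun; [exact: sa_id|rewrite amp_id].
rewrite -[in amp T x]Xx (amp_intertwine XY bT bT); last first.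
  by move=> i j v; have /(congr1 (@^~ v)) := hT _ (entryA i j).
rewrite XY Y0 ?ip0r// => k l [S AS [-> ->]]; exact: Axy.
Qed.

Lemma nfun_density A f g : star_algebra A ->
  nfun (commutant (commutant A)) f -> nfun (commutant (commutant A)) g ->
  (forall T, A T -> f T = g T) ->
  forall T, commutant (commutant A) T -> f T = g T.
Proof.
move=> sA nf ng fg T AT.
have [x [y h]] := nfun_lin (-1) (@commutant_bounded _ _ _) nf ng.
have subA : A `<=` commutant (commutant A).
  by apply: sub_bicommutant => S; exact: sa_bounded.
apply/esym/eqP; rewrite -subr_eq0 addrC -mulN1r h//; apply/eqP.
apply: (bicommutant_density sA) => // S AS.
by rewrite -h ?fg ?mulN1r ?addNr//; exact: subA.
Qed.

(** A functional that vanishes where finitely many normal functionals vanish is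
    a linear combination of them, by induction on their number. *)
Lemma nfun_span A f (l : seq (l2 K * l2 K)) : star_algebra A ->
  (forall a S T, A S -> A T -> f (a *: S + T) = a * f S + f T) ->
  (forall S, A S -> (forall p, p \in l -> '[amp S p.1, p.2] = 0) -> f S = 0) ->
  nfun A f.
Proof.
move=> sA; elim: l f => [|p l IH] f flin f0.
  by apply: nfun_ext (nfun0 A) => T AT; rewrite f0.
pose g S := '[amp S p.1, p.2].
have bA : A `<=` @bounded_op R K by move=> T; exact: sa_bounded.
have glin a S T : A S -> A T -> g (a *: S + T) = a * g S + g T.
  by move=> /bA/bounded_bdd bS /bA/bounded_bdd bT; rewrite /g amp_lin// ipDl ipZl.
have [[S0 [AS0 S0l gS0]]|none] := pselect (exists S, [/\ A S,
    forall q, q \in l -> '[amp S q.1, q.2] = 0 & g S != 0]); last first.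
  apply: IH => // S AS Sl; apply: f0 => // q; rewrite inE => /orP[/eqP->|/Sl//].
  by apply/eqP/negPn/negP => gS; apply: none; exists S.
pose a := f S0 / g S0.
have gn : nfun A g by exists p.1, p.2.
suff fn : nfun A (fun S => (- a) * g S + f S).
  by apply: nfun_ext (nfun_lin a bA gn fn) => S _; rewrite mulNr addrA subrr add0r.
apply: IH => [b S T AS AT|S AS Sl]; first by rewrite glin// flin//; ring.
pose b := - (g S / g S0).
have AbS : A (b *: S0 + S) by exact: sa_lin.
have h : f (b *: S0 + S) = 0.
  apply: f0 => // q; rewrite inE => /orP[/eqP->|ql].
    by rewrite -/(g _) glin// /b mulNr divfK// addNr.
  have [b1 b2] := (bounded_bdd (bA _ AS0), bounded_bdd (bA _ AS)).
  by rewrite amp_lin// ipDl ipZl S0l// Sl// mulr0 addr0.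
by move: h; rewrite flin// => <-; rewrite /a /b; field.
Qed.
End NormalFunctionals.

Section Pullback.
Variables (R : realType) (H K : hilbert R).

(** Normality, as ultraweak continuity along filters, is used only for the
    neighbourhood filter of [0]: the composite is then bounded on a basic
    neighbourhood, hence vanishes where finitely many normal functionals do. *)
Lemma normal_pullback (A : set (op H)) (B : set (op K)) (f : op H -> op K)
    (g : op K -> R[i]) :
  star_algebra A -> B `<=` @bounded_op R K -> (forall T, A T -> B (f T)) ->
  linear_on A f -> normal_map A f -> nfun B g -> nfun A (fun T => g (f T)).
Proof.
move=> sA bB AB flin fnorm [x0 [y0 gE]].
have bA T : A T -> bdd T by move=> /(sa_bounded sA)/bounded_bdd.
have A0 : A 0.
  by rewrite -(addNr idfun) -scaleN1r; apply: sa_lin => //; exact: sa_id.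
have f0 : f 0 = 0.
  by have := flin (-1) 0 0 A0 A0; rewrite scaler0 addr0 scaleN1r addNr.
pose F : set_system (op H) := [set V | exists (l : seq (l2 H * l2 H)) (e : R), 0 < e /\
  forall S, A S -> (forall p, p \in l -> nsq '[amp S p.1, p.2] < e) -> V S].
have FF : ProperFilter F.
  apply: Build_ProperFilter_ex => [V [l [e [e0 h]]]|].
    exists 0; apply: h => // p _.
    by rewrite amp0 ip0l /nsq /= expr0n addr0.
  split; first by exists [::], 1.
  - move=> V V' [l [e [e0 h]]] [l' [e' [e'0 h']]].
    exists (l ++ l'), (Num.min e e'); split; first by rewrite lt_min e0.
    move=> S AS Sl; split; [apply: h|apply: h'] => // p pl.
      by have := Sl p; rewrite mem_cat pl lt_min => /(_ erefl)/andP[].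
    by have := Sl p; rewrite mem_cat pl orbT lt_min => /(_ erefl)/andP[].
  - move=> V V' VV' [l [e [e0 h]]]; exists l, e; split=> // S AS Sl.
    exact/VV'/h.
have FA : F A by exists [::], 1; split.
have F0 : sw_cvg F 0.
  move=> x y /square_summableP sx /square_summableP sy.
  rewrite (sw_formE sx sy); last exact: bdd_zero.
  rewrite amp0 ip0l; apply/cvgrPdist_lt => e e0.
  have re : e = (complex.Re e)%:C by rewrite RRe_real// gtr0_real.
  have re0 : 0 < complex.Re e by rewrite -ltcR -re.
  exists [:: (mkl2 sx, mkl2 sy)], (complex.Re e ^+ 2); split; first exact: exprn_gt0.
  move=> S AS /(_ _ (mem_head _ _)) /= h.
  rewrite sub0r normrN (sw_formE sx sy); last exact: bA.
  rewrite -(@ltr_pXn2r _ 2)// ?nnegrE ?normr_ge0// ?ltW// nsqE re -rmorphXn /=.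
  by rewrite ltcR.
have := fnorm F 0 FF FA A0 F0; rewrite f0.
move=> /(_ x0 y0 ((square_summableP _).2 (l2P x0)) ((square_summableP _).2 (l2P y0))).
have e2 (z : l2 K) : mkl2 (l2P z) = z by apply: l2_ext.
rewrite (sw_formE (l2P x0) (l2P y0)) ?e2; last exact: bdd_zero.
rewrite amp0 ip0l => /cvgrPdist_lt /(_ 1 ltr01) [l [e [e0 h]]].
have {}h S : A S -> (forall p, p \in l -> nsq '[amp S p.1, p.2] < e) ->
    nsq (g (f S)) < 1.
  move=> AS /(h _ AS) /=; rewrite sub0r normrN.
  rewrite (sw_formE (l2P x0) (l2P y0)) ?e2; last exact/bounded_bdd/bB/AB.
  rewrite gE; last exact: AB.
  by rewrite -(@ltr_pXn2r _ 2)// ?nnegrE ?normr_ge0// nsqE expr1n ltcR.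
have glin a S T : A S -> A T -> g (f (a *: S + T)) = a * g (f S) + g (f T).
  move=> AS AT; rewrite !gE; [|exact: AB|exact: AB|by apply/AB/(sa_lin sA)].
  rewrite flin// amp_lin ?ipDl ?ipZl//; exact/bounded_bdd/bB/AB.
apply: (@nfun_span _ _ _ _ l) => // S AS Sl.
apply/nsq_eq0; rewrite leNgt; apply/negP => n0.
(* Rescale [S] inside the common kernel to contradict the bound. *)
pose t := 1 / Num.sqrt (nsq (g (f S))).
have tS : t%:C *: S = t%:C *: S + 0 by rewrite addr0.
have AtS : A (t%:C *: S) by rewrite tS; exact: sa_lin.
have g0 : g 0 = 0 by rewrite gE ?amp0 ?ip0l// -f0; exact: AB.
have : nsq (g (f (t%:C *: S))) < 1.
  apply: h => // p pl; rewrite tS amp_lin; [|exact: bA|exact: bdd_zero].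
  by rewrite amp0 addr0 ipZl Sl// mulr0 /nsq /= expr0n addr0.
rewrite tS glin// f0 g0 addr0 nsqM nsq_real expr_div_n expr1n sqr_sqrtr ?nsq_ge0//.
by rewrite mul1r mulVf ?gt_eqF// ltxx.
Qed.
End Pullback.

(** * Intertwiners, and transport of operators along them *)

Section LogConvex.
Variable R : realType.

Lemma bernoulli (r : R) n : 1 <= r -> 1 + n%:R * (r - 1) <= r ^+ n.
Proof.
move=> r1; elim: n => [|n IH]; first by rewrite mul0r addr0 expr0.
have n0 : 0 <= n%:R :> R by exact: ler0n.
rewrite exprS -natr1.
apply: (@le_trans _ _ (r * (1 + n%:R * (r - 1)))); last by rewrite ler_wpM2l//; lra.
by have := mulr_ge0 n0 (sqr_ge0 (r - 1)); lra.
Qed.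

Lemma powers_bounded (r C : R) : (forall k, r ^+ (2 ^ k) <= C) -> r <= 1.
Proof.
move=> h; rewrite leNgt; apply/negP => r1.
have d0 : 0 < r - 1 by lra.
pose k := (Num.truncn (`|C| / (r - 1))).+1.
have h1 : C < k%:R * (r - 1).
  rewrite -ltr_pdivrMr//; apply: le_lt_trans (truncnS_gt _).
  by rewrite ler_pM2r ?invr_gt0// ler_norm.
have h2 := bernoulli (2 ^ k) (ltW r1).
have h3 : k%:R * (r - 1) <= (2 ^ k)%:R * (r - 1).
  by rewrite ler_pM2r// ler_nat ltnW// ltn_expl.
have := h k; lra.
Qed.

(** Iterating the convexity hypothesis along powers of 2 gives
    [(s 1 / s 0)^(2^k) <= C / s 0 * d^(2^k)], and [C] disappears in the limit. *)
Lemma log_convex_bound (s : nat -> R) (C d : R) : 0 <= d ->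
  (forall m, 0 <= s m) -> (forall m, s m ^+ 2 <= s (m + m)%N * s 0%N) ->
  (forall m, s m <= C * d ^+ m) -> s 1%N <= d * s 0%N.
Proof.
move=> d0 s_ge0 conv grow.
have [s0|s0] := eqVneq (s 0%N) 0.
  have := conv 1%N; rewrite s0 !mulr0 => h.
  have : s 1%N ^+ 2 == 0 by rewrite eq_le h sqr_ge0.
  by rewrite sqrf_eq0 => /eqP->.
have sp : 0 < s 0%N by rewrite lt0r s0 s_ge0.
have [dz|dz] := eqVneq d 0.
  by have := grow 1%N; rewrite dz expr1 mulr0 mul0r.
have dp : 0 < d by rewrite lt0r dz.
have step k : (s 1%N / s 0%N) ^+ (2 ^ k) <= s (2 ^ k)%N / s 0%N.
  elim: k => [|k IH]; first by rewrite expn0 expr1.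
  rewrite expnS mulnC exprM -[(2 ^ k * 2)%N]/(2 ^ k * 2)%N muln2 -addnn.
  apply: (@le_trans _ _ ((s (2 ^ k)%N / s 0%N) ^+ 2)).
    by rewrite lerXn2r ?nnegrE ?exprn_ge0// divr_ge0.
  rewrite expr_div_n ler_pdivrMr ?exprn_gt0//.
  apply: le_trans (conv _) _.
  by rewrite expr2 mulrA divfK.
rewrite -ler_pdivrMr// -[leRHS]mul1r -ler_pdivrMr//.
apply: (@powers_bounded _ (C / s 0%N)) => k.
rewrite expr_div_n ler_pdivrMr ?exprn_gt0//.
apply: le_trans (step k) _.
by rewrite mulrAC ler_pM2r ?invr_gt0.
Qed.
End LogConvex.

Section SpatialSetup.
Variable R : realType.
Implicit Types K L : hilbert R.

(** A *-algebra of pairs, to be thought of as the graph of a *-isomorphism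
    between two operator algebras. *)
Record star_rel K L (Z : op K -> op L -> Prop) : Prop := StarRel {
  sr_bounded1 : forall T S, Z T S -> bounded_op T;
  sr_bounded2 : forall T S, Z T S -> bounded_op S;
  sr_id : Z idfun idfun;
  sr_lin : forall a T S T' S', Z T S -> Z T' S' -> Z (a *: T + T') (a *: S + S');
  sr_comp : forall T S T' S', Z T S -> Z T' S' -> Z (T \o T') (S \o S');
  sr_adj : forall T S, Z T S -> Z (adj T) (adj S) }.

Definition flip K L (Z : op K -> op L -> Prop) S T := Z T S.

Lemma star_rel_flip K L (Z : op K -> op L -> Prop) : star_rel Z -> star_rel (flip Z).
Proof.
move=> sZ; split; rewrite /flip.
- by move=> T S; exact: sr_bounded2.
- by move=> T S; exact: sr_bounded1.
- exact: sr_id.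
- by move=> a T S T' S'; exact: sr_lin.
- by move=> T S T' S'; exact: sr_comp.
- by move=> T S; exact: sr_adj.
Qed.

Definition src K L (Z : op K -> op L -> Prop) : set (op K) := [set T | exists S, Z T S].

Lemma star_algebra_src K L (Z : op K -> op L -> Prop) : star_rel Z -> star_algebra (src Z).
Proof.
move=> sZ; split.
- by move=> T [S ZTS]; exact: sr_bounded1 ZTS.
- by exists idfun; exact: sr_id.
- by move=> a T T' [S h] [S' h']; exists (a *: S + S'); exact: sr_lin.
- by move=> T T' [S h] [S' h']; exists (S \o S'); exact: sr_comp.
- by move=> T [S h]; exists (adj S); exact: sr_adj.
Qed.

(** The von Neumann algebra generated by the first components; for the second
    components this is [bicomm (flip Z)]. *)
Definition bicomm K L (Z : op K -> op L -> Prop) := commutant (commutant (src Z)).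

Lemma bicomm_vn K L (Z : op K -> op L -> Prop) : star_rel Z -> von_neumann (bicomm Z).
Proof.
move=> /star_algebra_src sA; apply: bicommutant_vn; first by move=> T /(sa_bounded sA).
by move=> T /(sa_adj sA).
Qed.

Lemma src_bicomm K L (Z : op K -> op L -> Prop) T S : star_rel Z -> Z T S -> bicomm Z T.
Proof.
move=> sZ ZTS; have sA := star_algebra_src sZ.
by apply: sub_bicommutant; [move=> X /(sa_bounded sA)|exists S].
Qed.

Record intertw K L (Z : op K -> op L -> Prop) (X : K -> L) (Y : L -> K) : Prop := {
  it_adjp : adjp X Y;
  it_bdd : bdd X;
  it_comm : forall T S, Z T S -> forall v, X (T v) = S (X v) }.

Lemma intertw_flip K L (Z : op K -> op L -> Prop) X Y : star_rel Z ->
  intertw Z X Y -> intertw (flip Z) Y X.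
Proof.
move=> sZ [XY bX hX]; split; [exact: adjp_sym|exact: bdd_adj XY bX|].
move=> S T ZTS w; apply: ip_inj => v.
have TT := adjP (sr_bounded1 sZ ZTS); have SS := adjP (sr_bounded2 sZ ZTS).
by rewrite (adjp_sym XY) SS TT (adjp_sym XY) (hX _ _ (sr_adj sZ ZTS)).
Qed.

Lemma intertw_commutant K L (Z : op K -> op L -> Prop) X Y X' Y' : star_rel Z ->
  intertw Z X Y -> intertw Z X' Y' -> commutant (src Z) (Y' \o X).
Proof.
move=> sZ iX iX'; have [XY' bX' _] := intertw_flip sZ iX'; have [XY bX hX] := iX.
split; first exact: adjp_bounded (adjp_comp XY XY') (bdd_comp bX bX').
move=> T [S ZTS]; apply/funext => v /=.
by rewrite (hX _ _ ZTS) (it_comm (intertw_flip sZ iX') ZTS).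
Qed.

(** Intertwiners are stable under the commutant, which is why transported
    operators land in the bicommutant. *)
Lemma intertw_mul K L (Z : op K -> op L -> Prop) X Y C : star_rel Z ->
  intertw Z X Y -> commutant (src (flip Z)) C -> intertw Z (C \o X) (Y \o adj C).
Proof.
move=> sZ [XY bX hX] [bC hC]; split.
- exact: adjp_comp XY (adjP bC).
- exact: bdd_comp bX (bounded_bdd bC).
- move=> T S ZTS v /=; rewrite (hX _ _ ZTS).
  by have /(congr1 (@^~ (X v))) := hC S (ex_intro _ T ZTS).
Qed.

(** The ranges of the intertwiners span a dense subspace of [L]. *)
Definition full_intertw K L (Z : op K -> op L -> Prop) :=
  forall w : L, (forall X Y, intertw Z X Y -> Y w = 0) -> w = 0.

Lemma full_intertw_agree K L (Z : op K -> op L -> Prop) (D D' : op L) :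
  full_intertw Z -> bounded_op D -> bounded_op D' ->
  (forall X Y, intertw Z X Y -> forall v, D (X v) = D' (X v)) -> D = D'.
Proof.
move=> nd bD bD' h; apply/funext => w; apply: ip_inj => z.
rewrite (adjP bD) (adjP bD'); congr '[_, _].
apply/eqP; rewrite -subr_eq0; apply/eqP; apply: nd => X Y iX.
apply: ip_eq0 => v; rewrite (adjp_sym (it_adjp iX)) ipC ipBr -(adjP bD) -(adjP bD').
by rewrite (h _ _ iX) subrr conjc0.
Qed.

Section Transport.
Variables (K L : hilbert R) (Z : op K -> op L -> Prop).
Hypotheses (sZ : star_rel Z) (ndZ : full_intertw Z).

Implicit Types (f g : seq ((K -> L) * K)).

(** A formal sum of vectors [X v], with [X] an intertwiner; operators on [K] act
    on the vectors [v]. *)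
Definition comb_eval f : L := \sum_(p <- f) p.1 p.2.
Definition comb_act (T : op K) f := [seq (p.1, T p.2) | p <- f].
Definition good_comb f := forall p, p \in f -> exists Y, intertw Z p.1 Y.

Lemma comb_eval_cons p f : comb_eval (p :: f) = p.1 p.2 + comb_eval f.
Proof. by rewrite /comb_eval big_cons. Qed.

Lemma comb_eval_cat f g : comb_eval (f ++ g) = comb_eval f + comb_eval g.
Proof. by rewrite /comb_eval big_cat. Qed.

Lemma good_comb_cons p f : good_comb (p :: f) -> (exists Y, intertw Z p.1 Y) /\ good_comb f.
Proof.
move=> h; split; first by apply: h; exact: mem_head.
by move=> q qf; apply: h; rewrite inE qf orbT.
Qed.

Lemma comb_act_good T f : good_comb f -> good_comb (comb_act T f).
Proof. by move=> h _ /mapP[p /h pf ->]. Qed.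

(** The products [Y' \o X] lie in the commutant of the first algebra, so that
    [T] may be moved across them. *)
Lemma comb_act_adj T f g : bicomm Z T -> good_comb f -> good_comb g ->
  '[comb_eval (comb_act T f), comb_eval g] = '[comb_eval f, comb_eval (comb_act (adj T) g)].
Proof.
move=> [bT hT]; elim: f => [|p f IH] gf gg.
  by rewrite /comb_eval /= big_nil !ip0l.
have [[Y iY] gf'] := good_comb_cons gf.
rewrite /= !comb_eval_cons !ipDl IH//; congr (_ + _) => {IH gf gf' f} /=.
elim: g gg => [|q g IH] gg; first by rewrite /comb_eval big_nil !ip0r.
have [[Y' iY'] gg'] := good_comb_cons gg.
rewrite /= !comb_eval_cons !ipDr IH//; congr (_ + _) => {IH gg gg' g} /=.
have /(congr1 (@^~ p.2)) /= h := hT _ (intertw_commutant sZ iY iY').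
have XY' := adjp_sym (it_adjp iY').
by rewrite -XY' -h (adjP bT) XY'.
Qed.

Lemma comb_act_comp T S f : comb_act S (comb_act T f) = comb_act (S \o T) f.
Proof. by rewrite /comb_act -map_comp. Qed.

Lemma comb_act_growth U (d : R) f : 0 <= d -> (forall x, sq (U x) <= d * sq x) -> good_comb f ->
  exists C, forall m, sq (comb_eval (comb_act (iter m (fun V => U \o V) idfun) f)) <= C * d ^+ m.
Proof.
move=> d0 hU; elim: f => [|p f IH] gf.
  by exists 0 => m; rewrite /comb_eval big_nil sq0 mul0r.
have [[Y [_ [c c0 hc] _]] /IH[C hC]] := good_comb_cons gf.
exists (2 * (c * sq p.2) + 2 * C) => m; rewrite /= comb_eval_cons mulrDl.
apply: le_trans (sqDle _ _) _; rewrite -!mulrA lerD// ler_wpM2l//.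
apply: le_trans (hc _) _; rewrite ler_wpM2l// {hC IH gf}.
elim: m => [|m IH]; first by rewrite expr0 mulr1.
by rewrite iterS /=; apply: le_trans (hU _) _; rewrite exprS mulrCA ler_wpM2l.
Qed.

(** The map [X v |-> X (T v)] is bounded. With [U] the operator [adj T \o T],
    the numbers [sq (sum X (U^m v))] satisfy [s m ^ 2 <= s (2 m) * s 0] by
    [comb_act_adj] and grow at most geometrically, so [s 1] is at most a
    multiple of [s 0] that does not depend on the sum. *)
Lemma comb_act_bound T : bicomm Z T -> exists2 c, 0 <= c &
  forall f, good_comb f -> sq (comb_eval (comb_act T f)) <= c * sq (comb_eval f).
Proof.
move=> AT; have vA := bicomm_vn sZ; have AT' := vn_adj vA AT.
pose U := adj T \o T; have AU : bicomm Z U by exact: vn_comp.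
have UU : adj U = U.
  by rewrite /U adj_comp ?adjK//; apply: (vn_bounded vA).
have [d d0 hd] := bounded_bdd (vn_bounded vA AU).
exists (d + 1); first lra.
move=> f gf; pose P m := iter m (fun V => U \o V) idfun.
have AP m : bicomm Z (P m).
  by elim: m => [|m IH]; [exact: vn_id|exact: vn_comp].
have PD m n : P (m + n)%N = P m \o P n.
  by elim: m => // m IH; rewrite addSn [LHS]/= -/(P _) IH.
have PP m : adj (P m) = P m.
  elim: m => [|m IH]; first by rewrite adj_id.
  rewrite [P m.+1]/= -/(P m) adj_comp ?UU ?IH; [|exact: (vn_bounded vA)..].
  by have := PD m 1%N; rewrite addn1.
pose s m := sq (comb_eval (comb_act (P m) f)).
have sE m : '[comb_eval (comb_act (P (m + m)%N) f), comb_eval f] = (s m)%:C.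
  by rewrite PD -comb_act_comp comb_act_adj// ?PP ?ipxx//; exact: comb_act_good.
have f0 : comb_act (P 0%N) f = f by rewrite /comb_act map_id_in// => -[].
have s1 : s 1%N <= d * s 0%N.
  have [C hC] := comb_act_growth d0 hd gf.
  apply: (log_convex_bound d0 _ _ hC) => m; first exact: sq_ge0.
  rewrite -nsq_real -sE; apply: le_trans (cauchy_schwarz _ _) _.
  by rewrite /s f0.
have h : (sq (comb_eval (comb_act T f))) ^+ 2 <= s 1%N * s 0%N.
  rewrite -nsq_real -ipxx comb_act_adj//; last exact: comb_act_good.
  rewrite ipC nsqJ comb_act_comp; apply: le_trans (cauchy_schwarz _ _) _.
  by rewrite /s f0.
have s0 : s 0%N = sq (comb_eval f) by rewrite /s f0.
rewrite s0 in s1 h; have e0 := sq_ge0 (comb_eval f).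
rewrite -(@ler_pXn2r _ 2)// ?nnegrE ?sq_ge0// ?mulr_ge0//; last lra.
apply: le_trans h _; apply: (@le_trans _ _ (d * sq (comb_eval f) * sq (comb_eval f))).
  by rewrite ler_wpM2r.
rewrite exprMn -mulrA -expr2 ler_wpM2r ?sqr_ge0//.
by rewrite sqrrD1; have := sqr_ge0 d; lra.
Qed.

Definition transported (T : op K) (S : op L) :=
  forall X Y, intertw Z X Y -> forall v, S (X v) = X (T v).

Lemma transport T : bicomm Z T -> exists2 S, bicomm (flip Z) S & transported T S.
Proof.
move=> AT; have lT := bounded_linear (vn_bounded (bicomm_vn sZ) AT).
have [c c0 hc] := comb_act_bound AT.
pose G (l l' : L) := exists2 f, good_comb f & l = comb_eval f /\ l' = comb_eval (comb_act T f).
have [||S [S' [SS bS SG _ _]]] := @extension R L L G c c0.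
- split.
    exists [::] => //; split; by rewrite /comb_eval big_nil.
  move=> a _ _ _ _ [f gf [-> ->]] [g gg [-> ->]].
  exists ([seq (p.1, a *: p.2) | p <- f] ++ g).
    move=> p; rewrite mem_cat => /orP[/mapP[q /gf h ->]//|/gg//].
  have evZ f' : good_comb f' -> comb_eval [seq (p.1, a *: p.2) | p <- f'] = a *: comb_eval f'.
    elim: f' => [|p f' IH] gf'; first by rewrite /comb_eval !big_nil scaler0.
    have [[Y [XY _ _]] gf1] := good_comb_cons gf'.
    by rewrite /= !comb_eval_cons IH// scalerDr /= (linZ _ _ (adjp_linear XY)).
  have -> : comb_act T ([seq (p.1, a *: p.2) | p <- f] ++ g) =
      [seq (p.1, a *: p.2) | p <- comb_act T f] ++ comb_act T g.
    rewrite /comb_act map_cat -!map_comp; congr (_ ++ _).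
    by apply: eq_map => p /=; rewrite linZ.
  by rewrite !comb_eval_cat !evZ//; exact: comb_act_good.
- by move=> _ _ [f gf [-> ->]]; exact: hc.
have tS : transported T S.
  move=> X Y iX v; apply: SG; exists [:: (X, v)].
    by move=> p; rewrite inE => /eqP->; exists Y.
  by rewrite /comb_eval /= !big_seq1.
exists S => //; split; first exact: adjp_bounded SS bS.
move=> C hC; have bS' := adjp_bounded SS bS; have bC := commutant_bounded hC.
apply: (full_intertw_agree ndZ); [exact: bounded_comp..|].
move=> X Y iX v /=.
by have /= -> := tS _ _ (intertw_mul sZ iX hC) v; rewrite (tS _ _ iX).
Qed.

Lemma transported_uniq T S S' : bounded_op S -> bounded_op S' ->
  transported T S -> transported T S' -> S = S'.
Proof.
move=> bS bS' tS tS'; apply: (full_intertw_agree ndZ) => // X Y iX v.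
by rewrite (tS _ _ iX) (tS' _ _ iX).
Qed.

(** The difference of the two sides is tested against the vectors [X' v'], on
    which [T] commutes with [Y' \o X]. *)
Lemma transported_adj T S : bicomm Z T -> bounded_op S ->
  transported T S -> transported (adj T) (adj S).
Proof.
move=> [bT hT] bS tS X Y iX v; apply/eqP; rewrite -subr_eq0; apply/eqP.
apply: ndZ => X' Y' iX'; apply: ip_eq0 => v'.
have XY' := adjp_sym (it_adjp iX').
rewrite XY' ipBl (adjp_sym (adjP bS)) (tS _ _ iX').
have /(congr1 (@^~ (adj T v))) /= h := hT _ (intertw_commutant sZ iX iX').
have e : '[X v, X' (T v')] = '[adj T (Y' (X v)), v'].
  by rewrite (adjp_sym (adjP bT)) XY'.
rewrite e -XY'.
have aT : commutant (commutant (src Z)) (adj T) by exact: (vn_adj (bicomm_vn sZ)).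
have /(congr1 (@^~ v)) /= -> := aT.2 _ (intertw_commutant sZ iX iX').
by rewrite subrr.
Qed.

Lemma transported_flip T S : bicomm Z T -> bounded_op S ->
  transported T S -> forall X Y, intertw Z X Y -> forall w, T (Y w) = Y (S w).
Proof.
move=> AT bS tS X Y iX w; apply: ip_inj => v.
have bT := vn_bounded (bicomm_vn sZ) AT.
have XY := adjp_sym (it_adjp iX).
rewrite (adjP bT) !XY -(transported_adj AT bS tS iX).
by rewrite (adjP bS).
Qed.
End Transport.
End SpatialSetup.

(** * Spatial isomorphism of von Neumann algebras *)

Section KernelProjection.
Variables (R : realType) (K L : hilbert R) (Z : op K -> op L -> Prop).
Hypothesis sZ : star_rel Z.

Definition entries_intertw (X : l2 K -> l2 L) (Y : l2 L -> l2 K) :=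
  [/\ adjp X Y, bdd X & forall i j, intertw Z (entry X i j) (entry Y j i)].

(** The common kernel of the adjoints of the intertwiners is invariant under
    the commutant of the second algebra ([intertw_mul]), so its projection
    belongs to that algebra. *)
Lemma kernel_projection : exists P : op L, [/\ bicomm (flip Z) P, adj P = P, P \o P = P,
  forall w X Y, intertw Z X Y -> Y (P w) = 0 &
  forall w, (forall X Y, intertw Z X Y -> Y w = 0) -> P w = w].
Proof.
pose N (w : L) := forall X Y, intertw Z X Y -> Y w = 0.
have NL a w w' : N w -> N w' -> N (a *: w + w').
  move=> Nw Nw' X Y iX; have lY := adjp_linear (adjp_sym (it_adjp iX)).
  by rewrite lY (Nw _ _ iX) (Nw' _ _ iX) scaler0 addr0.
pose G (k l : L) := N k /\ l = k.
have [||P [Q [PQ bP PG P0 Q0]]] := @extension R L L G 1 ler01.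
- split; last by move=> a x c y d [Nx ->] [Ny ->]; split=> //; exact: NL.
  split=> // X Y iX; exact: lin0 (adjp_linear (adjp_sym (it_adjp iX))).
- by move=> x z [_ ->]; rewrite mul1r.
have orth X Y v : intertw Z X Y -> forall k l, G k l -> '[k, X v] = 0.
  by move=> iX k l [Nk _]; rewrite -(adjp_sym (it_adjp iX)) (Nk _ _ iX) ip0l.
have orthr X Y v : intertw Z X Y -> forall k l, G k l -> '[l, X v] = 0.
  by move=> iX k l [Nk ->]; exact: (orth _ _ v iX k k).
have NP w : N (P w).
  move=> X Y iX; apply: ip_eq0 => v.
  by rewrite (adjp_sym (it_adjp iX)) PQ (Q0 _ (orthr _ _ v iX)) ip0r.
have NQ w : N (Q w).
  move=> X Y iX; apply: ip_eq0 => v.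
  by rewrite (adjp_sym (it_adjp iX)) (adjp_sym PQ) (P0 _ (orth _ _ v iX)) ip0r.
have PN w : N w -> P w = w by move=> Nw; exact: PG.
have lP := adjp_linear PQ.
have PQE : P = Q.
  apply/funext => w; rewrite -(PN _ (NQ w)); apply/eqP.
  rewrite -subr_eq0 -linB//; apply/eqP/P0 => k l [Nk _].
  by rewrite ipBr -PQ PN// subrr.
exists P; split => //.
- split; first exact: adjp_bounded PQ bP.
  move=> C hC; apply/funext => w /=; have bC := commutant_bounded hC.
  have hC' : commutant (src (flip Z)) (adj C).
    have sA := star_algebra_src (star_rel_flip sZ).
    by apply: commutant_adj hC => S; [exact: sa_bounded|exact: sa_adj].
  apply: (extension_intertwine PQ PG P0 (adjP bC) (adjP bC)).
    move=> k l [Nk ->]; split=> // X Y iX.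
    by have /Nk := intertw_mul sZ iX hC'; rewrite adjK.
  move=> k l [Nk ->]; split=> // X Y iX.
  by have /Nk := intertw_mul sZ iX hC.
- by apply: adjE; rewrite {2}PQE.
- by apply/funext => w /=; rewrite PN.
Qed.

(** The projection of [kernel_projection] is orthogonal to the range of every
    intertwiner, so all functionals built from intertwiners vanish on it. *)
Lemma full_intertw_separating :
  (forall P : op L, bicomm (flip Z) P -> adj P = P -> P \o P = P ->
    (forall X Y x y, entries_intertw X Y -> '[amp P y, X x] = 0) -> P = 0) ->
  full_intertw Z.
Proof.
move=> sep w Nw; have [P [AP PP PPP PN NP]] := kernel_projection.
rewrite -(NP w Nw) (sep P)// => X Y x y [XY bX eX].
have bP := commutant_bounded AP; have YX := adjp_sym XY.
rewrite -YX.
rewrite -(amp_intertwine (adjp_sym XY) (@bounded_zero R K) bP) ?amp0 ?ip0l//.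
by move=> i j v; have := PN v _ _ (eX j i); rewrite /entry => ->.
Qed.
End KernelProjection.

Section Cross.
Variable R : realType.

(** Cauchy-Schwarz for the quadratic form [(u, v) |-> '[u, v]] on pairs of vectors,
    which is only assumed to be nonnegative on the span of two pairs; its
    hermitian symmetry there is a consequence of positivity. *)
Lemma form_cauchy_schwarz (K : hilbert R) (u v u' v' : K) :
  (forall t : R[i], 0 <= '[t *: u' + u, t *: v' + v]) -> 0 <= '[u', v'] ->
  nsq '[u', v] <= complex.Re '[u, v] * complex.Re '[u', v'].
Proof.
move=> h h'.
have e t : '[t *: u' + u, t *: v' + v] =
    '[u, v] + (t * '[u', v] + conjc t * '[u, v']) + (nsq t)%:C * '[u', v'].
  rewrite ipDl !ipDr !ipZl !ipZr; have -> : (nsq t)%:C = t * conjc t :> R[i].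
    by case: t => a b; rewrite /nsq /=; congr Complex; ring.
  by ring.
have h0 : 0 <= '[u, v].
  by have := h 0; rewrite e conjc0 !mul0r !addr0 /nsq /= expr0n addr0 mul0r addr0.
move: h0 h'; rewrite !lecE /= => /andP[/eqP i0 r0] /andP[/eqP i0' r0'].
have im (t : R[i]) : complex.Im (t * '[u', v] + conjc t * '[u, v']) = 0.
  have := h t; rewrite e lecE => /andP[/eqP + _].
  case: (t * _ + _) '[u, v] '[u', v'] i0 i0' => [a b] [a1 b1] [a2 b2] /= -> ->.
  by rewrite mulr0 mul0r !addr0 add0r.
have hc : '[u, v'] = conjc '[u', v].
  have := im 1; have := im 'i; case: '[u, v'] '[u', v] => [a b] [c d] /= h1 h2.
  by congr Complex; lra.
apply: discriminant_le => // t.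
have := h t; rewrite e lecE => /andP[_].
rewrite hc; case: t '[u', v] '[u, v] '[u', v'] i0 i0' => [t1 t2] [a1 a2] [b1 b2] [c1 c2] /= _ _ hh.
by rewrite /nsq /= in hh *; lra.
Qed.

Variables (K L : hilbert R) (Z : op K -> op L -> Prop).
Hypothesis sZ : star_rel Z.

(** Write [f T] as [<T x1, y1>] and [g S] as [<S x2, y2>]. The form
    [b T T' = f (adj T \o T')] is positive on matching pairs, and
    [b T T = <T x1, T y1>] is at most [sq (amp T x)] for [x] the interleaving of
    [x1] and [y1]; likewise it is at most [sq (amp S y)] on the other side. So
    [b] descends to a bounded form on the orbits of [x] and [y], which is
    represented by an operator [X]. This replaces the composition of one
    Gelfand-Naimark-Segal map with the adjoint of another. *)
Lemma cross_intertwiner (f : op K -> R[i]) (g : op L -> R[i]) :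
  nfun (bicomm Z) f -> nfun (bicomm (flip Z)) g ->
  (forall T S, Z T S -> f T = g S) ->
  (forall T S, Z T S -> 0 <= f (adj T \o T)) ->
  exists X Y x y, [/\ entries_intertw Z X Y,
    forall S, bicomm (flip Z) S -> g S = '[amp S y, X x] &
    forall T, bicomm Z T -> f T = '[amp T (Y y), x]].
Proof.
move=> [x1 [y1 fE]] [x2 [y2 gE]] fg fpos.
have b1 T S : Z T S -> bdd T by move=> /(sr_bounded1 sZ)/bounded_bdd.
have b2 T S : Z T S -> bdd S by move=> /(sr_bounded2 sZ)/bounded_bdd.
have A1 T S : Z T S -> bicomm Z T by exact: src_bicomm.
have A2 T S : Z T S -> bicomm (flip Z) S.
  by move=> h; apply: (@src_bicomm _ _ _ _ S T) => //; exact: star_rel_flip.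
have sr_adjM T S T' S' : Z T S -> Z T' S' -> Z (adj T \o T') (adj S \o S').
  by move=> h h'; apply: sr_comp => //; exact: sr_adj.
pose b (T T' : op K) := '[amp T' x1, amp T y1].
have bE T S T' S' : Z T S -> Z T' S' -> f (adj T \o T') = b T T'.
  move=> h h'; rewrite fE; last exact: A1 (sr_adjM _ _ _ _ h h').
  rewrite amp_comp; [|exact: b1 (sr_adj sZ h)|exact: b1 h'].
  by rewrite (adjp_sym (amp_adjp (adjP (sr_bounded1 sZ h)) (b1 _ _ h))).
have bE2 T S T' S' : Z T S -> Z T' S' -> b T T' = '[amp S' x2, amp S y2].
  move=> h h'; rewrite -(bE _ _ _ _ h h') (fg _ _ (sr_adjM _ _ _ _ h h')).
  rewrite gE; last exact: A2 (sr_adjM _ _ _ _ h h').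
  rewrite amp_comp; [|exact: b2 (sr_adj sZ h)|exact: b2 h'].
  by rewrite (adjp_sym (amp_adjp (adjP (sr_bounded2 sZ h)) (b2 _ _ h))).
have b0 T S : Z T S -> 0 <= b T T by move=> h; rewrite -(bE _ _ _ _ h h) (fpos _ _ h).
have bcs T S T' S' : Z T S -> Z T' S' ->
    nsq (b T T') <= complex.Re (b T T) * complex.Re (b T' T').
  move=> h h'; apply: form_cauchy_schwarz; last exact: b0 h'.
  move=> t; rewrite -!amp_lin; [|exact: b1 h'|exact: b1 h|exact: b1 h'|exact: b1 h].
  exact: b0 (sr_lin sZ t h' h).
pose x := interleave x1 y1; pose y := interleave x2 y2.
have bx T S : Z T S -> complex.Re (b T T) <= sq (amp T x).
  move=> h; rewrite amp_interleave ?sq_interleave; last exact: b1 h.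
  have := ip_real_le (amp T x1) (amp T y1); rewrite -/(b T T) => hh.
  have := normr_ge0 (complex.Re (b T T)); have := ler_norm (complex.Re (b T T)); lra.
have bY T S : Z T S -> complex.Re (b T T) <= sq (amp S y).
  move=> h; rewrite amp_interleave ?sq_interleave; last exact: b2 h.
  rewrite (bE2 _ _ _ _ h h).
  have := ip_real_le (amp S x2) (amp S y2).
  have := normr_ge0 (complex.Re '[amp S x2, amp S y2]).
  by have := ler_norm (complex.Re '[amp S x2, amp S y2]); lra.
pose ran (w : l2 L) := forall T' S', Z T' S' -> '[amp S' y, w] = 0.
pose Q T (v : l2 L) := (forall T' S', Z T' S' -> '[amp S' y, v] = b T T') /\
  (forall w, ran w -> '[v, w] = 0).
have Quniq T v v' : Q T v -> Q T v' -> v = v'.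
  move=> [h1 h2] [h1' h2'].
  have rv : ran (v - v').
    by move=> T' S' h; rewrite ipBr (h1 _ _ h) (h1' _ _ h) subrr.
  apply/eqP; rewrite -subr_eq0; apply/eqP/sq_eq0.
  by rewrite /sq ipBl h2// h2'// subrr.
(* For a fixed left argument, [b] is represented by a vector in the closure
   of the orbit of [y]. *)
have Qex T S : Z T S -> exists2 v, Q T v & sq v <= sq (amp T x).
  move=> h.
  have [|||v [v1 v2 v3]] := @riesz R (l2 L) (fun w c => exists T' S',
    [/\ Z T' S', w = amp S' y & c = b T T']) (sq (amp T x)).
  - exact: sq_ge0.
  - split.
      exists 0, 0; rewrite /b !amp0 ip0l; split=> //.
      have := sr_lin sZ (-1) (sr_id sZ) (sr_id sZ).
      by rewrite !scaleN1r !addNr.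
    move=> a _ _ _ _ [T1 [S1 [h1 -> ->]]] [T2 [S2 [h2 -> ->]]].
    exists (a *: T1 + T2), (a *: S1 + S2); split; first exact: sr_lin.
      by rewrite amp_lin//; [exact: b2 h1|exact: b2 h2].
    rewrite /b amp_lin; [|exact: b1 h1|exact: b1 h2].
    by rewrite ipDl ipZl.
  - move=> w c [T' [S' [h' -> ->]]]; apply: le_trans (bcs _ _ _ _ h h') _.
    have p0 : 0 <= complex.Re (b T T) by have := b0 _ _ h; rewrite lecE => /andP[].
    have p1 : 0 <= complex.Re (b T' T') by have := b0 _ _ h'; rewrite lecE => /andP[].
    by apply: ler_pM => //; [exact: bx h|exact: bY h'].
  exists v => //; split; first by move=> T' S' h'; apply: v1; exists T', S'.
  by move=> w rw; apply: v3 => _ _ [T' [S' [h' -> _]]]; exact: rw h'.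
pose G (k : l2 K) (v : l2 L) := exists T S, [/\ Z T S, k = amp T x & Q T v].
have [||X [Y [XY bX XG X0 _]]] := @extension R (l2 K) (l2 L) G 1 ler01.
- split.
    exists 0, 0; split; first 1 last.
    - by rewrite amp0.
    - split=> [T' S' _|w _]; last by rewrite ip0l.
      by rewrite /b amp0 !ip0r.
    have := sr_lin sZ (-1) (sr_id sZ) (sr_id sZ).
    by rewrite !scaleN1r !addNr.
  move=> a _ v _ v' [T [S [h -> [q1 q2]]]] [T' [S' [h' -> [q1' q2']]]].
  exists (a *: T + T'), (a *: S + S'); split; first exact: sr_lin.
    by rewrite amp_lin//; [exact: b1 h|exact: b1 h'].
  split=> [T2 S2 h2|w rw].
    rewrite ipDr ipZr (q1 _ _ h2) (q1' _ _ h2) /b amp_lin ?ipDr ?ipZr//.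
      exact: b1 h.
    exact: b1 h'.
  by rewrite ipDl ipZl q2// q2'// mulr0 addr0.
- move=> _ v [T [S [h -> qv]]]; have [v' qv' le] := Qex _ _ h.
  by rewrite (Quniq _ _ _ qv qv') mul1r.
have XE T S T' S' : Z T S -> Z T' S' -> '[amp S' y, X (amp T x)] = b T T'.
  move=> h h'; have [v qv _] := Qex _ _ h.
  by rewrite (XG _ v); [exact: qv.1 h'|exists T, S].
(* Left multiplication by a matching pair preserves the graph of [X]. *)
have XT T S : Z T S -> forall w, X (amp T w) = amp S (X w).
  move=> h; have bT := sr_bounded1 sZ h; have bS := sr_bounded2 sZ h.
  have Gst T0 S0 : Z T0 S0 -> forall k l, G k l -> G (amp T0 k) (amp S0 l).
    move=> h0 k l [T1 [S1 [h1 -> [q1 q2]]]].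
    exists (T0 \o T1), (S0 \o S1); split; first exact: sr_comp.
      by rewrite amp_comp//; [exact: b1 h0|exact: b1 h1].
    have SS0 := amp_adjp (adjP (sr_bounded2 sZ h0)) (b2 _ _ h0).
    have TT0 := amp_adjp (adjP (sr_bounded1 sZ h0)) (b1 _ _ h0).
    have ZZ T' S' (h' : Z T' S') := sr_adjM _ _ _ _ h0 h'.
    split=> [T' S' h'|w rw].
      rewrite -(adjp_sym SS0) -amp_comp; [|exact: b2 (sr_adj sZ h0)|exact: b2 h'].
      rewrite (q1 _ _ (ZZ _ _ h')) /b amp_comp; [|exact: b1 (sr_adj sZ h0)|exact: b1 h'].
      by rewrite (adjp_sym TT0) amp_comp//; [exact: b1 h0|exact: b1 h1].
    rewrite SS0; apply: q2 => T' S' h'.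
    rewrite -SS0 -amp_comp; [|exact: b2 h0|exact: b2 h'].
    by apply: rw; apply: sr_comp h0 h'.
  apply: (extension_intertwine XY XG _ (amp_adjp (adjP bT) (b1 _ _ h))
    (amp_adjp (adjP bS) (b2 _ _ h))).
  - exact: X0.
  - exact: Gst.
  - exact: Gst (sr_adj sZ h).
exists X, Y, x, y; split.
- split=> // i j; split; [exact: entry_adjp|exact: entry_bdd|].
  move=> T S h v; rewrite /entry -amp_unit; last 2 first.
  + exact: b1 h.
  + by rewrite lin0//; exact: bounded_linear (sr_bounded1 sZ h).
  by rewrite (XT _ _ h) ampE//; exact: b2 h.
- apply: nfun_density; [exact: star_algebra_src (star_rel_flip sZ)| | |].
  + by exists x2, y2.
  + by exists y, (X x).
  move=> S [T h]; rewrite -(fg _ _ h) -[x in X x]amp_id (XE _ _ _ _ (sr_id sZ) h).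
  by rewrite -(bE _ _ _ _ (sr_id sZ) h) adj_id.
- apply: nfun_density; [exact: star_algebra_src sZ| | |].
  + by exists x1, y1.
  + by exists (Y y), x.
  move=> T [S h]; have h' := sr_adj sZ h.
  have TT := amp_adjp (adjP (sr_bounded1 sZ h)) (b1 _ _ h).
  rewrite TT (adjp_sym XY) -[y in '[y, _]]amp_id (XE _ _ _ _ h' (sr_id sZ)).
  by rewrite -(bE _ _ _ _ h' (sr_id sZ)) adjK//; exact: sr_bounded1 h.
Qed.
End Cross.

Section SpatialIso.
Variables (R : realType) (K L : hilbert R) (Z : op K -> op L -> Prop).
Variables (J : Type) (f : J -> op K -> R[i]) (g : J -> op L -> R[i]).

(** Both algebras act on spaces filled by intertwiners, since a projection
    orthogonal to all of them would be annihilated by the functionals. Transport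
    along the intertwiners in both directions gives the isomorphism. *)
Theorem spatial_isomorphism : star_rel Z ->
  (forall j, nfun (bicomm Z) (f j)) -> (forall j, nfun (bicomm (flip Z)) (g j)) ->
  (forall j T S, Z T S -> f j T = g j S) ->
  (forall j T S, Z T S -> 0 <= f j (adj T \o T)) ->
  (forall P, bicomm Z P -> adj P = P -> P \o P = P -> (forall j, f j P = 0) -> P = 0) ->
  (forall P, bicomm (flip Z) P -> adj P = P -> P \o P = P ->
    (forall j, g j P = 0) -> P = 0) ->
  exists Phi : op K -> op L, [/\ star_hom (bicomm Z) (bicomm (flip Z)) Phi,
    set_bij (bicomm Z) (bicomm (flip Z)) Phi,
    forall T S, Z T S -> Phi T = S &
    forall j T, bicomm Z T -> g j (Phi T) = f j T].
Proof.
move=> sZ nf ng fg fpos sepf sepg.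
have sZ' := star_rel_flip sZ.
have cross j := cross_intertwiner sZ (nf j) (ng j) (@fg j) (@fpos j).
have entries_flip X Y : entries_intertw Z X Y -> entries_intertw (flip Z) Y X.
  move=> [XY bX eX]; split; [exact: adjp_sym|exact: bdd_adj XY bX|].
  by move=> i j; exact: intertw_flip.
have nd : full_intertw Z.
  apply: full_intertw_separating => // P AP PP PPP P0; apply: sepg => // j.
  by have [X [Y [x [y [eX -> // _]]]]] := cross j; exact: P0 eX.
have nd' : full_intertw (flip Z).
  apply: full_intertw_separating => // P AP PP PPP P0; apply: sepf => // j.
  have [X [Y [x [y [eX _ ->//]]]]] := cross j.
  have bP := commutant_bounded AP.
  rewrite (amp_adjp (adjP bP) (bounded_bdd bP)) PP ipC.
  by rewrite (P0 _ _ _ _ (entries_flip _ _ eX)) conjc0.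
have vA := bicomm_vn sZ; have vB := bicomm_vn sZ'.
have [Phi PhiP] : {Phi : op K -> op L & forall T, bicomm Z T ->
    bicomm (flip Z) (Phi T) /\ transported Z T (Phi T)}.
  apply: (@choice _ _ (fun T S => bicomm Z T -> bicomm (flip Z) S /\ transported Z T S)).
  move=> T; have [AT|nAT] := pselect (bicomm Z T); last by exists 0.
  by have [S] := transport sZ nd AT; exists S.
have Phi_uniq T S : bicomm Z T -> bounded_op S -> transported Z T S -> Phi T = S.
  move=> AT bS tS; have [BT tT] := PhiP _ AT.
  exact: (transported_uniq nd (vn_bounded vB BT) bS tT tS).
exists Phi; split.
- split.
  + by move=> T /PhiP[].
  + move=> a T T' AT AT'; have [BT tT] := PhiP _ AT; have [BT' tT'] := PhiP _ AT'.
    have BS : bicomm (flip Z) (a *: Phi T + Phi T').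
      by apply: vn_add => //; exact: vn_scale.
    apply: Phi_uniq; [by apply: vn_add => //; exact: vn_scale|exact: (vn_bounded vB)|].
    move=> X Y iX v; have lX := adjp_linear (it_adjp iX).
    by rewrite [RHS]lX -(tT _ _ iX) -(tT' _ _ iX).
  + move=> T T' AT AT'; have [BT tT] := PhiP _ AT; have [BT' tT'] := PhiP _ AT'.
    apply: Phi_uniq; [exact: vn_comp|by apply: (vn_bounded vB); exact: vn_comp|].
    by move=> X Y iX v /=; rewrite (tT' _ _ iX) (tT _ _ iX).
  + move=> T AT; have [BT tT] := PhiP _ AT.
    apply: Phi_uniq; [exact: vn_adj|by apply: (vn_bounded vB); exact: vn_adj|].
    exact: (transported_adj sZ nd AT (vn_bounded vB BT) tT).
- split.
  + by move=> T /PhiP[].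
  + move=> T T' /set_mem AT /set_mem AT' e.
    have [BT tT] := PhiP _ AT; have [BT' tT'] := PhiP _ AT'.
    apply/funext => v; apply/eqP; rewrite -subr_eq0; apply/eqP/nd' => Y X iY.
    have iX := intertw_flip sZ' iY.
    rewrite linB; last exact: adjp_linear (it_adjp iX).
    by rewrite -(tT _ _ iX) -(tT' _ _ iX) e subrr.
  + move=> S BS; have [T AT tT] := transport sZ' nd' BS.
    exists T => //; apply: Phi_uniq => //; first exact: (vn_bounded vB).
    move=> X Y iX v; have iY := intertw_flip sZ iX.
    exact: (transported_flip sZ' nd' BS (vn_bounded vA AT) tT iY).
- move=> T S h; apply: Phi_uniq; [exact: src_bicomm h|exact: sr_bounded2 h|].
  by move=> X Y iX v; rewrite (it_comm iX h).
- move=> j T AT; have [BT tT] := PhiP _ AT.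
  have [X [Y [x [y [[XY bX eX] -> // -> //]]]]] := cross j.
  have bT := vn_bounded vA AT; have bS := vn_bounded vB BT.
  rewrite (amp_intertwine (adjp_sym XY) bT bS) ?(adjp_sym XY)//.
  move=> i k v; exact: (transported_flip sZ nd AT bS tT (eX k i)).
Qed.
End SpatialIso.

(** * Operator matrices *)

Section Blocks.
Variables (R : realType) (H : hilbert R).
Implicit Types (a b c d : op H) (T : op (dsum H)) (A : set (op H)).

Lemma dsum_ip (x y : dsum H) : '[x, y] = '[x.1, y.1] + '[x.2, y.2].
Proof. by []. Qed.

Lemma dsum_sq (x : dsum H) : sq x = sq x.1 + sq x.2.
Proof. by rewrite /sq dsum_ip; case: '[_, _] '[_, _] => ? ? [? ?]. Qed.

Lemma block_adjp a b c d a' b' c' d' :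
  adjp a a' -> adjp b b' -> adjp c c' -> adjp d d' ->
  adjp (block a b c d) (block a' c' b' d').
Proof.
move=> aa bb cc dd x y; rewrite !dsum_ip /block /= !ipDl !ipDr aa bb cc dd.
by rewrite addrACA.
Qed.

Lemma bounded_block a b c d : bounded_op a -> bounded_op b -> bounded_op c ->
  bounded_op d -> bounded_op (block a b c d).
Proof.
move=> ba bb bc bd.
apply: adjp_bounded (block_adjp (adjP ba) (adjP bb) (adjP bc) (adjP bd)) _.
have [k1 k10 h1] := bounded_bdd ba; have [k2 k20 h2] := bounded_bdd bb.
have [k3 k30 h3] := bounded_bdd bc; have [k4 k40 h4] := bounded_bdd bd.
exists (2 * (k1 + k2 + k3 + k4)) => [|x]; first lra.
rewrite !dsum_sq /block /=.
have := sqDle (a x.1) (b x.2); have := sqDle (c x.1) (d x.2).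
have := h1 x.1; have := h2 x.2; have := h3 x.1; have := h4 x.2.
have := sq_ge0 x.1; have := sq_ge0 x.2.
move: (sq x.1) (sq x.2) => p q q0 p0.
have := mulr_ge0 k10 q0; have := mulr_ge0 k20 p0; have := mulr_ge0 k30 q0.
have := mulr_ge0 k40 p0; lra.
Qed.

Lemma adj_block a b c d : bounded_op a -> bounded_op b -> bounded_op c ->
  bounded_op d -> adj (block a b c d) = block (adj a) (adj c) (adj b) (adj d).
Proof. by move=> *; apply/adjE/block_adjp; exact: adjP. Qed.

Lemma block_comp a b c d a' b' c' d' :
  linear a -> linear b -> linear c -> linear d ->
  block a b c d \o block a' b' c' d' =
  block ((a \o a') + (b \o c')) ((a \o b') + (b \o d'))
    ((c \o a') + (d \o c')) ((c \o b') + (d \o d')).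
Proof.
move=> la lb lc ld; apply/funext => x; rewrite /block /=; congr pair.
  by rewrite /= (linD _ _ la) (linD _ _ lb) addrACA.
by rewrite /= (linD _ _ lc) (linD _ _ ld) addrACA.
Qed.

Lemma block_lin k a b c d a' b' c' d' :
  k *: block a b c d + block a' b' c' d' =
  block (k *: a + a') (k *: b + b') (k *: c + c') (k *: d + d').
Proof. by apply/funext => x; congr pair; rewrite /= scalerDr addrACA. Qed.

Lemma block0 : block 0 0 0 0 = 0 :> op (dsum H).
Proof. by apply/funext => -[x y]; rewrite /block /= addr0. Qed.

Lemma ul_block a b c d : b 0 = 0 -> ul (block a b c d) = a.
Proof. by move=> b0; apply/funext => x; rewrite /ul /= b0 addr0. Qed.
Lemma ur_block a b c d : a 0 = 0 -> ur (block a b c d) = b.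
Proof. by move=> b0; apply/funext => x; rewrite /ur /= b0 add0r. Qed.
Lemma dl_block a b c d : d 0 = 0 -> dl (block a b c d) = c.
Proof. by move=> b0; apply/funext => x; rewrite /dl /= b0 addr0. Qed.
Lemma dr_block a b c d : c 0 = 0 -> dr (block a b c d) = d.
Proof. by move=> b0; apply/funext => x; rewrite /dr /= b0 add0r. Qed.

Lemma block_inj a b c d a' b' c' d' :
  linear a -> linear b -> linear c -> linear d ->
  linear a' -> linear b' -> linear c' -> linear d' ->
  block a b c d = block a' b' c' d' -> [/\ a = a', b = b', c = c' & d = d'].
Proof.
move=> la lb lc ld la' lb' lc' ld' e; split.
- by rewrite -(@ul_block a b c d) ?lin0// e ul_block// lin0.
- by rewrite -(@ur_block a b c d) ?lin0// e ur_block// lin0.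
- by rewrite -(@dl_block a b c d) ?lin0// e dl_block// lin0.
- by rewrite -(@dr_block a b c d) ?lin0// e dr_block// lin0.
Qed.

Lemma lin_zero : linear (0 : op H).
Proof. by move=> k x y; rewrite scaler0 addr0. Qed.

Lemma blockE T : linear T -> T = block (ul T) (ur T) (dl T) (dr T).
Proof.
move=> lT; apply/funext => -[x y]; rewrite /block /ul /ur /dl /dr /=.
have -> : (x, y) = ((x, 0) + (0, y) : dsum H) by congr pair; rewrite /= ?addr0 ?add0r.
by rewrite linD.
Qed.

Lemma corners_bounded T : bounded_op T ->
  [/\ bounded_op (ul T), bounded_op (ur T), bounded_op (dl T) & bounded_op (dr T)].
Proof.
move=> bT; have lT := bounded_linear bT; have TT := adjP bT.
have [c c0 hc] := bounded_bdd bT.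
have sq1 (z : dsum H) : sq z.1 <= sq z by rewrite dsum_sq lerDl sq_ge0.
have sq2 (z : dsum H) : sq z.2 <= sq z by rewrite dsum_sq lerDr sq_ge0.
have sqx (x : H) : sq ((x, 0) : dsum H) = sq x by rewrite dsum_sq /= sq0 addr0.
have sqy (x : H) : sq ((0, x) : dsum H) = sq x by rewrite dsum_sq /= sq0 add0r.
have i1 (z : dsum H) x : '[z.1, x] = '[z, (x, 0)] by rewrite dsum_ip /= ip0r addr0.
have i2 (z : dsum H) x : '[z.2, x] = '[z, (0, x)] by rewrite dsum_ip /= ip0r add0r.
have i1' (z : dsum H) x : '[x, z.1] = '[(x, 0) : dsum H, z] by rewrite dsum_ip /= ip0l addr0.
have i2' (z : dsum H) x : '[x, z.2] = '[(0, x) : dsum H, z] by rewrite dsum_ip /= ip0l add0r.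
split.
- apply: (@adjp_bounded _ _ _ (ul (adj T))) => [x y|].
    by rewrite /ul i1 TT i1'.
  by exists c => // x; apply: le_trans (sq1 _) _; apply: le_trans (hc _) _; rewrite sqx.
- apply: (@adjp_bounded _ _ _ (dl (adj T))) => [x y|].
    by rewrite /ur /dl i1 TT i2'.
  by exists c => // x; apply: le_trans (sq1 _) _; apply: le_trans (hc _) _; rewrite sqy.
- apply: (@adjp_bounded _ _ _ (ur (adj T))) => [x y|].
    by rewrite /ur /dl i2 TT i1'.
  by exists c => // x; apply: le_trans (sq2 _) _; apply: le_trans (hc _) _; rewrite sqx.
- apply: (@adjp_bounded _ _ _ (dr (adj T))) => [x y|].
    by rewrite /dr i2 TT i2'.
  by exists c => // x; apply: le_trans (sq2 _) _; apply: le_trans (hc _) _; rewrite sqy.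
Qed.

Lemma scalar_block_commutes c a11 a12 a21 a22 :
  linear c -> linear a11 -> linear a12 -> linear a21 -> linear a22 ->
  block a11 a12 a21 a22 \o block c 0 0 c = block c 0 0 c \o block a11 a12 a21 a22 ->
  [/\ a11 \o c = c \o a11, a12 \o c = c \o a12, a21 \o c = c \o a21 & a22 \o c = c \o a22].
Proof.
move=> lc l11 l12 l21 l22 e.
have key x : a11 (c x.1) + a12 (c x.2) = c (a11 x.1 + a12 x.2) /\
    a21 (c x.1) + a22 (c x.2) = c (a21 x.1 + a22 x.2).
  have := congr1 (@^~ (x : dsum H)) e; rewrite /block /= !addr0 !add0r.
  by case.
split; apply/funext => x /=.
- by have [+ _] := key (x, 0); rewrite /= (lin0 lc) (lin0 l12) !addr0.
- by have [+ _] := key (0, x); rewrite /= (lin0 lc) (lin0 l11) !add0r.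
- by have [_] := key (x, 0); rewrite /= (lin0 lc) (lin0 l22) !addr0.
- by have [_] := key (0, x); rewrite /= (lin0 lc) (lin0 l21) !add0r.
Qed.

Lemma block_commutes_scalar c a11 a12 a21 a22 : linear c ->
  a11 \o c = c \o a11 -> a12 \o c = c \o a12 -> a21 \o c = c \o a21 ->
  a22 \o c = c \o a22 ->
  block a11 a12 a21 a22 \o block c 0 0 c = block c 0 0 c \o block a11 a12 a21 a22.
Proof.
move=> lc e11 e12 e21 e22; apply/funext => x; rewrite /block /= !addr0 !add0r.
rewrite !(linD _ _ lc); congr (_ + _, _ + _).
- exact: (congr1 (@^~ x.1) e11).
- exact: (congr1 (@^~ x.2) e12).
- exact: (congr1 (@^~ x.1) e21).
- exact: (congr1 (@^~ x.2) e22).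
Qed.

Lemma mat2_block A a b c d : A a -> A b -> A c -> A d -> mat2 A (block a b c d).
Proof. by exists a, b, c, d. Qed.

Lemma mat2_bounded A : A `<=` @bounded_op R H -> mat2 A `<=` @bounded_op R (dsum H).
Proof. by move=> bA _ [a [b [c [d [/bA ? /bA ? /bA ? /bA ? ->]]]]]; exact: bounded_block. Qed.

(** The scalar matrices over the commutant of [A] commute with [mat2 A], hence
    with its bicommutant, whose entries therefore lie in the bicommutant of
    [A]. *)
Lemma mat2_vn A : von_neumann A -> von_neumann (mat2 A).
Proof.
move=> vA; have bA : A `<=` @bounded_op R H by move=> ?; exact: vn_bounded.
split; first exact: mat2_bounded.
  move=> _ [a [b [c [d [Aa Ab Ac Ad ->]]]]].
  by rewrite adj_block; try exact: bA; apply: mat2_block; exact: vn_adj.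
rewrite eqEsubset; split; last exact/sub_bicommutant/mat2_bounded.
move=> T [bT hT]; have lT := bounded_linear bT.
have [b11 b12 b21 b22] := corners_bounded bT.
have [_ _ <-] := vA; rewrite (blockE lT).
have key c : commutant A c -> block c 0 0 c \o T = T \o block c 0 0 c.
  move=> [bc hc]; rewrite hT//; split.
    by apply: bounded_block => //; exact: bounded_zero.
  move=> _ [a11 [a12 [a21 [a22 [A11 A12 A21 A22 ->]]]]].
  by apply/esym/block_commutes_scalar; rewrite ?hc//; exact: bounded_linear.
have key2 c : commutant A c -> [/\ ul T \o c = c \o ul T, ur T \o c = c \o ur T,
    dl T \o c = c \o dl T & dr T \o c = c \o dr T].
  move=> hc; apply: scalar_block_commutes; try exact: bounded_linear.
    exact: commutant_linear hc.
  by rewrite -(blockE lT) key.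
by apply: mat2_block; split=> // c /key2[].
Qed.
End Blocks.

(** * Positive operators and conditional expectations *)

Section Positivity.
Variables (R : realType).
Implicit Types H : hilbert R.

Lemma quadratic_eq0 H (T : op H) : linear T -> (forall x, '[T x, x] = 0) -> T = 0.
Proof.
move=> lT T0; apply/funext => x; apply: ip_eq0 => y.
have key t : conjc t * '[T x, y] + t * '[T y, x] = 0.
  have := T0 (x + t *: y).
  rewrite (linD _ _ lT) (linZ _ _ lT) ipDl !ipDr !ipZl !ipZr !T0.
  by rewrite add0r !mulr0 addr0.
have := key 1; have := key 'i; case: '[T x, y] '[T y, x] => [a b] [c d] /=.
by move=> [h1 h2] [h3 h4]; congr Complex; lra.
Qed.

Lemma pos_op_adj H (T : op H) : bounded_op T -> pos_op T -> adj T = T.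
Proof.
move=> bT pT; have bA := adj_bounded bT; apply/esym/eqP; rewrite -subr_eq0; apply/eqP.
have bTA : bounded_op (T - adj T).
  by apply: bounded_add => //; rewrite -scaleN1r; exact: bounded_scale.
apply: quadratic_eq0 => [|x]; first exact: bounded_linear.
rewrite ipBl (adjp_sym (adjP bT)) (ipC x).
by have := pT x; rewrite lecE => /andP[/eqP]; case: '[T x, x] => a b /= -> _;
  congr Complex; ring.
Qed.

Lemma adj_comp_pos H (T : op H) : bounded_op T -> pos_op (adj T \o T).
Proof. by move=> bT x /=; rewrite (adjp_sym (adjP bT)) ip_ge0. Qed.

Lemma pos_op_add H (S T : op H) : pos_op S -> pos_op T -> pos_op (S + T).
Proof. by move=> pS pT x; rewrite ipDl addr_ge0. Qed.

Lemma pos_op_antisym H (T : op H) : linear T -> pos_op T -> pos_op (- T) -> T = 0.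
Proof.
move=> lT pT pN; apply: quadratic_eq0 => // x.
by apply/eqP; rewrite eq_le pT andbT; have := pN x; rewrite ipNl oppr_ge0.
Qed.

Lemma pos_op_add0 H (S T : op H) : linear S -> pos_op S -> pos_op T -> S + T = 0 -> S = 0.
Proof.
move=> lS pS pT e; apply: pos_op_antisym => //.
by have -> : - S = T by apply/eqP; rewrite eq_sym -addr_eq0 addrC e.
Qed.

Lemma gram_eq0 H (S T : op H) : bounded_op S -> bounded_op T ->
  (adj S \o S) + (adj T \o T) = 0 -> S = 0 /\ T = 0.
Proof.
move=> bS bT e.
have key (V W : op H) : bounded_op V -> bounded_op W ->
    (adj V \o V) + (adj W \o W) = 0 -> V = 0.
  move=> bV bW eVW.
  have h : adj V \o V = 0.
    apply: pos_op_add0 eVW; [|exact: adj_comp_pos..].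
    by apply: bounded_linear; apply: bounded_comp => //; exact: adj_bounded.
  apply/funext => x; apply: sq_eq0; rewrite /sq (adjP bV).
  by have /(congr1 (@^~ x)) /= -> := h; rewrite ip0r.
by split; [exact: key e|apply: key bT bS _; rewrite addrC].
Qed.

(** Cauchy-Schwarz for the form of [T] gives
    [sq (T x) ^ 2 <= '[T x, x] * '[T (T x), T x]]. *)
Lemma square_le_pos H (T : op H) : bounded_op T -> pos_op T ->
  exists c : R, pos_op (c%:C *: T - (T \o T)).
Proof.
move=> bT pT; have [k k0 hk] := bounded_bdd bT; exists (k + 1) => x.
have lT := bounded_linear bT.
have [p0 ip0] : 0 <= complex.Re '[T x, x] /\ complex.Im '[T x, x] = 0.
  by have := pT x; rewrite lecE => /andP[/eqP ? ?].
have cs : nsq '[T (T x), x] <= complex.Re '[T x, x] * complex.Re '[T (T x), T x].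
  apply: form_cauchy_schwarz; last exact: pT.
  by move=> t; rewrite -lT; exact: pT.
have e : '[T (T x), x] = (sq (T x))%:C.
  by rewrite -{1}(pos_op_adj bT pT) (adjp_sym (adjP bT)) ipxx.
rewrite e nsq_real in cs.
have s0 := sq_ge0 (T x).
have h1 : complex.Re '[T (T x), T x] <= (k + 1) * sq (T x).
  have := ip_real_le (T (T x)) (T x); have := hk (T x).
  have := ler_norm (complex.Re '[T (T x), T x]).
  have := mulr_ge0 k0 s0; lra.
have h2 : sq (T x) <= (k + 1) * complex.Re '[T x, x].
  have [->|n0] := eqVneq (sq (T x)) 0; first by rewrite mulr_ge0//; lra.
  have sp : 0 < sq (T x) by rewrite lt0r n0.
  rewrite -(ler_pM2r sp) -expr2; apply: le_trans cs _.
  by rewrite [leRHS]mulrAC [leRHS]mulrC ler_wpM2l.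
rewrite ipBl ipZl /= e.
case: '[T x, x] ip0 h2 p0 => a b /= -> h2 p0.
rewrite lecE /= mulr0 mul0r !addr0 subr0 eqxx /=; lra.
Qed.

(** Faithfulness is given on elements [adj S \o S] only. Rather than writing [T]
    as such an element with a square root, bound [T \o T] by a multiple of [T]:
    the expectation of [T \o T] is then nonpositive. *)
Lemma cond_exp_pos_faithful H (A B : set (op H)) (E : op H -> op H) (T : op H) :
  von_neumann A -> B `<=` @bounded_op R H -> faithful_normal_cond_exp A B E ->
  A T -> pos_op T -> E T = 0 -> T = 0.
Proof.
move=> vA bB [[EB _ Elin Epos _] Ef _] AT pT ET0.
have bT := vn_bounded vA AT; have aT := pos_op_adj bT pT.
have [c hc] := square_le_pos bT pT.
have ATT : A (T \o T) by exact: vn_comp.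
apply: Ef => //; rewrite aT.
apply: pos_op_antisym; first exact/bounded_linear/bB/EB.
  apply: Epos => //; by have := adj_comp_pos bT; rewrite aT.
have e : c%:C *: T - (T \o T) = (-1) *: (T \o T) + c%:C *: T.
  by rewrite scaleN1r addrC.
have e2 : c%:C *: T = c%:C *: T + 0 by rewrite addr0.
have A0 := vn_zero vA.
have E0 : E 0 = 0.
  by have := Elin (-1) 0 0 A0 A0; rewrite scaler0 addr0 scaleN1r addNr.
have AcT : A (c%:C *: T) by exact: vn_scale.
have Ae : A (c%:C *: T - (T \o T)) by exact: vn_sub.
have := Epos _ Ae hc; rewrite e Elin// e2 Elin// ET0 E0 scaler0 !addr0.
by rewrite scaleN1r.
Qed.

Lemma fce_cond_exp H (A B : set (op H)) (E : op H -> op H) :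
  faithful_normal_cond_exp A B E -> cond_exp A B E.
Proof. by case. Qed.

Lemma cond_exp0 H (A B : set (op H)) (E : op H -> op H) :
  von_neumann A -> cond_exp A B E -> E 0 = 0.
Proof.
move=> vA [_ _ Elin _ _]; have A0 := vn_zero vA.
by have := Elin (-1) 0 0 A0 A0; rewrite scaler0 addr0 scaleN1r addNr.
Qed.

Lemma linear_on_add H K (A : set (op H)) (f : op H -> op K) S T :
  linear_on A f -> A S -> A T -> f (S + T) = f S + f T.
Proof. by move=> fl AS AT; have := fl 1 S T AS AT; rewrite !scale1r. Qed.

Lemma linear_on_sub H K (A : set (op H)) (f : op H -> op K) S T :
  linear_on A f -> A S -> A T -> f (S - T) = f S - f T.
Proof.
by move=> fl AS AT; have := fl (-1) T S AT AS; rewrite !scaleN1r addrC [in RHS]addrC.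
Qed.

Lemma cond_exp_l H (A B : set (op H)) (E : op H -> op H) S T :
  B idfun -> cond_exp A B E -> B S -> A T -> E (S \o T) = S \o E T.
Proof. by move=> B1 [_ _ _ _ bi] BS AT; exact: bi BS AT B1. Qed.

Lemma cond_exp_r H (A B : set (op H)) (E : op H -> op H) S T :
  B idfun -> cond_exp A B E -> B S -> A T -> E (T \o S) = E T \o S.
Proof. by move=> B1 [_ _ _ _ bi] BS AT; exact: bi B1 AT BS. Qed.
End Positivity.

(** * Corners of functionals on operator matrices *)

Section Compress.
Variables (R : realType).

(** Both the passage to a corner and the inclusion of a corner have the form
    [S |-> p \o S \o i] with [i] and [p] mutually adjoint. *)
Lemma nfun_compress (H1 H2 : hilbert R) (i : H1 -> H2) (p : H2 -> H1)
    (A : set (op H2)) (B : set (op H1)) (f : op H1 -> R[i]) :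
  adjp i p -> bdd i -> A `<=` @bounded_op R H2 -> nfun B f ->
  (forall S, A S -> B (p \o S \o i)) -> nfun A (fun S => f (p \o S \o i)).
Proof.
move=> ip bi bA [x [y fE]] AB; exists (amp i x), (amp i y) => S AS.
have bp := bdd_adj ip bi; have bS := bounded_bdd (bA _ AS).
rewrite fE; last exact: AB.
have e : amp (p \o S \o i) x = amp p (amp S (amp i x)).
  exact: (etrans (amp_comp x (bdd_comp bS bp) bi) (amp_comp (amp i x) bp bS)).
by rewrite e (adjp_sym (amp_adjp ip bi)).
Qed.

Variable H : hilbert R.
Definition inl2 (x : H) : dsum H := (x, 0).
Definition inr2 (x : H) : dsum H := (0, x).
Definition fst2 (x : dsum H) : H := x.1.
Definition snd2 (x : dsum H) : H := x.2.

Lemma inl2_adjp : adjp inl2 fst2.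
Proof. by move=> x y; rewrite dsum_ip /= ip0l addr0. Qed.
Lemma inr2_adjp : adjp inr2 snd2.
Proof. by move=> x y; rewrite dsum_ip /= ip0l add0r. Qed.
Lemma inl2_bdd : bdd inl2.
Proof. by exists 1 => // x; rewrite dsum_sq /= sq0 addr0 mul1r. Qed.
Lemma inr2_bdd : bdd inr2.
Proof. by exists 1 => // x; rewrite dsum_sq /= sq0 add0r mul1r. Qed.
Lemma block_inl (a : op H) : block a 0 0 0 = inl2 \o a \o fst2.
Proof. by apply/funext => x; rewrite /block /inl2 /= addr0; congr pair; rewrite /= addr0. Qed.
Lemma block_inr (a : op H) : block 0 0 0 a = inr2 \o a \o snd2.
Proof. by apply/funext => x; rewrite /block /inr2 /= !add0r. Qed.
End Compress.

(** * Reduced words in the HNN extension *)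

Section HNN.
Variables (R : realType) (H : hilbert R) (D N : set (op H)) (theta ED Eth : op H -> op H).
Hypotheses (vnD : von_neumann D) (vnN : von_neumann N) (DN : D `<=` N).
Hypothesis theta_emb : normal_embedding D N theta.
Hypotheses (ED_ce : faithful_normal_cond_exp N D ED)
  (Eth_ce : faithful_normal_cond_exp N [set theta d | d in D] Eth).
Variables (M : set (op H)) (EM : op H -> op H) (u : op H).
Hypothesis hnn : is_hnn D N theta ED Eth M EM u.

Lemma vnM : von_neumann M. Proof. by case: hnn => -[]. Qed.
Lemma NM : N `<=` M. Proof. by case: hnn => -[]. Qed.
Lemma M_u : M u. Proof. by case: hnn => _ _ []. Qed.
Lemma EM_ce : faithful_normal_cond_exp M N EM. Proof. by case: hnn. Qed.
Lemma uuK : u \o adj u = idfun. Proof. by case: hnn => _ _ []. Qed.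
Lemma uKu : adj u \o u = idfun. Proof. by case: hnn => _ _ []. Qed.
Lemma u_bounded : bounded_op u. Proof. exact: (vn_bounded vnM M_u). Qed.
Lemma M_adj_u : M (adj u). Proof. exact: (vn_adj vnM M_u). Qed.
Lemma adj_u_bounded : bounded_op (adj u). Proof. exact: (vn_bounded vnM M_adj_u). Qed.

Lemma theta_N d : D d -> N (theta d).
Proof. by case: theta_emb => -[h _ _ _] _ _ _; exact: h. Qed.

Lemma thetaE d : D d -> theta d = adj u \o d \o u.
Proof.
move=> Dd; have [_ _ _ _ [/(_ _ Dd) e _]] := hnn.
rewrite -[X in adj u \o X \o u]e.
by apply/funext => x; have /= K y := congr1 (@^~ y) uKu; rewrite /= !K.
Qed.

Lemma u_theta d : D d -> d \o u = u \o theta d.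
Proof.
move=> Dd; rewrite thetaE//.
by apply/funext => x; have /= -> := congr1 (@^~ (d (u x))) uuK.
Qed.

Lemma theta_D_id : [set theta d | d in D] idfun.
Proof. by case: theta_emb => _ h _ _; exists idfun => //; exact: vn_id. Qed.

Lemma ED_l d n : D d -> N n -> ED (d \o n) = d \o ED n.
Proof. by move=> Dd Nn; apply: (cond_exp_l (vn_id vnD) (fce_cond_exp ED_ce)). Qed.
Lemma ED0 : ED 0 = 0. Proof. exact: (cond_exp0 vnN (fce_cond_exp ED_ce)). Qed.
Lemma Eth0 : Eth 0 = 0. Proof. exact: (cond_exp0 vnN (fce_cond_exp Eth_ce)). Qed.
Lemma EM0 : EM 0 = 0. Proof. exact: (cond_exp0 vnM (fce_cond_exp EM_ce)). Qed.

Lemma Eth_l d n : D d -> N n -> Eth (theta d \o n) = theta d \o Eth n.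
Proof. by move=> Dd Nn; apply: (cond_exp_l theta_D_id (fce_cond_exp Eth_ce)) => //; exists d. Qed.

Lemma EM_l n x : N n -> M x -> EM (n \o x) = n \o EM x.
Proof. exact: (cond_exp_l (vn_id vnN) (fce_cond_exp EM_ce)). Qed.

Lemma EM_r n x : N n -> M x -> EM (x \o n) = EM x \o n.
Proof. exact: (cond_exp_r (vn_id vnN) (fce_cond_exp EM_ce)). Qed.

Lemma EM_D x y : M x -> M y -> EM (x + y) = EM x + EM y.
Proof. by apply: linear_on_add; case: EM_ce => -[]. Qed.

Lemma EM_N n : N n -> EM n = n.
Proof. by case: EM_ce => -[_ h _ _ _] _ _; exact: h. Qed.

Lemma EM_in x : M x -> N (EM x).
Proof. by case: EM_ce => -[h _ _ _ _] _ _; exact: h. Qed.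

(** The last factor in [N] absorbs the coefficients at the end of a word; the
    first letter is kept as an index because it decides which left
    multiplications keep a word reduced ([reduced_span_cons]). *)
Inductive reduced_span (e : bool) : op H -> Prop :=
| reduced_span0 : reduced_span e 0
| reduced_spanD x y : reduced_span e x -> reduced_span e y -> reduced_span e (x + y)
| reduced_span_word w n : hnn_reduced N ED Eth e w -> N n ->
    reduced_span e (hnn_word u e w \o n).

Lemma upow_M e : M (upow u e).
Proof. by case: e; [exact: M_u|exact: M_adj_u]. Qed.

Lemma hnn_word_M e w : hnn_reduced N ED Eth e w -> M (hnn_word u e w).
Proof.
elim: w e => [|[n e'] w IH] e /=; first by move=> _; exact: upow_M.
move=> [Nn _ _ /IH h]; apply: (vn_comp vnM) => //.
by apply: (vn_comp vnM); [exact: upow_M|exact: NM].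
Qed.

Lemma reduced_span_EM e x : reduced_span e x -> M x /\ EM x = 0.
Proof.
elim=> [|{}x y _ [Mx x0] _ [My y0]|w n hw Nn].
- by split; [exact: (vn_zero vnM)|exact: EM0].
- by split; [exact: (vn_add vnM)|rewrite EM_D// x0 y0 addr0].
- have Mw := hnn_word_M hw; split; first by apply: (vn_comp vnM) => //; exact: NM.
  have [_ _ _ _ [_ h]] := hnn.
  by rewrite EM_r// h.
Qed.

Lemma reduced_span_end e n : N n -> reduced_span e (upow u e \o n).
Proof. by move=> Nn; exact: (@reduced_span_word e [::] n). Qed.

Lemma reduced_span_cons e e' n x : N n -> (e = true -> e' = false -> Eth n = 0) ->
  (e = false -> e' = true -> ED n = 0) -> reduced_span e' x ->
  reduced_span e (upow u e \o n \o x).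
Proof.
move=> Nn h1 h2; have lu : linear (upow u e \o n).
  by apply: (vn_linear vnM); apply: (vn_comp vnM); [exact: upow_M|exact: NM].
elim=> [|{}x y _ hx _ hy|w m hw Nm].
- have -> : upow u e \o n \o (0 : op H) = 0 by apply/funext => v; exact: (lin0 lu).
  exact: reduced_span0.
- have -> : upow u e \o n \o (x + y) = (upow u e \o n \o x) + (upow u e \o n \o y).
    by apply/funext => v; exact: (linD _ _ lu).
  exact: reduced_spanD.
- have red : hnn_reduced N ED Eth e ((n, e') :: w) by split.
  exact: (reduced_span_word red Nm).
Qed.

(** The shape of an alternating word that starts with a letter of the second
    algebra: words in the first row start with [u], in the second with
    [adj u]. *)
Definition reduced_block (s : op (dsum H)) := exists x11 x12 x21 x22,
  [/\ s = block x11 x12 x21 x22, reduced_span true x11, reduced_span true x12,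
    reduced_span false x21 & reduced_span false x22].

Definition ker_block (s : op (dsum H)) := exists n11 n12 n21 n22,
  [/\ s = block n11 n12 n21 n22, N n11 /\ N n12, N n21 /\ N n22, ED n11 = 0 & Eth n22 = 0].

(** A centered letter of the second algebra after the twist. *)
Definition stable_block (s : op (dsum H)) := exists b c,
  [/\ D b, D c & s = block 0 (b \o u) (adj u \o c) 0].

Lemma Nlin n : N n -> linear n. Proof. exact: vn_linear. Qed.

Lemma ED_ker d n : D d -> N n -> ED n = 0 -> ED (d \o n) = 0.
Proof.
move=> Dd Nn n0; rewrite ED_l// n0.
by apply/funext => v; exact: (lin0 (vn_linear vnD Dd)).
Qed.

Lemma Eth_ker d n : D d -> N n -> Eth n = 0 -> Eth (theta d \o n) = 0.
Proof.
move=> Dd Nn n0; rewrite Eth_l// n0.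
by apply/funext => v; exact: (lin0 (Nlin (theta_N Dd))).
Qed.

Lemma stable_block_comp b c x11 x12 x21 x22 : D b -> D c ->
  block 0 (b \o u) (adj u \o c) 0 \o block x11 x12 x21 x22 =
  block (u \o theta b \o x21) (u \o theta b \o x22)
    (adj u \o c \o x11) (adj u \o c \o x12).
Proof.
move=> Db Dc; rewrite u_theta//; apply/funext => x; rewrite /block /= !add0r !addr0.
congr pair.
  have l := vn_linear vnM (vn_comp vnM M_u (NM (theta_N Db))).
  exact: (linD _ _ l).
have l := vn_linear vnM (vn_comp vnM M_adj_u (NM (DN Dc))).
exact: (linD _ _ l).
Qed.

Lemma stable_ker_block s t : stable_block s -> ker_block t -> reduced_block (s \o t).
Proof.
move=> [b [c [Db Dc ->]]] [n11 [n12 [n21 [n22 [-> [N11 N12] [N21 N22] _ _]]]]].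
rewrite stable_block_comp//; do 4 eexists; split; first reflexivity.
- by apply: (@reduced_span_end true (theta b \o n21)); apply: (vn_comp vnN) => //; exact: theta_N.
- by apply: (@reduced_span_end true (theta b \o n22)); apply: (vn_comp vnN) => //; exact: theta_N.
- by apply: (@reduced_span_end false (c \o n11)); apply: (vn_comp vnN) => //; exact: DN.
- by apply: (@reduced_span_end false (c \o n12)); apply: (vn_comp vnN) => //; exact: DN.
Qed.

Lemma stable_reduced_block s : stable_block s -> reduced_block s.
Proof.
move=> [b [c [Db Dc ->]]]; do 4 eexists; split; first reflexivity.
- exact: reduced_span0.
- by rewrite u_theta//; apply: (@reduced_span_end true); exact: theta_N.
- by apply: (@reduced_span_end false); exact: DN.
- exact: reduced_span0.
Qed.

(** The diagonal entries of the middle matrix are those that stand between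
    opposite powers of [u], and they are centered; the off-diagonal entries stand
    between equal powers. Coefficients from [D] are moved to the right by
    [u_theta], and multiplication by them preserves centered elements. *)
Lemma stable_ker_reduced_block s t r : stable_block s -> ker_block t ->
  reduced_block r -> reduced_block (s \o (t \o r)).
Proof.
move=> [b [c [Db Dc ->]]] [n11 [n12 [n21 [n22 [-> [N11 N12] [N21 N22] k11 k22]]]]].
move=> [x11 [x12 [x21 [x22 [-> r11 r12 r21 r22]]]]].
rewrite block_comp; [|exact: Nlin..]; rewrite stable_block_comp//.
have Nb n : N n -> N (theta b \o n) by move=> Nn; apply: (vn_comp vnN) => //; exact: theta_N.
have Nc n : N n -> N (c \o n) by move=> Nn; apply: (vn_comp vnN) => //; exact: DN.
have lb : linear (u \o theta b).
  exact: (vn_linear vnM (vn_comp vnM M_u (NM (theta_N Db)))).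
have lc : linear (adj u \o c).
  exact: (vn_linear vnM (vn_comp vnM M_adj_u (NM (DN Dc)))).
have dist (f g h k l : op H) : linear f ->
    f \o ((g \o h) + (k \o l)) = (f \o g \o h) + (f \o k \o l).
  by move=> lf; apply/funext => v; exact: (linD _ _ lf).
rewrite !dist//; do 4 eexists; split; first reflexivity; apply: reduced_spanD.
- by apply: (@reduced_span_cons true true (theta b \o n21)) => //; exact: Nb.
- by apply: (@reduced_span_cons true false (theta b \o n22)) => // [|_ _];
    [exact: Nb|exact: Eth_ker].
- by apply: (@reduced_span_cons true true (theta b \o n21)) => //; exact: Nb.
- by apply: (@reduced_span_cons true false (theta b \o n22)) => // [|_ _];
    [exact: Nb|exact: Eth_ker].
- by apply: (@reduced_span_cons false true (c \o n11)) => // [|_ _];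
    [exact: Nc|exact: ED_ker].
- by apply: (@reduced_span_cons false false (c \o n12)) => //; exact: Nc.
- by apply: (@reduced_span_cons false true (c \o n11)) => // [|_ _];
    [exact: Nc|exact: ED_ker].
- by apply: (@reduced_span_cons false false (c \o n12)) => //; exact: Nc.
Qed.

Definition diag_expect (s : op (dsum H)) : op (dsum H) := diag_map ED Eth (amplify EM s).

Lemma amplifyE a b c d : M a -> M b -> M c -> M d ->
  amplify EM (block a b c d) = block (EM a) (EM b) (EM c) (EM d).
Proof.
move=> Ma Mb Mc Md; rewrite /amplify ul_block ?ur_block ?dl_block ?dr_block//;
  by apply: lin0; exact: (vn_linear vnM).
Qed.

Lemma diag_mapE f g a b c d : N a -> N b -> N c -> N d ->
  diag_map f g (block a b c d) = block (f a) 0 0 (g d).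
Proof.
move=> Na Nb Nc Nd; rewrite /diag_map ul_block ?dr_block//;
  by apply: lin0; exact: Nlin.
Qed.

Lemma diag_expectE a b c d : M a -> M b -> M c -> M d ->
  diag_expect (block a b c d) = block (ED (EM a)) 0 0 (Eth (EM d)).
Proof. by move=> Ma Mb Mc Md; rewrite /diag_expect amplifyE// diag_mapE//; exact: EM_in. Qed.

Lemma diag_expect_reduced_block s : reduced_block s -> diag_expect s = 0.
Proof.
move=> [x11 [x12 [x21 [x22 [-> r11 r12 r21 r22]]]]].
have [M11 e11] := reduced_span_EM r11; have [M12 _] := reduced_span_EM r12.
have [M21 _] := reduced_span_EM r21; have [M22 e22] := reduced_span_EM r22.
by rewrite diag_expectE// e11 e22 ED0 Eth0 block0.
Qed.

Lemma diag_expect_ker_block s : ker_block s -> diag_expect s = 0.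
Proof.
move=> [n11 [n12 [n21 [n22 [-> [N11 N12] [N21 N22] k11 k22]]]]].
by rewrite diag_expectE ?EM_N ?k11 ?k22 ?block0//; exact: NM.
Qed.

Lemma diag_expect_ker_reduced_block s r : ker_block s -> reduced_block r ->
  diag_expect (s \o r) = 0.
Proof.
move=> [n11 [n12 [n21 [n22 [-> [N11 N12] [N21 N22] k11 k22]]]]].
move=> [x11 [x12 [x21 [x22 [-> r11 r12 r21 r22]]]]].
have [M11 e11] := reduced_span_EM r11; have [M12 e12] := reduced_span_EM r12.
have [M21 e21] := reduced_span_EM r21; have [M22 e22] := reduced_span_EM r22.
rewrite block_comp; [|exact: Nlin..].
have Mc n x : N n -> M x -> M (n \o x) by move=> /NM Mn Mx; exact: (vn_comp vnM).
have z n m x y : N n -> N m -> M x -> M y -> EM x = 0 -> EM y = 0 ->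
    EM ((n \o x) + (m \o y)) = 0.
  move=> Nn Nm Mx My x0 y0; rewrite EM_D; [|exact: Mc..].
  rewrite (EM_l Nn Mx) (EM_l Nm My) x0 y0.
  apply/funext => v.
  exact: (etrans (congr2 +%R (lin0 (Nlin Nn)) (lin0 (Nlin Nm))) (addr0 _)).
rewrite diag_expectE; try (by apply: (vn_add vnM); exact: Mc).
by rewrite !z// ED0 Eth0 block0.
Qed.

Lemma diag_expect_lin a s t : mat2 M s -> mat2 M t ->
  diag_expect (a *: s + t) = a *: diag_expect s + diag_expect t.
Proof.
move=> [a1 [b1 [c1 [d1 [A1 B1 C1 D1 ->]]]]] [a2 [b2 [c2 [d2 [A2 B2 C2 D2 ->]]]]].
have Ml x y : M x -> M y -> M (a *: x + y).
  by move=> Mx My; apply: (vn_add vnM) => //; exact: (vn_scale vnM).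
have [[_ _ EDl _ _] _ _] := ED_ce; have [[_ _ Ethl _ _] _ _] := Eth_ce.
have [[_ _ EMl _ _] _ _] := EM_ce.
rewrite block_lin !diag_expectE//; try exact: Ml.
by rewrite !EMl// EDl ?Ethl ?block_lin ?scaler0 ?addr0//; exact: EM_in.
Qed.

Lemma diag_expect_N s : mat2 N s -> diag_expect s = diag_map ED Eth s.
Proof.
move=> [a [b [c [d [A B C Dd ->]]]]].
by rewrite diag_expectE ?diag_mapE ?EM_N//; exact: NM.
Qed.

Lemma diag_expect_in s : mat2 M s -> mat2 N (diag_expect s).
Proof.
move=> [a [b [c [d [A B C Dd ->]]]]]; rewrite diag_expectE//.
have [[EDin _ _ _ _] _ _] := ED_ce; have [[Ethin _ _ _ _] _ _] := Eth_ce.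
apply: mat2_block; try exact: (vn_zero vnN).
  exact/DN/EDin/EM_in.
by have [d' Dd' <-] := Ethin _ (EM_in Dd); exact: theta_N.
Qed.
(** * Matching pairs of operators *)

Variables (K : hilbert R) (P : set (op K)) (E : op K -> op K)
  (ltheta l1 : op (dsum H) -> op K).
Hypothesis afp : is_amalgamated_free_product (diag2 D)
           (mat2 N) (diag_map ED Eth) (diag_map idfun theta)
           (mat2 D) (diag_map idfun idfun) (diag_map idfun idfun)
           P E ltheta l1.


Lemma vnP : von_neumann P. Proof. by case: afp. Qed.

Lemma ltheta_hom : star_hom (mat2 N) P ltheta.
Proof. by case: afp => _ [[]]. Qed.
Lemma l1_hom : star_hom (mat2 D) P l1.
Proof. by case: afp => _ [_ []]. Qed.
Lemma ltheta_in n : mat2 N n -> P (ltheta n).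
Proof. by case: ltheta_hom => h _ _ _; exact: h. Qed.
Lemma l1_in d : mat2 D d -> P (l1 d).
Proof. by case: l1_hom => h _ _ _; exact: h. Qed.
Lemma ltheta_lin : linear_on (mat2 N) ltheta. Proof. by case: ltheta_hom. Qed.
Lemma l1_lin : linear_on (mat2 D) l1. Proof. by case: l1_hom. Qed.
Lemma ltheta_comp m n : mat2 N m -> mat2 N n -> ltheta (m \o n) = ltheta m \o ltheta n.
Proof. by case: ltheta_hom => _ _ h _; exact: h. Qed.
Lemma l1_comp m n : mat2 D m -> mat2 D n -> l1 (m \o n) = l1 m \o l1 n.
Proof. by case: l1_hom => _ _ h _; exact: h. Qed.
Lemma ltheta_inj m n : mat2 N m -> mat2 N n -> ltheta m = ltheta n -> m = n.
Proof.
by case: afp => _ [[_ _ h _] _ _] _ _ _ Nm Nn; apply: h; exact: mem_set.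
Qed.
Lemma mat2N_vn : von_neumann (mat2 N). Proof. exact: mat2_vn. Qed.
Lemma mat2D_vn : von_neumann (mat2 D). Proof. exact: mat2_vn. Qed.
Lemma mat2M_vn : von_neumann (mat2 M). Proof. exact: (mat2_vn vnM). Qed.
Lemma ltheta0 : ltheta 0 = 0.
Proof.
have n0 := vn_zero mat2N_vn.
by have := ltheta_lin (-1) n0 n0; rewrite scaler0 addr0 scaleN1r addNr.
Qed.
Lemma E_ltheta n : mat2 N n -> E (ltheta n) = ltheta (diag_map ED Eth n).
Proof. by case: afp => _ _ _ [_ h _] _; exact: h. Qed.

Let E_range := [set ltheta (diag_map idfun theta q) | q in diag2 D].
Lemma E_ce : faithful_normal_cond_exp P E_range E.
Proof. by case: afp => _ _ _ []. Qed.

Lemma mat2_sub (A B : set (op H)) : A `<=` B -> mat2 A `<=` mat2 B.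
Proof.
by move=> AB _ [a [b [c [d [/AB ? /AB ? /AB ? /AB ? ->]]]]]; exact: mat2_block.
Qed.

(** The unitary that conjugates the copy of [mat2 D] with diagonal inclusion into
    [mat2 M], so that its diagonal becomes [d1, theta d2] and its matrix unit of
    index 12 becomes [u]. *)
Definition twist_op : op (dsum H) := block idfun 0 0 (adj u).
Definition twist_op' : op (dsum H) := block idfun 0 0 u.
Definition twist (s : op (dsum H)) : op (dsum H) := twist_op \o s \o twist_op'.

Lemma twist_op_linear : linear twist_op.
Proof.
apply/bounded_linear/bounded_block; [exact: bounded_id|exact: bounded_zero..|].
exact: adj_u_bounded.
Qed.

Lemma twist_opK : twist_op' \o twist_op = idfun.
Proof.
apply/funext => -[x y]; rewrite /twist_op' /twist_op /block /= !addr0 !add0r.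
by have /= -> := congr1 (@^~ y) uuK.
Qed.

Lemma twist_comp s t : twist (s \o t) = twist s \o twist t.
Proof.
apply/funext => x; rewrite /twist /=.
by have /= -> := congr1 (@^~ (t (twist_op' x))) twist_opK.
Qed.

Lemma twist_block a b c d : twist (block a b c d) =
  block a (b \o u) (adj u \o c) (adj u \o d \o u).
Proof.
have lu := vn_linear vnM M_adj_u.
apply/funext => x; rewrite /twist /twist_op /twist_op' /block /= !addr0 !add0r.
by rewrite (linD _ _ lu).
Qed.

Lemma twist_diag a d : D d -> twist (block a 0 0 d) = block a 0 0 (theta d).
Proof.
move=> Dd; rewrite twist_block (thetaE Dd); congr block.
by apply/funext => x; rewrite /= (lin0 (vn_linear vnM M_adj_u)).
Qed.

Lemma twist_M d : mat2 D d -> mat2 M (twist d).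
Proof.
move=> [a [b [c [e [/DN/NM Ma /DN/NM Mb /DN/NM Mc /DN/NM Me ->]]]]].
rewrite twist_block; apply: mat2_block => //.
- exact: (vn_comp vnM Mb M_u).
- exact: (vn_comp vnM M_adj_u Mc).
- exact: (vn_comp vnM (vn_comp vnM M_adj_u Me) M_u).
Qed.

Lemma twist_adj d : mat2 D d -> twist (adj d) = adj (twist d).
Proof.
move=> Dd; have bd := vn_bounded mat2D_vn Dd.
have [bu bau] := (u_bounded, adj_u_bounded).
have b0 := @bounded_zero R H; have b1 := @bounded_id R H.
have bW : bounded_op twist_op by exact: bounded_block.
have bW' : bounded_op twist_op' by exact: bounded_block.
have aW : adj twist_op = twist_op'.
  by rewrite /twist_op (adj_block b1 b0 b0 bau) adj_id adj0 (adjK bu).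
have aW' : adj twist_op' = twist_op by rewrite -aW adjK.
by rewrite /twist (adj_comp (bounded_comp bW bd) bW') (adj_comp bW bd) aW aW'.
Qed.

Inductive matching : op K -> op (dsum H) -> Prop :=
| matching_theta n : mat2 N n -> matching (ltheta n) n
| matching_one d : mat2 D d -> matching (l1 d) (twist d)
| matching_add T S T' S' : matching T S -> matching T' S' -> matching (T + T') (S + S')
| matching_comp T S T' S' : matching T S -> matching T' S' -> matching (T \o T') (S \o S').

Lemma matching_in T S : matching T S -> P T /\ mat2 M S.
Proof.
elim=> [n Nn|d Dd|{}T {}S T' S' _ [PT MS] _ [PT' MS']|{}T {}S T' S' _ [PT MS] _ [PT' MS']].
- by split; [exact: ltheta_in|exact: (mat2_sub NM)].
- by split; [exact: l1_in|exact: twist_M].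
- by split; [exact: (vn_add vnP)|exact: (vn_add mat2M_vn)].
- by split; [exact: (vn_comp vnP)|exact: (vn_comp mat2M_vn)].
Qed.

Lemma ltheta_id : ltheta idfun = idfun.
Proof. by case: afp => _ [[_ h _ _]]. Qed.

Lemma matching_star : star_rel matching.
Proof.
have Zid : matching idfun idfun.
  by rewrite -{1}ltheta_id; apply: matching_theta; exact: (vn_id mat2N_vn).
have Zscale a T S : matching T S -> matching (a *: T) (a *: S).
  move=> h; have Na : mat2 N (a *: idfun) by apply: (vn_scale mat2N_vn); exact: vn_id mat2N_vn.
  have e : ltheta (a *: idfun) = a *: idfun.
    have := ltheta_lin a (vn_id mat2N_vn) (vn_zero mat2N_vn).
    by rewrite !addr0 ltheta0 addr0 ltheta_id.
  by have := matching_comp (matching_theta Na) h; rewrite e.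
split => //.
- by move=> T S /matching_in[PT _]; exact: (vn_bounded vnP).
- by move=> T S /matching_in[_ MS]; exact: (vn_bounded mat2M_vn).
- by move=> a T S T' S' h h'; apply: matching_add => //; exact: Zscale.
- by move=> T S T' S'; exact: matching_comp.
- move=> T S; elim=> [n Nn|d Dd|{}T {}S T' S' h IH h' IH'|{}T {}S T' S' h IH h' IH'].
  + have [_ _ _ <-//] := ltheta_hom; apply: matching_theta; exact: (vn_adj mat2N_vn).
  + have [_ _ _ <-//] := l1_hom; rewrite -twist_adj//; apply: matching_one.
    exact: (vn_adj mat2D_vn).
  + have [PT MS] := matching_in h; have [PT' MS'] := matching_in h'.
    rewrite (adj_add (vn_bounded vnP PT) (vn_bounded vnP PT')).
    rewrite (adj_add (vn_bounded mat2M_vn MS) (vn_bounded mat2M_vn MS')).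
    exact: matching_add.
  + have [PT MS] := matching_in h; have [PT' MS'] := matching_in h'.
    rewrite (adj_comp (vn_bounded vnP PT) (vn_bounded vnP PT')).
    rewrite (adj_comp (vn_bounded mat2M_vn MS) (vn_bounded mat2M_vn MS')).
    exact: matching_comp.
Qed.

Lemma bicomm_matching : bicomm matching = P.
Proof.
rewrite eqEsubset; split.
  have [_ _ <-] := vnP; apply/commutant_anti/commutant_anti.
  by move=> T [S /matching_in[]].
have [_ _ -> _ _] := afp; apply: bigcap_inf; split; first exact: (bicomm_vn matching_star).
move=> _ [[n Nn <-]|[d Dd <-]].
  exact: (src_bicomm matching_star (matching_theta Nn)).
exact: (src_bicomm matching_star (matching_one Dd)).
Qed.

Lemma block_e12 (a : op H) : block 0 a 0 0 = fun x => (a x.2, 0).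
Proof. by apply/funext => x; rewrite /block /= add0r addr0. Qed.
Lemma block_e21 (a : op H) : block 0 0 a 0 = fun x => (0, a x.1).
Proof. by apply/funext => x; rewrite /block /= !addr0. Qed.

(** An operator that commutes with the second components commutes with the matrix
    units of [mat2 N], hence is scalar with entry [c]; commuting with [mat2 N] and
    with the twisted matrix units of [mat2 D], [c] commutes with [N], [u] and
    [adj u]. *)
Lemma bicomm_flip_matching : bicomm (flip matching) = mat2 M.
Proof.
have [D1 D0] := (vn_id vnD, vn_zero vnD); have [N1 N0] := (vn_id vnN, vn_zero vnN).
rewrite eqEsubset; split.
  have [_ _ <-] := mat2M_vn; apply/commutant_anti/commutant_anti.
  by move=> S [T /matching_in[]].
move=> S MS; split; first exact: (vn_bounded mat2M_vn).
move=> C [bC hC]; have lC := bounded_linear bC.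
have [b11 b12 b21 b22] := corners_bounded bC.
have commN n : mat2 N n -> C \o n = n \o C.
  by move=> Nn; apply: hC; exists (ltheta n); exact: matching_theta.
have commD d : mat2 D d -> C \o twist d = twist d \o C.
  by move=> Dd; apply: hC; exists (l1 d); exact: matching_one.
set c := ul C.
have CE : C = block c 0 0 c.
  have := commN _ (mat2_block N0 N1 N0 N0); rewrite block_e12 => e12.
  have h x y : (C (y, 0)).1 = (C (x, y)).2 /\ 0 = (C (y, 0)).2.
    by have := congr1 (@^~ ((x, y) : dsum H)) e12; rewrite /=; case: (C (y, 0)) => ? ? [-> ->].
  have := commN _ (mat2_block N0 N0 N1 N0); rewrite block_e21 => e21.
  have h' y : (C ((0, y) : dsum H)).1 = 0.
    have := congr1 (@^~ ((y, 0) : dsum H)) e21; rewrite /=.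
    by case: (C (0, y)) => ? ? [-> _].
  apply/funext => -[x y].
  have e : C (x, y) = C (x, 0) + C (0, y).
    by rewrite -(linD _ _ lC); congr C; congr pair; rewrite /= ?addr0 ?add0r.
  rewrite e [LHS]surjective_pairing /block /c /ul; congr pair.
    by rewrite [LHS]/= h'.
  have [e1 _] := h 0 y; have [_ e2] := h 0 x.
  by rewrite [LHS]/= -e2 /= e1.
have bc : bounded_op c by [].
have lc := bounded_linear bc.
have hc : commutant M c.
  have [_ _ _ ME _] := hnn.
  have bS : N `|` [set u] `<=` @bounded_op R H.
    by move=> x [/(vn_bounded vnN)//|->]; exact: u_bounded.
  rewrite ME (vn_genE bS) tricommutant; last exact: adj_closure_bounded.
  have lz := @lin_zero R H.
  have au0 : adj u \o (0 : op H) = 0.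
    by apply/funext => x; exact: (lin0 (vn_linear vnM M_adj_u)).
  have zu : (0 : op H) \o u = 0 by [].
  have cu : c \o u = u \o c.
    have := commD _ (mat2_block D0 D1 D0 D0); rewrite twist_block au0 zu CE => e.
    by have [_ h _ _] := scalar_block_commutes lc lz (vn_linear vnM M_u) lz lz (esym e).
  have cau : c \o adj u = adj u \o c.
    have := commD _ (mat2_block D0 D0 D1 D0); rewrite twist_block au0 zu CE => e.
    by have [_ _ h _] := scalar_block_commutes lc lz lz (vn_linear vnM M_adj_u) lz (esym e).
  have cN n : N n -> c \o n = n \o c.
    move=> Nn; have := commN _ (mat2_block Nn N0 N0 N0); rewrite CE => e.
    by have [h _ _ _] := scalar_block_commutes lc (vn_linear vnN Nn) lz lz lz (esym e).
  split=> // x [[Nx|->]|[y [Ny|->] <-]] //; first exact: cN.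
  by apply: cN; exact: (vn_adj vnN).
have [a11 [a12 [a21 [a22 [A11 A12 A21 A22 ->]]]]] := MS.
by rewrite CE; apply: block_commutes_scalar => //; rewrite hc.2.
Qed.

(** * Words in the amalgamated free product *)

Definition letter (b : bool) (t : op K) (s : op (dsum H)) : Prop :=
  if b then exists2 n, mat2 N n & t = ltheta n /\ s = n
  else exists2 d, mat2 D d & t = l1 d /\ s = twist d.

Definition ker_letter (b : bool) (t : op K) (s : op (dsum H)) : Prop :=
  if b then exists n, [/\ mat2 N n, diag_map ED Eth n = 0, t = ltheta n & s = n]
  else exists d, [/\ mat2 D d, diag_map idfun idfun d = 0, t = l1 d & s = twist d].

(** The amalgamated subalgebra, on which the two kinds of letters agree. *)
Definition diag_letter (t : op K) (s : op (dsum H)) : Prop :=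
  exists a d, [/\ D a, D d, t = ltheta (block a 0 0 (theta d)) & s = block a 0 0 (theta d)].

Lemma ltheta_l1 a d : D a -> D d ->
  ltheta (block a 0 0 (theta d)) = l1 (block a 0 0 d).
Proof.
move=> Da Dd; have [_ [_ _ h] _ _ _] := afp.
have := h (block a 0 0 d); rewrite /diag_map !ul_block// !dr_block//.
by apply; exists a, d.
Qed.

Lemma diag_letterD a d : D a -> D d -> mat2 D (block a 0 0 d).
Proof. by move=> Da Dd; apply: mat2_block => //; exact: (vn_zero vnD). Qed.

Lemma diag_letterN a d : D a -> D d -> mat2 N (block a 0 0 (theta d)).
Proof.
move=> Da Dd; apply: mat2_block; try exact: (vn_zero vnN); first exact: DN.
exact: theta_N.
Qed.

Lemma diag_is_letter b t s : diag_letter t s -> letter b t s.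
Proof.
move=> [a [d [Da Dd -> ->]]]; case: b.
  by exists (block a 0 0 (theta d)) => //; exact: diag_letterN.
exists (block a 0 0 d); first exact: diag_letterD.
by rewrite ltheta_l1// twist_diag.
Qed.

Lemma letter_comp b t s t' s' : letter b t s -> letter b t' s' ->
  letter b (t \o t') (s \o s').
Proof.
case: b => -[n Nn [-> ->]] [n' Nn' [-> ->]].
  by exists (n \o n'); [exact: (vn_comp mat2N_vn)|rewrite ltheta_comp].
by exists (n \o n'); [exact: (vn_comp mat2D_vn)|rewrite l1_comp// twist_comp].
Qed.

Lemma ker_is_letter b t s : ker_letter b t s -> letter b t s.
Proof. by case: b => -[n [Nn _ -> ->]]; exists n. Qed.

Lemma block_split (a b c d a' d' : op H) :
  block a b c d = block (a - a') b c (d - d') + block a' 0 0 d'.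
Proof.
by apply/funext => x; rewrite /block; congr pair; rewrite /= ?add0r ?addr0;
  rewrite ?addrA ?subrK// [in RHS]addrAC subrK.
Qed.

Lemma letter_split b t s : letter b t s -> exists tk sk td sd,
  [/\ ker_letter b tk sk, diag_letter td sd, t = tk + td & s = sk + sd].
Proof.
have [[EDin EDid EDlin _ _] _ _] := ED_ce; have [[Ethin Ethid Ethlin _ _] _ _] := Eth_ce.
case: b => -[_ [n11 [n12 [n21 [n22 [h11 h12 h21 h22 ->]]]]] [-> ->]].
  have Da := EDin _ h11; have [d Dd ed] := Ethin _ h22.
  have h11' := DN Da; have h22' : N (Eth n22) by rewrite -ed; exact: theta_N.
  have Nk : mat2 N (block (n11 - ED n11) n12 n21 (n22 - Eth n22)).
    by apply: mat2_block => //; exact: (vn_sub vnN).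
  have Nd := diag_letterN Da Dd; rewrite ed in Nd.
  exists (ltheta (block (n11 - ED n11) n12 n21 (n22 - Eth n22))),
    (block (n11 - ED n11) n12 n21 (n22 - Eth n22)),
    (ltheta (block (ED n11) 0 0 (Eth n22))), (block (ED n11) 0 0 (Eth n22)).
  split.
  - exists (block (n11 - ED n11) n12 n21 (n22 - Eth n22)); split=> //.
    rewrite diag_mapE //; [|exact: (vn_sub vnN)..].
    rewrite (linear_on_sub EDlin)// (linear_on_sub Ethlin)// (EDid _ Da).
    by rewrite (Ethid (Eth n22)) ?subrr ?block0//; exists d.
  - by exists (ED n11), d; rewrite ed.
  - by rewrite -(linear_on_add ltheta_lin)// -block_split.
  - by rewrite -block_split.
have D0 := vn_zero vnD.
have Dk : mat2 D (block 0 n12 n21 0) by exact: mat2_block.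
have Dd : mat2 D (block n11 0 0 n22) by exact: mat2_block.
have e : block n11 n12 n21 n22 = block 0 n12 n21 0 + block n11 0 0 n22.
  by rewrite (block_split n11 n12 n21 n22 n11 n22) !subrr.
exists (l1 (block 0 n12 n21 0)), (twist (block 0 n12 n21 0)),
  (l1 (block n11 0 0 n22)), (twist (block n11 0 0 n22)); split.
- exists (block 0 n12 n21 0); split=> //.
  rewrite /diag_map ul_block ?dr_block ?block0//; exact: lin0 (vn_linear vnD _).
- by exists n11, n22; rewrite ltheta_l1 ?twist_diag.
- by rewrite -(linear_on_add l1_lin)// -e.
- rewrite e; apply/funext => x; exact: (linD _ _ twist_op_linear).
Qed.

Lemma diag_ker b t s t' s' : diag_letter t s -> ker_letter b t' s' ->
  ker_letter b (t \o t') (s \o s').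
Proof.
move=> [a [d [Da Dd -> ->]]].
have [la ld] : linear a /\ linear (theta d).
  by split; [exact: vn_linear Da|exact: vn_linear (theta_N Dd)].
have Ntd := theta_N Dd; have Na := DN Da.
have lz := @lin_zero R H.
case: b => -[_ [[n11 [n12 [n21 [n22 [h11 h12 h21 h22 ->]]]]] k -> ->]].
  have e : block a 0 0 (theta d) \o block n11 n12 n21 n22 =
      block (a \o n11) (a \o n12) (theta d \o n21) (theta d \o n22).
    by apply/funext => x; rewrite /block /= !add0r !addr0; congr pair;
      rewrite ?(linD _ _ la) ?(linD _ _ ld).
  move: k; rewrite diag_mapE// -block0 => k.
  have [[EDin _ _ _ _] _ _] := ED_ce; have [[Ethin _ _ _ _] _ _] := Eth_ce.
  have lE : linear (Eth n22).
    by have [d' Dd' <-] := Ethin _ h22; exact: vn_linear (theta_N Dd').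
  have [k1 _ _ k2] := block_inj (vn_linear vnD (EDin _ h11)) lz lz lE lz lz lz lz k.
  have Nn : mat2 N (block a 0 0 (theta d) \o block n11 n12 n21 n22).
    by apply: (vn_comp mat2N_vn); [exact: diag_letterN|exact: mat2_block].
  exists (block a 0 0 (theta d) \o block n11 n12 n21 n22); split=> //.
    rewrite e diag_mapE; try (by apply: (vn_comp vnN)).
    by rewrite ED_ker// Eth_ker// block0.
  by rewrite ltheta_comp//; [exact: diag_letterN|exact: mat2_block].
have D0 := vn_zero vnD.
have lin x : D x -> linear x by exact: vn_linear.
move: k; rewrite /diag_map ul_block ?dr_block; try by apply: lin0; exact: lin.
rewrite -block0 => k.
have [k1 _ _ k2] := block_inj (lin _ h11) lz lz (lin _ h22) lz lz lz lz k.
have Dn : mat2 D (block a 0 0 d \o block n11 n12 n21 n22).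
  by apply: (vn_comp mat2D_vn); [exact: diag_letterD|exact: mat2_block].
exists (block a 0 0 d \o block n11 n12 n21 n22); split=> //.
- have -> : block a 0 0 d \o block n11 n12 n21 n22 = block 0 (a \o n12) (d \o n21) 0.
    rewrite k1 k2; apply/funext => x; rewrite /block /= !add0r !addr0.
    by congr pair; rewrite ?add0r ?addr0.
  rewrite /diag_map ul_block ?dr_block ?block0//.
    exact: lin0 (vn_linear vnD (vn_comp vnD Dd h21)).
  exact: lin0 (vn_linear vnD (vn_comp vnD Da h12)).
- by rewrite l1_comp ?ltheta_l1//; [exact: diag_letterD|exact: mat2_block].
- by rewrite twist_comp twist_diag.
Qed.

Inductive word : bool -> op K -> op (dsum H) -> Prop :=
| word1 b t s : ker_letter b t s -> word b t s
| word_cons b t s t' s' : ker_letter b t s -> word (~~ b) t' s' ->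
    word b (t \o t') (s \o s').

(** Together with the diagonal algebra, alternating words in centered letters
    span an algebra. *)
Inductive word_span : op K -> op (dsum H) -> Prop :=
| word_span_diag t s : diag_letter t s -> word_span t s
| word_span_word b t s : word b t s -> word_span t s
| word_spanD t s t' s' : word_span t s -> word_span t' s' -> word_span (t + t') (s + s').

Lemma diag_word b t s t' s' : diag_letter t s -> word b t' s' ->
  word b (t \o t') (s \o s').
Proof.
move=> dt w; case: w dt => {b t' s'} [b t' s' k|b t1 s1 t2 s2 k w] dt.
  exact/word1/diag_ker.
by apply: (@word_cons b (t \o t1) (s \o s1)) => //; exact: diag_ker.
Qed.

Lemma letter_span b t s : letter b t s -> word_span t s.
Proof.
move=> /letter_split[tk [sk [td [sd [k d -> ->]]]]].
by apply: word_spanD; [exact: (word_span_word (word1 k))|exact: word_span_diag].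
Qed.

(** When the letters are of the same kind, their product is a letter: its
    centered part replaces the first letter of the word, and its diagonal part
    is absorbed by the next letter. *)
Lemma ker_letter_word b b' t s t' s' : ker_letter b t s -> word b' t' s' ->
  word_span (t \o t') (s \o s').
Proof.
move=> k w; have [bb|nb] := eqVneq b' (~~ b).
  by rewrite bb in w; exact: (word_span_word (word_cons k w)).
have {nb} e : b' = b by case: b b' nb {k w} => -[].
rewrite {}e in w *; case: w k => {b t' s'} [b t' s' k'|b t1 s1 t2 s2 k' w] k.
  exact: letter_span (letter_comp (ker_is_letter k) (ker_is_letter k')).
have /letter_split[tk [sk [td [sd [k2 d et es]]]]] :=
  letter_comp (ker_is_letter k) (ker_is_letter k').
have -> : t \o (t1 \o t2) = (tk \o t2) + (td \o t2).
  by rewrite compA et.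
have -> : s \o (s1 \o s2) = (sk \o s2) + (sd \o s2).
  by rewrite compA es.
apply: word_spanD; first exact: (word_span_word (word_cons k2 w)).
exact: (word_span_word (diag_word d w)).
Qed.

Lemma letter_linear b t s : letter b t s -> linear t /\ linear s.
Proof.
case: b => -[n Nn [-> ->]]; split.
- exact: (vn_linear vnP (ltheta_in Nn)).
- exact: (vn_linear mat2N_vn Nn).
- exact: (vn_linear vnP (l1_in Nn)).
- exact: (vn_linear mat2M_vn (twist_M Nn)).
Qed.

Lemma letter_word_span b t s t' s' : letter b t s -> word_span t' s' ->
  word_span (t \o t') (s \o s').
Proof.
move=> lt; have [lint lins] := letter_linear lt.
elim=> [{}t' {}s' d|b' {}t' {}s' w|t1 s1 t2 s2 _ h1 _ h2].
- exact: letter_span (letter_comp lt (diag_is_letter b d)).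
- have [tk [sk [td [sd [k d -> ->]]]]] := letter_split lt.
  by apply: word_spanD; [exact: ker_letter_word k w|exact: (word_span_word (diag_word d w))].
- have -> : t \o (t1 + t2) = (t \o t1) + (t \o t2).
    by apply/funext => x; exact: (linD _ _ lint).
  have -> : s \o (s1 + s2) = (s \o s1) + (s \o s2).
    by apply/funext => x; exact: (linD _ _ lins).
  exact: word_spanD.
Qed.

Lemma matching_word_span T S : matching T S -> word_span T S.
Proof.
suff h : matching T S -> forall t s, word_span t s -> word_span (T \o t) (S \o s).
  move=> /h /(_ idfun idfun); apply.
  apply: (@letter_span true); exists idfun; first exact: (vn_id mat2N_vn).
  by rewrite ltheta_id.
elim=> [n Nn|d Dd|{}T {}S T' S' _ h _ h'|{}T {}S T' S' _ h _ h'] t s ts.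
- by apply: (@letter_word_span true) => //; exists n.
- by apply: (@letter_word_span false) => //; exists d.
- exact: (word_spanD (h _ _ ts) (h' _ _ ts)).
- exact: (h _ _ (h' _ _ ts)).
Qed.

Lemma word_free b t s : word b t s -> exists w : seq (bool * op K),
  [/\ w != [::], ohead w = Some (b, (head (b, 0) w).2),
    sorted (fun a b : bool * op K => a.1 != b.1) w,
    forall (b : bool) (T : op K), (b, T) \in w ->
       (if b then ker_image (mat2 N) (diag_map ED Eth) ltheta
        else ker_image (mat2 D) (diag_map idfun idfun) l1) T
    & t = op_prod (map snd w)].
Proof.
have kl c T S : ker_letter c T S ->
    (if c then ker_image (mat2 N) (diag_map ED Eth) ltheta
     else ker_image (mat2 D) (diag_map idfun idfun) l1) T.
  by case: c => -[n [Nn n0 -> _]]; exists n.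
elim=> [{}b {}t {}s k|{}b {}t {}s t' s' k _ [w [w0 hw sw kw ->]]].
  exists [:: (b, t)]; split=> // c T; rewrite inE => /eqP[-> ->]; exact: kl k.
exists ((b, t) :: w); split=> //.
  case: w w0 hw sw kw => // -[c T] w _ [->] /= sw _.
  by rewrite sw andbT; case: (b).
move=> c T; rewrite inE => /orP[/eqP[-> ->]|/kw//]; exact: kl k.
Qed.

Lemma E_word b t s : word b t s -> E t = 0.
Proof.
move=> /word_free[w [w0 _ sw kw ->]].
by have [_ _ _ _ h] := afp; exact: h.
Qed.

Lemma ker_letter_blocks b t s : ker_letter b t s ->
  if b then ker_block s else stable_block s.
Proof.
have lz := @lin_zero R H.
case: b => -[_ [[n11 [n12 [n21 [n22 [h11 h12 h21 h22 ->]]]]] k _ ->]].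
  move: k; rewrite diag_mapE// -block0 => k.
  have [[EDin _ _ _ _] _ _] := ED_ce; have [[Ethin _ _ _ _] _ _] := Eth_ce.
  have lE : linear (Eth n22).
    by have [d' Dd' <-] := Ethin _ h22; exact: vn_linear (theta_N Dd').
  have [k1 _ _ k2] := block_inj (vn_linear vnD (EDin _ h11)) lz lz lE lz lz lz lz k.
  by exists n11, n12, n21, n22.
have lin x : D x -> linear x by exact: vn_linear.
move: k; rewrite /diag_map ul_block ?dr_block; try by apply: lin0; exact: lin.
rewrite -block0 => k.
have [k1 _ _ k2] := block_inj (lin _ h11) lz lz (lin _ h22) lz lz lz lz k.
exists n12, n21; split=> //; rewrite twist_block k1 k2; congr block.
by apply/funext => x; exact: (lin0 (vn_linear vnM M_adj_u)).
Qed.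

(** The words of the free product become matrices of reduced words of the HNN
    extension. A word that starts in the first algebra carries one more matrix
    over [N] on the left. *)
Lemma word_blocks b t s : word b t s ->
  if b then ker_block s \/
    exists n r, [/\ ker_block n, reduced_block r & s = n \o r]
  else reduced_block s.
Proof.
elim=> [{}b {}t {}s /ker_letter_blocks|{}b {}t {}s t' s' /ker_letter_blocks].
  case: b => h; first by left.
  exact: stable_reduced_block.
case: b => /= h _ h'; first by right; exists s, s'.
case: h' => [h'|[n [r [hn hr ->]]]].
  exact: (stable_ker_block h h').
exact: (stable_ker_reduced_block h hn hr).
Qed.

Lemma diag_expect_word b t s : word b t s -> diag_expect s = 0.
Proof.
move=> /word_blocks; case: b => [[h|[n [r [hn hr ->]]]]|h].
- exact: (diag_expect_ker_block h).
- exact: (diag_expect_ker_reduced_block hn hr).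
- exact: (diag_expect_reduced_block h).
Qed.

Lemma word_span_in t s : word_span t s -> P t /\ mat2 M s.
Proof.
have lin b' t' s' : letter b' t' s' -> P t' /\ mat2 M s'.
  case: b' => -[n Nn [-> ->]].
    by split; [exact: ltheta_in|exact: (mat2_sub NM)].
  by split; [exact: l1_in|exact: twist_M].
elim=> [{}t {}s d|b {}t {}s w|{}t {}s t' s' _ [Pt Ms] _ [Pt' Ms']].
- exact: lin (diag_is_letter true d).
- elim: w => [{}b {}t {}s k|{}b {}t {}s t' s' k _ [Pt Ms]].
    exact: lin (ker_is_letter k).
  have [Pt' Ms'] := lin _ _ _ (ker_is_letter k).
  by split; [exact: (vn_comp vnP)|exact: (vn_comp mat2M_vn)].
- by split; [exact: (vn_add vnP)|exact: (vn_add mat2M_vn)].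
Qed.

(** Both expectations kill the alternating words and fix the diagonal
    algebra. *)
Lemma E_match T S : matching T S -> E T = ltheta (diag_expect S).
Proof.
move=> /matching_word_span; elim=> [t s|b t s w|t s t' s' h IH h' IH'].
- move=> [a [d [Da Dd -> ->]]]; have Nd := diag_letterN Da Dd.
  by rewrite E_ltheta// diag_expect_N.
- by rewrite (E_word w) (diag_expect_word w) ltheta0.
- have [Pt Ms] := word_span_in h; have [Pt' Ms'] := word_span_in h'.
  have [[_ _ Elin _ _] _ _] := E_ce.
  have := diag_expect_lin 1 Ms Ms'; rewrite !scale1r => ->.
  rewrite (linear_on_add Elin)// IH IH' (linear_on_add ltheta_lin)//;
    exact: diag_expect_in.
Qed.

(** * The isomorphism *)

Lemma ranges_bounded : D `<=` @bounded_op R H /\ [set theta d | d in D] `<=` @bounded_op R H.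
Proof.
split=> [d Dd|_ [d Dd <-]]; first exact: (vn_bounded vnD).
exact: (vn_bounded vnN (theta_N Dd)).
Qed.

(** The diagonal entries of [adj s \o s] are sums of two squares
    [adj a \o a], one for each entry of a column of [s]; the expectations are
    faithful on such positive elements. *)
Lemma diag_expect_faithful s : mat2 M s -> diag_expect (adj s \o s) = 0 -> s = 0.
Proof.
move=> [a [b [c [d [Ma Mb Mc Md ->]]]]].
have [ba bb bc bd] : [/\ bounded_op a, bounded_op b, bounded_op c & bounded_op d].
  by split; exact: (vn_bounded vnM).
have Mg x y : M x -> M y -> M ((adj x \o x) + (adj y \o y)).
  by move=> Mx My; apply: (vn_add vnM); apply: (vn_comp vnM) => //; exact: (vn_adj vnM).
have pg x y : M x -> M y -> pos_op ((adj x \o x) + (adj y \o y)).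
  by move=> Mx My; apply: pos_op_add; apply: adj_comp_pos; exact: (vn_bounded vnM).
have [bD bT] := ranges_bounded.
have bN : N `<=` @bounded_op R H by move=> x; exact: (vn_bounded vnN).
have EMpos x : M x -> pos_op x -> pos_op (EM x).
  by have [[_ _ _ h _] _ _] := EM_ce; exact: h.
rewrite (adj_block ba bb bc bd) block_comp;
  [|exact: bounded_linear (adj_bounded _)..].
rewrite diag_expectE; [|exact: Mg| | |exact: Mg]; last 2 first.
- by apply: (vn_add vnM); apply: (vn_comp vnM) => //; exact: (vn_adj vnM).
- by apply: (vn_add vnM); apply: (vn_comp vnM) => //; exact: (vn_adj vnM).
rewrite -block0 => e.
have lz := @lin_zero R H.
have [[EDin _ _ _ _] _ _] := ED_ce; have [[Ethin _ _ _ _] _ _] := Eth_ce.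
have [e1 _ _ e2] : [/\ ED (EM ((adj a \o a) + (adj c \o c))) = 0, 0 = 0 :> op H,
    0 = 0 :> op H & Eth (EM ((adj b \o b) + (adj d \o d))) = 0].
  apply: block_inj e => //.
    by apply/bounded_linear/bD/EDin/EM_in; exact: Mg.
  by apply/bounded_linear/bT/Ethin/EM_in; exact: Mg.
have EM0pos x : M x -> pos_op x -> EM x = 0 -> x = 0.
  exact: (cond_exp_pos_faithful vnM bN EM_ce).
have [-> ->] : a = 0 /\ c = 0.
  apply: gram_eq0 => //; apply: EM0pos; [exact: Mg|exact: pg|].
  apply: (cond_exp_pos_faithful vnN bD ED_ce) e1; first by apply: EM_in; exact: Mg.
  by apply: EMpos; [exact: Mg|exact: pg].
have [-> ->] : b = 0 /\ d = 0.
  apply: gram_eq0 => //; apply: EM0pos; [exact: Mg|exact: pg|].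
  apply: (cond_exp_pos_faithful vnN bT Eth_ce) e2; first by apply: EM_in; exact: Mg.
  by apply: EMpos; [exact: Mg|exact: pg].
by [].
Qed.

(** Only the two diagonal corners are involved, and there the expectation is
    [ED \o EM] or [Eth \o EM]. *)
Lemma nfun_diag_expect (f : op (dsum H) -> R[i]) : nfun (mat2 N) f ->
  (forall S T, mat2 N S -> mat2 N T -> f (S + T) = f S + f T) ->
  nfun (mat2 M) (fun S => f (diag_expect S)).
Proof.
move=> nf fD.
have bN : N `<=` @bounded_op R H by move=> x; exact: (vn_bounded vnN).
have bM : M `<=` @bounded_op R H by move=> x; exact: (vn_bounded vnM).
have bM2 := mat2_bounded bM.
have sN := vn_star_algebra vnN; have sM := vn_star_algebra vnM.
have N0 := vn_zero vnN.
have [[EDin _ EDlin _ _] _ EDn] := ED_ce; have [[Ethin _ Ethlin _ _] _ Ethn] := Eth_ce.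
have [[_ _ EMlin _ _] _ EMn] := EM_ce.
have EDN x : N x -> N (ED x) by move=> /EDin/DN.
have EthN x : N x -> N (Eth x) by move=> /Ethin[d Dd <-]; exact: theta_N.
have f1 : nfun N (fun a => f (block a 0 0 0)).
  have h : forall a, N a -> mat2 N (@inl2 R H \o a \o @fst2 R H).
    by move=> a Na; rewrite -block_inl; exact: mat2_block.
  have := nfun_compress (adjp_sym (@inl2_adjp R H))
    (bdd_adj (@inl2_adjp R H) (@inl2_bdd R H)) bN nf h.
  by apply: nfun_ext => a _; rewrite block_inl.
have f2 : nfun N (fun a => f (block 0 0 0 a)).
  have h : forall a, N a -> mat2 N (@inr2 R H \o a \o @snd2 R H).
    by move=> a Na; rewrite -block_inr; exact: mat2_block.
  have := nfun_compress (adjp_sym (@inr2_adjp R H))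
    (bdd_adj (@inr2_adjp R H) (@inr2_bdd R H)) bN nf h.
  by apply: nfun_ext => a _; rewrite block_inr.
have {}f1 := normal_pullback sN bN EDN EDlin EDn f1.
have {}f2 := normal_pullback sN bN EthN Ethlin Ethn f2.
have {}f1 := normal_pullback sM bN EM_in EMlin EMn f1.
have {}f2 := normal_pullback sM bN EM_in EMlin EMn f2.
have cM S : mat2 M S -> M (@fst2 R H \o S \o @inl2 R H) /\ M (@snd2 R H \o S \o @inr2 R H).
  move=> [a [b [c [d [Ma Mb Mc Md ->]]]]].
  have -> : @fst2 R H \o block a b c d \o @inl2 R H = a.
    by apply: ul_block; exact: (lin0 (vn_linear vnM Mb)).
  have -> // : @snd2 R H \o block a b c d \o @inr2 R H = d.
  by apply: dr_block; exact: (lin0 (vn_linear vnM Mc)).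
have g1 := nfun_compress (@inl2_adjp R H) (@inl2_bdd R H) bM2 f1 (fun S h => (cM S h).1).
have g2 := nfun_compress (@inr2_adjp R H) (@inr2_bdd R H) bM2 f2 (fun S h => (cM S h).2).
apply: nfun_ext (nfun_lin 1 bM2 g1 g2) => S MS; rewrite mul1r.
have [M1 M2] := cM _ MS.
rewrite -fD; last 2 first.
- by apply: mat2_block => //; exact/EDN/EM_in.
- by apply: mat2_block => //; exact/EthN/EM_in.
congr f; rewrite /diag_expect /diag_map.
have [a [b [c [d [Ma Mb Mc Md ->]]]]] := MS.
have e1 : @fst2 R H \o block a b c d \o @inl2 R H = a.
  by apply: ul_block; exact: (lin0 (vn_linear vnM Mb)).
have e2 : @snd2 R H \o block a b c d \o @inr2 R H = d.
  by apply: dr_block; exact: (lin0 (vn_linear vnM Mc)).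
rewrite e1 e2 amplifyE// ul_block ?dr_block; last 2 first.
- exact: (lin0 (Nlin (EM_in Mc))).
- exact: (lin0 (Nlin (EM_in Mb))).
by apply/funext => x; rewrite /block; congr pair; rewrite /= ?addr0 ?add0r.
Qed.

Lemma E_range_bounded : E_range `<=` @bounded_op R K.
Proof.
move=> _ [_ [a [d [Da Dd ->]]] <-].
rewrite /diag_map !ul_block ?dr_block//.
by apply: (vn_bounded vnP); apply: ltheta_in; exact: diag_letterN.
Qed.

Lemma isomorphism : exists Phi : op K -> op (dsum H),
  [/\ star_hom P (mat2 M) Phi, set_bij P (mat2 M) Phi,
    forall T S, matching T S -> Phi T = S &
    forall T, P T -> E T = ltheta (diag_expect (Phi T))].
Proof.
have [[Ein _ Elin Epos _] Ef En] := E_ce.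
have sP := vn_star_algebra vnP; have sN := vn_star_algebra mat2N_vn.
have bP : P `<=` @bounded_op R K by move=> T; exact: (vn_bounded vnP).
have FN s : mat2 M s -> mat2 N (diag_expect s) by exact: diag_expect_in.
have := @spatial_isomorphism R K (dsum H) matching K (fun xi T => '[E T xi, xi])
  (fun xi S => '[ltheta (diag_expect S) xi, xi]) matching_star.
rewrite bicomm_matching bicomm_flip_matching => h.
have [| | | | | |Phi [hom bij ext same]] := h.
- move=> xi; apply: (normal_pullback (g := fun T => '[T xi, xi]) sP E_range_bounded Ein Elin En).
  exact: (nfun_vec xi xi E_range_bounded).
- move=> xi; apply: (@nfun_diag_expect (fun n => '[ltheta n xi, xi])) => [|S T NS NT].
    have [_ [[_ _ _ lnorm] _ _] _ _ _] := afp.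
    apply: (normal_pullback (g := fun T => '[T xi, xi]) sN bP ltheta_in ltheta_lin lnorm).
    exact: (nfun_vec xi xi bP).
  by rewrite (linear_on_add ltheta_lin)// ipDl.
- by move=> xi T S Z; rewrite (E_match Z).
- move=> xi T S /matching_in[PT _].
  apply: Epos; first by apply: (vn_comp vnP) => //; exact: (vn_adj vnP).
  exact: adj_comp_pos (bP _ PT).
- move=> p Pp ap pp E0; apply: Ef => //; rewrite ap pp.
  by apply: quadratic_eq0 => //; exact: (bounded_linear (E_range_bounded (Ein _ Pp))).
- move=> p Mp ap pp F0; apply: diag_expect_faithful => //; rewrite ap pp.
  apply: ltheta_inj; [exact: FN|exact: (vn_zero mat2N_vn)|rewrite ltheta0].
  apply: quadratic_eq0 => //; exact: (vn_linear vnP (ltheta_in (FN _ Mp))).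
exists Phi; split=> // T PT.
have MPT : mat2 M (Phi T) by case: hom => hin _ _ _; exact: hin.
have PE : P (E T).
  have [_ [a [d [Da Dd ->]]] <-] := Ein _ PT.
  rewrite /diag_map !ul_block ?dr_block//.
  by apply: ltheta_in; exact: diag_letterN.
apply/eqP; rewrite -subr_eq0; apply/eqP/quadratic_eq0.
  by apply: (vn_linear vnP); apply: (vn_sub vnP) => //; exact/ltheta_in/FN.
by move=> xi; rewrite ipBl -(same xi _ PT) subrr.
Qed.

Lemma amplify_comp x s : mat2 N x -> mat2 M s ->
  amplify EM (x \o s) = x \o amplify EM s.
Proof.
move=> [x11 [x12 [x21 [x22 [X11 X12 X21 X22 ->]]]]].
move=> [a [b [c [d [Ma Mb Mc Md ->]]]]].
have Mx n y : N n -> M y -> M (n \o y) by move=> /NM Mn My; exact: (vn_comp vnM).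
have EMc n m y z : N n -> N m -> M y -> M z ->
    EM ((n \o y) + (m \o z)) = (n \o EM y) + (m \o EM z).
  move=> Nn Nm My Mz; rewrite EM_D; [|exact: Mx..].
  by rewrite (EM_l Nn My) (EM_l Nm Mz).
rewrite block_comp; [|exact: Nlin..].
rewrite amplifyE; try (by apply: (vn_add vnM); exact: Mx).
rewrite (amplifyE Ma Mb Mc Md) block_comp; [|exact: Nlin..].
by rewrite (EMc _ _ _ _ X11 X12 Ma Mc) (EMc _ _ _ _ X11 X12 Mb Md)
  (EMc _ _ _ _ X21 X22 Ma Mc) (EMc _ _ _ _ X21 X22 Mb Md).
Qed.

Lemma amplify_in s : mat2 M s -> mat2 N (amplify EM s).
Proof.
move=> [a [b [c [d [Ma Mb Mc Md ->]]]]]; rewrite amplifyE//.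
by apply: mat2_block; exact: EM_in.
Qed.

(** Both [Etheta T] and [amplify EM (Phi T)] come from an element of [mat2 N], and
    the two elements have the same expectation after multiplication on the left
    by any element of [mat2 N]; take the adjoint of their difference. *)
Lemma expectation_intertwined (Etheta : op K -> op K) (Phi : op K -> op (dsum H)) :
  cond_exp P (ltheta @` mat2 N) Etheta ->
  (forall T, P T -> E (Etheta T) = E T) ->
  star_hom P (mat2 M) Phi ->
  (forall n, mat2 N n -> Phi (ltheta n) = n) ->
  (forall T, P T -> E T = ltheta (diag_expect (Phi T))) ->
  forall T, P T -> Phi (Etheta T) = amplify EM (Phi T).
Proof.
move=> ce EE [hin _ hcomp _] PhiN PhiE T PT.
have MT := hin _ PT.
have [[n Nn en] cl] : (ltheta @` mat2 N) (Etheta T) /\ (ltheta @` mat2 N) idfun.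
  by split; [case: ce => h _ _ _ _; exact: h|
    exists idfun; [exact: (vn_id mat2N_vn)|exact: ltheta_id]].
rewrite -en PhiN//.
have Nn' := amplify_in MT; set n' := amplify EM (Phi T) in Nn' *.
have key x : mat2 N x -> diag_expect (x \o n) = diag_expect (x \o n').
  move=> Nx; have Px := ltheta_in Nx.
  have Nxn : mat2 N (x \o n) by exact: (vn_comp mat2N_vn).
  have Nxn' : mat2 N (x \o n') by exact: (vn_comp mat2N_vn).
  have PxT : P (ltheta x \o T) by exact: (vn_comp vnP).
  have h : E (ltheta x \o T) = ltheta (diag_expect (x \o n)).
    have xin : (ltheta @` mat2 N) (ltheta x) by exists x.
    rewrite -(EE _ PxT) (cond_exp_l cl ce xin PT) -en.
    by rewrite -(ltheta_comp Nx Nn) (E_ltheta Nxn) (diag_expect_N Nxn).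
  move: h; rewrite (PhiE _ PxT) (hcomp _ _ Px PT) (PhiN _ Nx).
  have MxT : mat2 M (x \o Phi T).
    by apply: (vn_comp mat2M_vn) => //; exact: (mat2_sub NM).
  move=> /ltheta_inj e.
  have <- := e (diag_expect_in MxT) (diag_expect_in (mat2_sub NM Nxn)).
  rewrite (diag_expect_N Nxn') /diag_expect amplify_comp//.
have Nd : mat2 N (n - n') by exact: (vn_sub mat2N_vn).
have Nad := vn_adj mat2N_vn Nd.
apply/eqP; rewrite -subr_eq0; apply/eqP/diag_expect_faithful; first exact: (mat2_sub NM).
have lx := vn_linear mat2N_vn Nad.
have -> : adj (n - n') \o (n - n') =
    (-1) *: (adj (n - n') \o n') + (adj (n - n') \o n).
  rewrite scaleN1r [RHS]addrC; apply/funext => v; exact: (linB (n v) (n' v) lx).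
rewrite diag_expect_lin; try by apply: (mat2_sub NM); exact: (vn_comp mat2N_vn).
by rewrite (key _ Nad) scaleN1r addNr.
Qed.
End HNN.

Theorem proposition2p1 (R : realType) (H : hilbert R)
  (D N : set (op H)) (theta ED Eth : op H -> op H)
  (vnD : von_neumann D) (vnN : von_neumann N) (DN : D `<=` N)
  (sfD : sigma_finite_vn D) (sfN : sigma_finite_vn N)
  (theta_emb : normal_embedding D N theta)
  (ED_ce : faithful_normal_cond_exp N D ED)
  (Eth_ce : faithful_normal_cond_exp N (theta @` D) Eth)
  (M : set (op H)) (EM : op H -> op H) (u : op H)
  (hnn : is_hnn D N theta ED Eth M EM u)
  (K : hilbert R) (P : set (op K)) (E : op K -> op K)
  (ltheta l1 : op (dsum H) -> op K)
  (afp : is_amalgamated_free_product (diag2 D)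
           (mat2 N) (diag_map ED Eth) (diag_map idfun theta)
           (mat2 D) (diag_map idfun idfun) (diag_map idfun idfun)
           P E ltheta l1)
  (Etheta : op K -> op K)
  (Etheta_ce : cond_exp P (ltheta @` mat2 N) Etheta)
  (EEtheta : forall T, P T -> E (Etheta T) = E T) :
  exists Phi : op K -> op (dsum H),
    [/\ star_hom P (mat2 M) Phi /\ set_bij P (mat2 M) Phi,
        Phi @` (ltheta @` mat2 N) = mat2 N,
        forall T, P T -> Phi (Etheta T) = amplify EM (Phi T) &
        [/\ Phi (l1 (block 0 idfun 0 0) \o ltheta (block 0 0 idfun 0)) =
              block u 0 0 0,
            forall n, N n -> Phi (ltheta (block n 0 0 0)) = block n 0 0 0 &
            Phi (ltheta (block 0 idfun 0 0)) = block 0 idfun 0 0]].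
Proof.
have [Phi [hom bij ext PhiE]] :=
  isomorphism vnD vnN DN theta_emb ED_ce Eth_ce hnn afp.
have PhiN n : mat2 N n -> Phi (ltheta n) = n.
  by move=> Nn; apply: ext; exact: matching_theta.
have [N0 N1] := (vn_zero vnN, vn_id vnN); have [D0 D1] := (vn_zero vnD, vn_id vnD).
exists Phi; split.
- by split.
- rewrite eqEsubset; split=> [_ [_ [n Nn <-] <-]|n Nn]; first by rewrite PhiN.
  by exists (ltheta n); [exists n|exact: PhiN].
- exact: (expectation_intertwined vnD vnN DN theta_emb ED_ce Eth_ce hnn afp Etheta_ce).
- split=> [|n Nn|]; [|by apply: PhiN; exact: mat2_block..].
  have e12 : mat2 D (block 0 idfun 0 0) by exact: mat2_block.
  have e21 : mat2 N (block 0 0 idfun 0) by exact: mat2_block.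
  rewrite (ext _ _ (matching_comp (matching_one _ _ _ _ e12) (matching_theta _ _ _ _ e21))).
  rewrite (twist_block hnn); apply/funext => x; rewrite /block /=.
  rewrite !add0r !addr0; congr pair.
  have u0 := lin0 (vn_linear (vnM hnn) (M_adj_u hnn)).
  exact: (etrans (congr2 +%R u0 u0) (addr0 _)).
Qed.
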